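(* Let $\mu$ be a probability measure on $[0,1]$ with $1\in\mathrm{supp}(\mu)$ and $\mu(\{1\})=0$, and let $\nu$ be the measure on the open unit disk $\mathbb{D}$ given by $d\nu(re^{i\theta})=d\mu(r)\times\frac{d\theta}{2\pi}$. Let $n\in\mathbb{N}$, $n\geq 1$, and let $q:[0,1]\to\mathbb{C}$ be in $L^\infty([0,1],\mu)$ and continuously differentiable in a neighborhood of $1$ (in $[0,1]$). Let $T=T_{z^n}$ and $D=T_{q(|z|)}$ be the Toeplitz operators on the weighted Bergman space $\mathcal{A}^2_\nu(\mathbb{D})$ with symbols $z^n$ and $q(|z|)$, and let $$J=[T^*,T]^{-1/2}\big([T^*,D]+[D^*,T]\big)[T^*,T]^{-1/2}.$$ Put $\alpha=q'(1)/(2n)$. Then, expressed in the orthonormal basis $e_k=\gamma_{2k}^{-1/2}z^k$ ($k\ge0$) of $\mathcal{A}^2_\nu(\mathbb{D})$, the operator $J$ is a compact perturbation of $\alpha\mathcal{L}^n+\bar\alpha\mathcal{R}^n$; that is, $J-(\alpha\mathcal{L}^n+\bar\alpha\mathcal{R}^n)$ is (extends to) a compact operator on $\ell^2(\mathbb{N}_0)$.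
   Context: $\mathbb{N}_0=\mathbb{N}\cup\{0\}$. $\mathcal{A}^2_\nu(\mathbb{D})$ is the Hilbert space of analytic functions $f$ on $\mathbb{D}$ with $\int_{\mathbb{D}}|f|^2\,d\nu<\infty$, with inner product $\langle f,g\rangle_\nu=\int_{\mathbb{D}}f\bar g\,d\nu$. For $t\ge0$, $\gamma_t=\int_{[0,1]}x^t\,d\mu(x)$; the functions $e_k=\gamma_{2k}^{-1/2}z^k$, $k\in\mathbb{N}_0$, form an orthonormal basis of $\mathcal{A}^2_\nu(\mathbb{D})$, and $\mathcal{A}^2_\nu(\mathbb{D})$ is identified with $\ell^2(\mathbb{N}_0)$ by sending $e_k$ to the $k$-th standard basis vector. $P_\nu$ is the orthogonal projection of $L^2(\mathbb{D},d\nu)$ onto $\mathcal{A}^2_\nu(\mathbb{D})$, and for a bounded symbol $\varphi$ the Toeplitz operator is $T_\varphi f=P_\nu(\varphi f)$. $\mathcal{L}$ and $\mathcal{R}$ are the left and right shifts on $\ell^2(\mathbb{N}_0)$: $\mathcal{L}(x_0,x_1,x_2,\dots)=(x_1,x_2,\dots)$ and $\mathcal{R}(x_0,x_1,\dots)=(0,x_0,x_1,\dots)$. For operators $A,B$, $[A,B]=AB-BA$. The operator $[T^*,T]$ is diagonal in the basis $\{e_k\}$ with strictly positive diagonal entries, and $[T^*,T]^{-1/2}$ is the (possibly unbounded) diagonal operator whose entries are the $-1/2$ powers of these; $J$ is a priori defined on finite linear combinations of the $e_k$. *)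

(* Defs.v *)
From HB Require Import structures.
From mathcomp Require Import all_boot all_order all_algebra.
From mathcomp Require Import complex.
From mathcomp Require Import all_classical all_reals all_analysis.
From mathcomp Require Import measurable_realfun.

Set Implicit Arguments.
Unset Strict Implicit.
Unset Printing Implicit Defensive.

Import Order.TTheory GRing.Theory Num.Theory.
Import numFieldNormedType.Exports.
Import Normc.

Local Open Scope classical_set_scope.
Local Open Scope ring_scope.
Local Open Scope complex_scope.

(* The topology of the complex plane is the one that MathComp-Analysis puts on
   [R[i]^o]; the annotations [: R[i]^o] below only serve to select it. *)

Section Complex.
Context {R : realType}.

(* [normc] is the modulus with values in R, whereas the norm [`|z|] of z : R[i]
   lives in R[i]. *)
Definition disk : set R[i] := [set z | normc z < 1].

Definition analytic_at (f : R[i] -> R[i]) (a : R[i]) : Prop :=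
  exists (c : nat -> R[i]) (rho : R), 0 < rho /\
    forall z : R[i], normc (z - a) < rho ->
      series (fun k => c k * (z - a) ^+ k : R[i]^o) @ \oo --> (f z : R[i]^o).

(* Meaningful when the real and imaginary parts of f are integrable. *)
Definition integralC d (T : measurableType d) (m : {measure set T -> \bar R})
    (A : set T) (f : T -> R[i]) : R[i] :=
  (\int[m]_(x in A) complex.Re (f x))%R +i* (\int[m]_(x in A) complex.Im (f x))%R.

End Complex.

Definition supp {R : realType} (mu : {measure set (measurableTypeR R) -> \bar R})
  : set R :=
  [set x | forall U : set R, open U -> U x -> (0 < mu U)%E].

Section RadialMeasure.
Context {R : realType}.

(* The plane, as a measurable space, is R * R with the product of the Borel
   sigma-algebras; [to_complex] identifies it with R[i]. *)
Definition to_complex (p : R * R) : R[i] := p.1 +i* p.2.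

Definition polar (p : measurableTypeR R * measurableTypeR R) : R * R :=
  (p.1 * cos p.2, p.1 * sin p.2).

Lemma measurable_polar : measurable_fun setT polar.
Proof.
have m1 : measurable_fun setT (fst : measurableTypeR R * measurableTypeR R -> R).
  exact: measurable_fst.
have mcs (g : R -> R) : continuous g -> measurable_fun setT
    (fun p : measurableTypeR R * measurableTypeR R => g p.2).
  move=> cg; apply: (measurableT_comp (f := g)); last exact: measurable_snd.
  exact: continuous_measurable_fun.
apply: measurable_fun_pair.
- exact: (measurable_funM m1 (mcs _ (@continuous_cos R))).
- exact: (measurable_funM m1 (mcs _ (@continuous_sin R))).
Qed.

HB.instance Definition _ :=
  isMeasurableFun.Build _ _ _ _ polar measurable_polar.

Lemma lt0_2pi : 0 < 2 * pi :> R.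
Proof. by rewrite mulr_gt0// pi_gt0. Qed.

Variable mu : probability (measurableTypeR R) R.

(* The law of r e^(i theta) when (r, theta) is distributed according to the
   product of mu with the uniform law d theta / (2 pi) on [0, 2 pi]. *)
Definition nu : probability (R * R)%type R :=
  distribution (mu \x uniform_prob lt0_2pi)%E polar.

Definition plane_disk : set (R * R) := to_complex @^-1` disk.

Definition inner (f g : R[i] -> R[i]) : R[i] :=
  integralC nu plane_disk
    (fun p => f (to_complex p) * ((g (to_complex p))^*)%C).

(* A function on the disk is represented by its extension by 0 to the plane. *)
Definition bergman : set (R[i] -> R[i]) :=
  [set f | [/\ forall z, disk z -> analytic_at f z,
               forall z, ~ disk z -> f z = 0
             & (\int[nu]_(p in plane_disk) (normc (f (to_complex p)) ^+ 2)%:E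
                < +oo)%E]].

Definition gamma_ (t : R) : R := (\int[mu]_(x in `[0%R, 1%R]) (x `^ t))%R.

Definition e_ (k : nat) (z : R[i]) : R[i] :=
  if z \in disk then (gamma_ (2 * k)%:R `^ (- 2^-1))%:C * z ^+ k else 0.

(* The operators below are total functions on R[i] -> R[i], meaningful on
   [bergman]. The projection and the adjoint are the unique elements with the
   stated properties (and 0 if there is none). *)
Definition bergman_proj (u : R[i] -> R[i]) : R[i] -> R[i] :=
  xget (fun=> 0) [set g | bergman g /\
    forall h, bergman h -> inner (fun z => u z - g z) h = 0].

Definition toeplitz (phi : R[i] -> R[i]) (f : R[i] -> R[i]) : R[i] -> R[i] :=
  bergman_proj (fun z => phi z * f z).

Definition adjoint (A : (R[i] -> R[i]) -> (R[i] -> R[i])) (g : R[i] -> R[i])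
  : R[i] -> R[i] :=
  xget (fun=> 0) [set h | bergman h /\
    forall f, bergman f -> inner (A f) g = inner f h].

Definition commutator (A B : (R[i] -> R[i]) -> (R[i] -> R[i]))
    (f : R[i] -> R[i]) : R[i] -> R[i] :=
  fun z => A (B f) z - B (A f) z.

(* A^(-1/2) for A diagonal in the basis e_ with positive diagonal entries
   <A e_k, e_k>. *)
Definition diag_invsqrt (A : (R[i] -> R[i]) -> (R[i] -> R[i]))
    (f : R[i] -> R[i]) : R[i] -> R[i] :=
  fun z => lim (series (fun k =>
    (complex.Re (inner (A (e_ k)) (e_ k)) `^ (- 2^-1))%:C
      * inner f (e_ k) * e_ k z : R[i]^o) @ \oo).

Definition J_op (n : nat) (q : R -> R[i]) : (R[i] -> R[i]) -> (R[i] -> R[i]) :=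
  let T := toeplitz (fun z => z ^+ n) in
  let D := toeplitz (fun z => q (normc z)) in
  let S := diag_invsqrt (commutator (adjoint T) T) in
  fun f => S (fun z => commutator (adjoint T) D (S f) z
                       + commutator (adjoint D) T (S f) z).

(* The unitary from the Bergman space onto l^2 sending e_k to the k-th standard
   basis vector. *)
Definition coords (f : R[i] -> R[i]) : nat -> R[i] := fun k => inner f (e_ k).

End RadialMeasure.

Section SequenceSpace.
Context {R : realType}.

Definition l2norm2 (x : nat -> R[i]) : \bar R :=
  (\sum_(0 <= k <oo) (normc (x k) ^+ 2)%:E)%E.

Definition l2 : set (nat -> R[i]) := [set x | (l2norm2 x < +oo)%E].

Definition left_shift (x : nat -> R[i]) : nat -> R[i] := fun k => x k.+1.

Definition right_shift (x : nat -> R[i]) : nat -> R[i] :=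
  fun k => if k is k'.+1 then x k' else 0.

(* Linear maps of l^2 that send every bounded sequence to a sequence with a
   norm-convergent subsequence. *)
Definition compact_operator (K : (nat -> R[i]) -> (nat -> R[i])) : Prop :=
  [/\ forall x, l2 x -> l2 (K x),
      forall (a : R[i]) x y, l2 x -> l2 y ->
        K (fun k => a * x k + y k) = (fun k => a * K x k + K y k)
    & forall (x : nat -> nat -> R[i]) (M : R),
        (forall j, (l2norm2 (x j) <= M%:E)%E) ->
        exists (s : nat -> nat) (y : nat -> R[i]),
          [/\ {homo s : i j / (i < j)%N}, l2 y
            & l2norm2 (fun k => K (x (s j)) k - y k) @[j --> \oo] --> 0%E]].

End SequenceSpace.

Section Symbol.
Context {R : realType}.

Definition Linfty01 (mu : probability (measurableTypeR R) R) (q : R -> R[i])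
  : Prop :=
  [/\ measurable_fun (`[0%R, 1%R] : set (measurableTypeR R))
        (fun x => complex.Re (q x)),
      measurable_fun (`[0%R, 1%R] : set (measurableTypeR R))
        (fun x => complex.Im (q x))
    & exists M : R, {ae mu, forall x, 0 <= x <= 1 -> normc (q x) <= M}].

(* q is differentiable (relatively to [0, 1]) with continuous derivative q' on
   some interval ]1 - delta, 1]. *)
Definition C1_near1 (q q' : R -> R[i]) : Prop :=
  exists delta : R, [/\ 0 < delta <= 1,
    forall x : R, 1 - delta < x <= 1 ->
      ((q y - q x) / (y - x)%:C : R[i]^o) @[y --> within `[0, 1] x^']
        --> (q' x : R[i]^o)
  & {within `]1 - delta, 1], continuous (q' : R -> R[i]^o)}].

End Symbol.

(* Main.v *)
Require Import Defs.
From HB Require Import structures.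
From mathcomp Require Import all_boot all_order all_algebra.
From mathcomp Require Import complex.
From mathcomp Require Import all_classical all_reals all_analysis.
From mathcomp Require Import measurable_realfun ring lra.
Import Order.TTheory GRing.Theory Num.Theory.
Import numFieldNormedType.Exports.
Import Normc.
Local Open Scope classical_set_scope.
Local Open Scope ring_scope.
Local Open Scope complex_scope.

Set Implicit Arguments.
Unset Strict Implicit.
Unset Printing Implicit Defensive.

(**
D is diagonal with entries lam k = (int q r^2k dmu) / (int r^2k dmu) and T is a
weighted shift by n, so J is a hermitian matrix supported on the n-th super- and
subdiagonal. With X = r^2n, N = 2n and weight r^2k dmu, the differences
lam (k + n) - lam k and the entries of [T^*, T] are a covariance and a variance:
the k-th entry of the superdiagonal is
  Cov_k(q, X) / Var_k(X) * sqrt (Var_k(X) / Var_(k-n)(X)).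
Because 1 lies in the support of mu, Var_k(X) decays more slowly than every
geometric sequence, so the weights only see r close to 1; there q is affine in X
up to o(X - 1), with slope q'(1) / 2n, and the ratio of variances tends to 1.
Hence the entries tend to alpha, and a band matrix with entries tending to 0 is
compact by a diagonal extraction along an ultrafilter.

That the e_k form a basis needs functions with local power series expansions to
expand globally on the disk; this is Cauchy's formula for circles, obtained by
contracting the circle to a point under the integral sign.
*)

(** The covariance compares [q] at two moving points near 1: [r], and the point whose [N]-th power
    is the weighted mean of [X]. An error [o(X - 1)] alone would not be dominated by the variance;
    increments of [q] have to be affine in [X] up to a small multiple of the increment of [X], and
    this is where the continuity of [q'] near 1 enters. Farther from 1, [q] is only essentially
    bounded, so that region is paid for by [s ^+ p] against the variance. The variance beats every
    such sequence because, with no atom at 1, each left neighbourhood of 1 contains two separated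
    intervals of positive mass. Projection and adjoint are given by characterizations, and the
    inverse square root by a pointwise series, all on total functions. A value is known only once an
    element with the required property has been exhibited; hence a Riesz-Fischer theorem for the
    Bergman space, and the study of all operators on functions with finitely many coordinates, a
    class that each of them preserves. *)

Section ComplexBasics.
Context {R : realType}.
Implicit Types (z w : R[i]) (x y : R).

(** * Modulus, real and imaginary parts *)

Lemma normcE z : normc z = Num.sqrt (complex.Re z ^+ 2 + complex.Im z ^+ 2).
Proof. by case: z. Qed.

Lemma sqr_normcE z : normc z ^+ 2 = complex.Re z ^+ 2 + complex.Im z ^+ 2.
Proof. by rewrite normcE sqr_sqrtr// addr_ge0// sqr_ge0. Qed.

Lemma normc_ge0 z : 0 <= normc z.
Proof. by rewrite normcE sqrtr_ge0. Qed.

Lemma normcX z k : normc (z ^+ k) = normc z ^+ k.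
Proof. by elim: k => [|k ih]; rewrite ?expr0 ?normc1// !exprS normcM ih. Qed.

Lemma normc_sum (I : Type) (r : seq I) (P : pred I) (F : I -> R[i]) :
  normc (\sum_(i <- r | P i) F i) <= \sum_(i <- r | P i) normc (F i).
Proof.
elim/big_ind2 : _ => //; first by rewrite normc0.
by move=> a b c d ab cd; rewrite (le_trans (le_normcD _ _))// lerD.
Qed.

Lemma normc_real x : normc x%:C = `|x|.
Proof. by rewrite normcE/= expr0n addr0 sqrtr_sqr. Qed.

Lemma normc_conj z : normc z^*%C = normc z.
Proof. by case: z => a b; rewrite !normcE/= sqrrN. Qed.

Lemma normc_distC z w : normc (z - w) = normc (w - z).
Proof. by rewrite -normcN opprB. Qed.

Lemma lerB_normc z w : normc z - normc w <= normc (z - w).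
Proof. by rewrite lerBlDr (le_trans _ (le_normcD _ _))// subrK. Qed.

Lemma Re_le_normc z : `|complex.Re z| <= normc z.
Proof. by rewrite normcE -sqrtr_sqr ler_wsqrtr// lerDl sqr_ge0. Qed.

Lemma Im_le_normc z : `|complex.Im z| <= normc z.
Proof. by rewrite normcE -sqrtr_sqr ler_wsqrtr// lerDr sqr_ge0. Qed.

Lemma normc_le_ReIm z : normc z <= `|complex.Re z| + `|complex.Im z|.
Proof.
rewrite -(@ler_pXn2r _ 2)// ?nnegrE ?normc_ge0 ?addr_ge0//.
rewrite sqr_normcE sqrrD !real_normK ?num_real// -addrA lerD2l addrC lerDl.
by rewrite mulrn_wge0// mulr_ge0.
Qed.

Lemma normc_eq0 z : (normc z == 0) = (z == 0).
Proof. by apply/eqP/eqP => [/eq0_normc//|->]; rewrite normc0. Qed.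

Lemma normc_gt0 z : (0 < normc z) = (z != 0).
Proof. by rewrite lt_def normc_eq0 normc_ge0 andbT. Qed.

Lemma mulc_conj z : z * z^*%C = (normc z ^+ 2)%:C.
Proof.
rewrite sqr_normcE; case: z => a b; apply/eqP; rewrite eq_complex/=.
by apply/andP; split; apply/eqP; ring.
Qed.

Lemma complex_eqP z w :
  complex.Re z = complex.Re w -> complex.Im z = complex.Im w -> z = w.
Proof. by case: z w => a b [c d]/= -> ->. Qed.

Lemma ReD z w : complex.Re (z + w) = complex.Re z + complex.Re w.
Proof. by case: z w => a b []. Qed.
Lemma ImD z w : complex.Im (z + w) = complex.Im z + complex.Im w.
Proof. by case: z w => a b []. Qed.
Lemma ReN z : complex.Re (- z) = - complex.Re z.
Proof. by case: z. Qed.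
Lemma ImN z : complex.Im (- z) = - complex.Im z.
Proof. by case: z. Qed.
Lemma ReB z w : complex.Re (z - w) = complex.Re z - complex.Re w.
Proof. by rewrite ReD ReN. Qed.
Lemma ImB z w : complex.Im (z - w) = complex.Im z - complex.Im w.
Proof. by rewrite ImD ImN. Qed.
Lemma ReM z w : complex.Re (z * w) =
  complex.Re z * complex.Re w - complex.Im z * complex.Im w.
Proof. by case: z w => a b []. Qed.
Lemma ImM z w : complex.Im (z * w) =
  complex.Re z * complex.Im w + complex.Im z * complex.Re w.
Proof. by case: z w => a b []. Qed.
Lemma Re_conj z : complex.Re z^*%C = complex.Re z. Proof. by case: z. Qed.
Lemma Im_conj z : complex.Im z^*%C = - complex.Im z. Proof. by case: z. Qed.
Lemma Re_sum (I : Type) (r : seq I) (P : pred I) (F : I -> R[i]) :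
  complex.Re (\sum_(i <- r | P i) F i) = \sum_(i <- r | P i) complex.Re (F i).
Proof. by apply: (big_morph _ ReD). Qed.
Lemma Im_sum (I : Type) (r : seq I) (P : pred I) (F : I -> R[i]) :
  complex.Im (\sum_(i <- r | P i) F i) = \sum_(i <- r | P i) complex.Im (F i).
Proof. by apply: (big_morph _ ImD). Qed.

Lemma real_complexM x y : (x * y)%:C = x%:C * y%:C.
Proof. by rewrite rmorphM. Qed.
Lemma real_complexV x : (x^-1)%:C = (x%:C)^-1.
Proof. by rewrite fmorphV. Qed.

End ComplexBasics.

(** * Limits and series in the complex plane *)

Section ComplexLimits.
Context {R : realType}.

(* Convergence in the plane, expressed through real limits so as not to depend
   on the topology of [R[i]^o]. *)
Definition ccvg {T : Type} (F : set_system T) (f : T -> R[i]) (l : R[i]) : Prop :=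
  (complex.Re (f x) @[x --> F] --> complex.Re l) /\
  (complex.Im (f x) @[x --> F] --> complex.Im l).

Section filter.
Context {T : Type} {F : set_system T} {FF : ProperFilter F}.
Implicit Types (f g : T -> R[i]) (l m : R[i]).

Lemma ccvgD f g l m : ccvg F f l -> ccvg F g m -> ccvg F (fun x => f x + g x) (l + m).
Proof.
move=> [f1 f2] [g1 g2]; split.
  by under eq_fun do rewrite ReD; rewrite ReD; apply: cvgD.
by under eq_fun do rewrite ImD; rewrite ImD; apply: cvgD.
Qed.

Lemma ccvgM f g l m : ccvg F f l -> ccvg F g m -> ccvg F (fun x => f x * g x) (l * m).
Proof.
move=> [f1 f2] [g1 g2]; split.
  by under eq_fun do rewrite ReM; rewrite ReM; apply: cvgB; apply: cvgM.
by under eq_fun do rewrite ImM; rewrite ImM; apply: cvgD; apply: cvgM.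
Qed.

Lemma ccvg_cst l : ccvg F (fun=> l) l.
Proof. by split; apply: cvg_cst. Qed.

Lemma ccvgZ a f l : ccvg F f l -> ccvg F (fun x => a * f x) (a * l).
Proof. by move=> fl; apply: ccvgM => //; exact: ccvg_cst. Qed.

Lemma ccvgN f l : ccvg F f l -> ccvg F (fun x => - f x) (- l).
Proof.
move=> [f1 f2]; split.
  by under eq_fun do rewrite ReN; rewrite ReN; apply: cvgN.
by under eq_fun do rewrite ImN; rewrite ImN; apply: cvgN.
Qed.

Lemma ccvgB f g l m : ccvg F f l -> ccvg F g m -> ccvg F (fun x => f x - g x) (l - m).
Proof. by move=> fl gm; apply: ccvgD => //; exact: ccvgN. Qed.

Lemma ccvg_conj f l : ccvg F f l -> ccvg F (fun x => (f x)^*%C) (l^*%C).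
Proof.
move=> [f1 f2]; split.
  by under eq_fun do rewrite Re_conj; rewrite Re_conj.
by under eq_fun do rewrite Im_conj; rewrite Im_conj; apply: cvgN.
Qed.

Lemma ccvg_unique f l m : ccvg F f l -> ccvg F f m -> l = m.
Proof.
move=> [f1 f2] [g1 g2]; apply: complex_eqP.
  exact: (cvg_unique _ f1 g1).
exact: (cvg_unique _ f2 g2).
Qed.

Lemma ccvg_sum (I : Type) (r : seq I) (f : I -> T -> R[i]) (l : I -> R[i]) :
  (forall i, ccvg F (f i) (l i)) ->
  ccvg F (fun x => \sum_(i <- r) f i x) (\sum_(i <- r) l i).
Proof.
move=> fl; elim: r => [|i r ih].
  rewrite big_nil; under eq_fun do rewrite big_nil; exact: ccvg_cst.
rewrite big_cons; under eq_fun do rewrite big_cons; exact: ccvgD.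
Qed.

Lemma ccvgP f l : ccvg F f l <-> (normc (f x - l) @[x --> F] --> (0 : R)).
Proof.
split => [[f1 f2]|fl].
  have /cvgrPdist_lt f1' := f1; have /cvgrPdist_lt f2' := f2.
  apply/cvgrPdist_lt => e e0.
  have e20 : 0 < e / 2 by rewrite divr_gt0.
  near=> x; rewrite sub0r normrN ger0_norm ?normc_ge0//.
  rewrite (le_lt_trans (normc_le_ReIm _))// (splitr e) ltrD//.
    by rewrite ReB distrC; near: x; exact: f1'.
  by rewrite ImB distrC; near: x; exact: f2'.
have /cvgrPdist_lt fl' := fl.
split; apply/cvgrPdist_lt => e e0; near=> x.
  rewrite distrC -ReB (le_lt_trans (Re_le_normc _))//.
  rewrite -[ltLHS]ger0_norm ?normc_ge0// -normrN -sub0r; near: x; exact: fl'.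
rewrite distrC -ImB (le_lt_trans (Im_le_normc _))//.
rewrite -[ltLHS]ger0_norm ?normc_ge0// -normrN -sub0r; near: x; exact: fl'.
Unshelve. all: by end_near. Qed.

Lemma ccvg_normc f l : ccvg F f l -> normc (f x) @[x --> F] --> normc l.
Proof.
move/ccvgP/cvgrPdist_lt => fl; apply/cvgrPdist_lt => e e0; near=> x.
have h : normc (f x - l) < e.
  rewrite -[ltLHS]ger0_norm ?normc_ge0// -normrN -sub0r; near: x; exact: fl.
rewrite (le_lt_trans _ h)// distrC ler_norml lerB_normc andbT.
by rewrite normc_distC -lerN2 opprB opprK lerB_normc.
Unshelve. all: by end_near. Qed.

Lemma ccvg_le f l M : ccvg F f l -> (\forall x \near F, normc (f x) <= M) ->
  normc l <= M.
Proof.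
by move=> /ccvg_normc fl h; apply: (closed_cvg (fun y => y <= M)) fl => //; exact: closed_le.
Qed.

Lemma ccvg_regP f l :
  ((f : T -> R[i]^o) @ F --> (l : R[i]^o)) <-> ccvg F f l.
Proof.
have E z : `|z : R[i]^o| = (normc z)%:C by [].
split=> [/cvgrPdist_lt fl|/ccvgP/cvgrPdist_lt fl].
  apply/ccvgP/cvgrPdist_lt => e e0; near=> x.
  rewrite sub0r normrN ger0_norm ?normc_ge0// normc_distC -ltcR.
  by rewrite -E; near: x; apply: fl; rewrite ltcR.
apply/cvgrPdist_lt => e e0.
(* A positive element of [R[i]] has zero imaginary part, so the epsilon of [R[i]^o] is a real
   number. *)
have [d ed d0] : exists2 d : R, e = d%:C & 0 < d.
  move: (e0); case: e {e0} => a b; rewrite ltcE/= => /andP[/eqP -> a0].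
  by exists a.
near=> x; rewrite E ed ltcR normc_distC -[ltLHS]ger0_norm ?normc_ge0//.
by rewrite -normrN -sub0r; near: x; exact: fl.
Unshelve. all: by end_near. Qed.

Lemma ccvg_near f g l : (\forall x \near F, f x = g x) -> ccvg F f l -> ccvg F g l.
Proof.
move=> fg [f1 f2]; split; [move: f1|move: f2];
  by apply: cvg_trans; apply: near_eq_cvg; apply: filterS fg => x ->.
Qed.

End filter.

Definition hasum (a : nat -> R[i]) (l : R[i]) : Prop :=
  ccvg \oo (fun n => \sum_(k < n) a k) l.

Lemma hasum_seriesP a l :
  (series (fun k => a k : R[i]^o) @ \oo --> (l : R[i]^o)) <-> hasum a l.
Proof.
rewrite ccvg_regP /hasum; suff -> : series (fun k => a k : R[i]^o) =
  (fun n => \sum_(k < n) a k) by [].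
by apply/funext => n; rewrite /series/= big_mkord.
Qed.

Lemma hasum_unique a l m : hasum a l -> hasum a m -> l = m.
Proof. exact: ccvg_unique. Qed.

Lemma eq_hasum a b l : a =1 b -> hasum a l -> hasum b l.
Proof. by move=> /funext ->. Qed.

Lemma hasumD a b l m : hasum a l -> hasum b m -> hasum (fun k => a k + b k) (l + m).
Proof.
move=> al bm; rewrite /hasum; under eq_fun do rewrite big_split/=.
exact: ccvgD.
Qed.

Lemma hasumZ c a l : hasum a l -> hasum (fun k => c * a k) (c * l).
Proof.
move=> al; rewrite /hasum; under eq_fun do rewrite -mulr_sumr.
exact: ccvgZ.
Qed.

Lemma hasum_finite a n : (forall k, (n <= k)%N -> a k = 0) ->
  hasum a (\sum_(k < n) a k).
Proof.
move=> h; apply: (ccvg_near _ (ccvg_cst _)); near=> m.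
have nm : (n <= m)%N by near: m; exact: nbhs_infty_ge.
rewrite -!(big_mkord xpredT) (big_cat_nat (n := n) (p := m))//=.
rewrite [X in _ = _ + X]big_nat_cond [X in _ = _ + X]big1 ?addr0// => k.
by move=> /andP[/andP[+ _] _]; apply: h.
Unshelve. all: by end_near. Qed.

Lemma hasum_le a l M : hasum a l -> (forall n, \sum_(k < n) normc (a k) <= M) ->
  normc l <= M.
Proof.
move=> al h; apply: (ccvg_le al); apply: nearW => n.
by rewrite (le_trans (normc_sum _ _ _)).
Qed.

Lemma ccvg_shift f l N : ccvg \oo f l -> ccvg \oo (fun n => f (n + N)%N) l.
Proof.
move=> [f1 f2]; split.
  by rewrite (cvg_shiftn N (fun x => complex.Re (f x))).
by rewrite (cvg_shiftn N (fun x => complex.Im (f x))).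
Qed.

Lemma hasum_tail a l N : hasum a l ->
  hasum (fun k => a (k + N)%N) (l - \sum_(k < N) a k).
Proof.
move=> /(@ccvg_shift _ _ N) al; rewrite /hasum.
have -> : (fun n => \sum_(k < n) a (k + N)%N) =
  (fun n => \sum_(k < n + N) a k - \sum_(k < N) a k).
  apply/funext => n; rewrite addnC big_split_ord/= addrC addrK.
  by apply: eq_bigr => i _; rewrite addnC.
by apply: ccvgB => //; exact: ccvg_cst.
Qed.

Lemma hasum_term_bounded a l : hasum a l -> exists2 B, 0 < B & forall k, normc (a k) <= B.
Proof.
move=> al.
have /ccvg_normc cn : ccvg \oo (fun n => \sum_(k < n.+1) a k - \sum_(k < n) a k) (l - l).
  by apply: ccvgB => //; have := @ccvg_shift _ _ 1 al; under eq_fun do rewrite addn1.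
have /cvg_seq_bounded := cvgP _ cn.
move=> [M [_ hM]]; exists (`|M| + 1) => [|k]; first by rewrite ltr_wpDl.
have M1 : M < `|M| + 1 by rewrite (le_lt_trans (ler_norm _))// ltrDl.
have := hM _ M1 k I; rewrite /= big_ord_recr/= addrAC subrr add0r.
by rewrite ger0_norm ?normc_ge0.
Qed.

Lemma hasum_exists a (b : nat -> R) : (forall k, normc (a k) <= b k) ->
  cvgn (series b) -> exists l, hasum a l.
Proof.
move=> ab cb.
have h (f : R[i] -> R) : (forall z, `|f z| <= normc z) -> cvgn (series (f \o a)).
  move=> fle; apply: normed_cvg; rewrite /=.
  apply: series_le_cvg cb => n; rewrite ?normr_ge0//.
    exact: le_trans (normc_ge0 _) (ab _).
  by rewrite (le_trans (fle _)).
have /cvg_ex[lr hr] := h _ (@Re_le_normc _); have /cvg_ex[li hi] := h _ (@Im_le_normc _).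
exists (lr +i* li); split => /=.
  suff -> : (fun n => complex.Re (\sum_(k < n) a k)) = series (@complex.Re R \o a) by [].
  by apply/funext => n; rewrite Re_sum/series/= big_mkord.
suff -> : (fun n => complex.Im (\sum_(k < n) a k)) = series (@complex.Im R \o a) by [].
by apply/funext => n; rewrite Im_sum/series/= big_mkord.
Qed.

Lemma sum_geometric_le (x : R) n : 0 <= x -> x < 1 -> \sum_(k < n) x ^+ k <= (1 - x)^-1.
Proof.
move=> x0 x1; rewrite -[leRHS]mul1r ler_pdivlMr ?subr_gt0//.
rewrite mulrC -opprB mulNr -subrX1 opprB lerBlDr lerDl exprn_ge0//.
Qed.

End ComplexLimits.

(** * Re-expansion of a power series at another centre *)

Section Reexpansion.
Context {R : realType}.

(** The sum may stop before [k] or run past it: once the binomial formula is padded with vanishing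
    coefficients, every such sum is a part of one nonnegative sum. *)
Lemma partial_binomial_le (u v : R) k N : 0 <= u -> 0 <= v ->
  \sum_(j < N) 'C(k, j)%:R * u ^+ (k - j) * v ^+ j <= (u + v) ^+ k.
Proof.
move=> u0 v0; rewrite exprDn.
have -> : \sum_(i < k.+1) u ^+ (k - i) * v ^+ i *+ 'C(k, i) =
    \sum_(j < k.+1 + N) 'C(k, j)%:R * u ^+ (k - j) * v ^+ j.
  rewrite big_split_ord/= [X in _ = _ + X]big1 ?addr0.
    by apply: eq_bigr => i _; rewrite -mulr_natl mulrA.
  by move=> i _; rewrite bin_small ?mul0r// ltnS leq_addr.
rewrite addnC big_split_ord/= lerDl sumr_ge0// => i _.
by rewrite !mulr_ge0// exprn_ge0.
Qed.

(** Binomial coefficients vanish for [j > k], so the triangle of binomial expansions can be summed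
    over a square and no truncation error arises. *)
Lemma power_sum_reexpand (c : nat -> R[i]) (a w : R[i]) N :
  \sum_(k < N) c k * (a + w) ^+ k =
  \sum_(j < N) (\sum_(k < N) 'C(k, j)%:R * c k * a ^+ (k - j)) * w ^+ j.
Proof.
under [RHS]eq_bigr do rewrite mulr_suml.
rewrite exchange_big/=; apply: eq_bigr => k _.
have [M NE] : exists M, N = (k.+1 + M)%N by exists (N - k.+1)%N; rewrite subnKC.
transitivity (\sum_(j < k.+1 + M) 'C(k, j)%:R * c k * a ^+ (k - j) * w ^+ j); last first.
  by rewrite -NE.
rewrite exprDn mulr_sumr big_split_ord/=.
rewrite [X in _ = _ + X]big1 ?addr0; last first.
  by move=> i _; rewrite bin_small ?mul0r// ltnS leq_addr.
by apply: eq_bigr => i _; rewrite -mulr_natl; ring.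
Qed.

(** The double series of binomial terms converges absolutely for [|w| <= rho], row [k] being at most
    [B * x ^+ k]. Partial sums at [a + w] are exact square sums, so the error of the re-expansion is
    only the part [k >= N] of the coefficients [b j], a geometric tail. *)
Lemma power_series_analytic (c : nat -> R[i]) (f : R[i] -> R[i]) :
  (forall z, normc z < 1 -> hasum (fun k => c k * z ^+ k) (f z)) ->
  forall a, normc a < 1 -> analytic_at f a.
Proof.
move=> cf a a1.
have a0 := normc_ge0 a.
(* The largest modulus in play, [s], stays below 1, and [t] lies strictly between [s] and 1: terms
   bounded at [t] decay geometrically at [s]. *)
pose rho := (1 - normc a) / 2; pose s := normc a + rho; pose t := (s + 1) / 2.
have rho0 : 0 < rho by rewrite /rho; lra.
have s0 : 0 < s by rewrite /s; lra.
have st : s < t by rewrite /t /s /rho; lra.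
have t1 : t < 1 by rewrite /t /s /rho; lra.
have t0 : 0 < t by lra.
have [B B0 cB] : exists2 B, 0 < B & forall k, normc (c k) * t ^+ k <= B.
  have /cf/hasum_term_bounded[B B0 h] : normc t%:C < 1.
    by rewrite normc_real gtr0_norm.
  exists B => // k; have := h k.
  by rewrite normcM normcX normc_real gtr0_norm.
pose x := s / t.
have x0 : 0 <= x by rewrite divr_ge0// ltW.
have x1 : x < 1 by rewrite ltr_pdivrMr// mul1r.
have cx k : normc (c k) * s ^+ k <= B * x ^+ k.
  have -> : s = x * t by rewrite /x divfK ?gt_eqF.
  rewrite exprMn mulrCA mulrC ler_wpM2r ?exprn_ge0//.
pose T k j := 'C(k, j)%:R * c k * a ^+ (k - j) : R[i].
have nT k j : normc (T k j) = 'C(k, j)%:R * normc (c k) * normc a ^+ (k - j).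
  rewrite /T !normcM normcX; congr (_ * _ * _).
  by rewrite -(rmorph_nat (real_complex R)) normc_real ger0_norm.
have Tsum k N (w : R) : 0 <= w -> w <= rho ->
    \sum_(j < N) normc (T k j) * w ^+ j <= B * x ^+ k.
  move=> w0 wr; apply: le_trans (cx k).
  have -> : \sum_(j < N) normc (T k j) * w ^+ j =
     normc (c k) * \sum_(j < N) 'C(k, j)%:R * normc a ^+ (k - j) * w ^+ j.
    by rewrite mulr_sumr; apply: eq_bigr => j _; rewrite nT; ring.
  rewrite ler_wpM2l ?normc_ge0// (le_trans (partial_binomial_le _ _ _ _))//.
  by apply: lerXn2r; rewrite ?nnegrE; [exact: addr_ge0|exact: ltW|rewrite /s lerD2l].
have [b Tb] : {b : nat -> R[i] & forall j, hasum (T ^~ j) (b j)}.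
  apply: (@choice _ _ (fun j b => hasum (T ^~ j) b)) => j.
  apply: (@hasum_exists _ _ (geometric (B / rho ^+ j) x)); last first.
    by apply: is_cvg_geometric_series; rewrite ger0_norm.
  move=> k; rewrite /geometric/= mulrAC ler_pdivlMr ?exprn_gt0//.
  apply: le_trans (Tsum k j.+1 rho _ _) => //; last exact: ltW.
  rewrite big_ord_recr/= lerDr sumr_ge0// => i _.
  by rewrite mulr_ge0 ?normc_ge0// exprn_ge0// ltW.
exists b, rho; split => // z zr; apply/hasum_seriesP.
set w := z - a in zr *.
have cP : ccvg \oo (fun N => \sum_(k < N) c k * z ^+ k) (f z).
  apply: cf; rewrite -(subrK a z) -/w (le_lt_trans (le_normcD _ _))//.
  by move: zr; rewrite /rho; lra.
suff cD : ccvg \oo (fun N => \sum_(j < N) (b j - \sum_(k < N) T k j) * w ^+ j) 0.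
  have h := [elaborate ccvgD cD cP]; rewrite add0r in h.
  apply: (ccvg_near _ h); apply: nearW => N.
  have -> : z = a + w by rewrite /w addrC subrK.
  rewrite power_sum_reexpand -big_split/=; apply: eq_bigr => j _.
  by rewrite -mulrDl subrK.
apply/ccvgP.
have h0 : geometric (B / (1 - x)) x @ \oo --> (0 : R).
  by apply: cvg_geometric; rewrite ger0_norm.
apply: squeeze_cvgr (cvg_cst (0 : R)) h0; apply: nearW => N.
rewrite normc_ge0 subr0/=.
have cl : ccvg \oo (fun m => \sum_(j < N) (\sum_(k < m) T (k + N)%N j) * w ^+ j)
    (\sum_(j < N) (b j - \sum_(k < N) T k j) * w ^+ j).
  apply: (@ccvg_sum R nat \oo _ 'I_N (index_enum _)
    (fun j m => (\sum_(k < m) T (k + N)%N j) * w ^+ j)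
    (fun j => (b j - \sum_(k < N) T k j) * w ^+ j)) => j.
  by apply: ccvgM; [exact: (hasum_tail N (Tb j))|exact: ccvg_cst].
apply: (ccvg_le cl); apply: nearW => m.
under eq_bigr do rewrite mulr_suml.
rewrite exchange_big/= (le_trans (normc_sum _ _ _))//.
apply: (@le_trans _ _ (\sum_(k < m) B * x ^+ (k + N))).
  apply: ler_sum => k _; apply: le_trans (Tsum (k + N)%N N (normc w) _ (ltW zr)).
    rewrite (le_trans (normc_sum _ _ _))//; apply: ler_sum => j _.
    by rewrite normcM normcX.
  exact: normc_ge0.
have -> : \sum_(k < m) B * x ^+ (k + N) = (\sum_(k < m) x ^+ k) * (B * x ^+ N).
  by rewrite mulr_suml; apply: eq_bigr => k _; rewrite exprD; ring.
rewrite /geometric/= [leRHS](_ : _ = (1 - x)^-1 * (B * x ^+ N)); last by ring.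
by rewrite ler_wpM2r ?sum_geometric_le// mulr_ge0 ?exprn_ge0// ltW.
Qed.

End Reexpansion.

(** * Strict complex differentiability of analytic functions *)

Section StrictDifferentiability.
Context {R : realType}.

(** Strict differentiability at [a] with an explicit rate: both [u] and [v] move in the ball of
    radius [m]. This strength yields continuity of the derivative without differentiating power
    series. *)
Definition strict_diff (f : R[i] -> R[i]) (a c : R[i]) : Prop :=
  exists C d : R, [/\ 0 <= C, 0 < d & forall m u v, m <= d ->
    normc (u - a) <= m -> normc (v - a) <= m ->
    normc (f u - f v - c * (u - v)) <= C * m * normc (u - v)].

Definition ccont (g : R[i] -> R[i]) (a : R[i]) : Prop :=
  forall e : R, 0 < e -> exists2 d : R, 0 < d &
    forall z, normc (z - a) < d -> normc (g z - g a) < e.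

Lemma normc_subXX_le (x y : R[i]) (m : R) k : normc x <= m -> normc y <= m ->
  normc (x ^+ k - y ^+ k) <= k%:R * m ^+ k.-1 * normc (x - y).
Proof.
move=> xm ym; have m0 : 0 <= m by apply: le_trans xm; exact: normc_ge0.
rewrite subrXX normcM mulrC ler_wpM2r ?normc_ge0//.
rewrite (le_trans (normc_sum _ _ _))//.
have -> : k%:R * m ^+ k.-1 = \sum_(i < k) m ^+ k.-1.
  by rewrite sumr_const card_ord mulr_natl.
apply: ler_sum => i _; rewrite normcM !normcX.
have -> : m ^+ k.-1 = m ^+ (k.-1 - i) * m ^+ i.
  by rewrite -exprD subnK//; case: k i => [[]//|k i]/=; rewrite -ltnS.
by rewrite ler_pM ?exprn_ge0 ?normc_ge0// lerXn2r ?nnegrE ?normc_ge0.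
Qed.

(** Only degrees at least 2 remain in [f u - f v - c * (u - v)], and there each difference of powers
    carries a factor [m * |u - v|]. *)
Lemma analytic_strict_diff f a : analytic_at f a -> exists c : R[i], strict_diff f a c.
Proof.
move=> [c [rho [rho0 cf]]].
pose r := rho / 2; have r0 : 0 < r by rewrite divr_gt0.
have [B B0 cB] : exists2 B, 0 < B & forall k, normc (c k) * r ^+ k <= B.
  have /cf/hasum_seriesP/hasum_term_bounded[B B0 h] : normc (a + r%:C - a) < rho.
    by rewrite addrC addKr normc_real gtr0_norm// /r; lra.
  exists B => // k; have := h k.
  by rewrite addrC addKr normcM normcX normc_real gtr0_norm.
exists (c 1%N), (4 * B / r ^+ 2), (r / 4); split.
- by rewrite !mulr_ge0 ?invr_ge0 ?exprn_ge0 ?ltW.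
- by rewrite divr_gt0.
move=> m u v md um vm.
have m0 : 0 <= m by apply: le_trans um; exact: normc_ge0.
have mr : m < rho by apply: (le_lt_trans md); rewrite /r; lra.
set x := u - a in um; set y := v - a in vm.
have xy : u - v = x - y by rewrite /x /y opprB addrA subrK.
have sx : hasum (fun k => c k * x ^+ k) (f u).
  by apply/hasum_seriesP/cf; apply: le_lt_trans mr.
have sy : hasum (fun k => c k * y ^+ k) (f v).
  by apply/hasum_seriesP/cf; apply: le_lt_trans mr.
have := hasum_tail 2 (hasumD sx (hasumZ (-1) sy)).
rewrite !big_ord_recl big_ord0 !expr0 !expr1 !mulN1r/= mulr1 subrr add0r addr0 -mulrBr.
rewrite xy => /hasum_le; apply => n.
(* The radius [r / 4] leaves a factor [4 ^- k]: one [2 ^- k] absorbs [k + 2 <= 2 * 2 ^ k], the other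
   one sums to at most 2. *)
apply: (@le_trans _ _ (\sum_(k < n) (2 * B / r ^+ 2 * m * normc (x - y)) * (2^-1) ^+ k)).
  apply: ler_sum => k _; rewrite addn2 mulN1r -mulrBr normcM.
  have h := normc_subXX_le k.+2 um vm.
  apply: (@le_trans _ _ (normc (c k.+2) * (k.+2%:R * m ^+ k.+1 * normc (x - y)))).
    by rewrite ler_wpM2l ?normc_ge0.
  have -> : 2 * B / r ^+ 2 * m * normc (x - y) * 2^-1 ^+ k =
     (B / r ^+ k.+2 * ((2 * 2 ^+ k) * (m * (r / 4) ^+ k))) * normc (x - y).
    have -> : (r / 4) ^+ k = r ^+ k * (2^-1) ^+ k * (2^-1) ^+ k.
      by rewrite -!exprMn; congr (_ ^+ _); field.
    rewrite !exprS expr0 mulr1 exprVn; field.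
    by rewrite !expf_neq0// gt_eqF.
  rewrite [leLHS]mulrA ler_wpM2r ?normc_ge0// ler_pM ?normc_ge0//.
  - by rewrite mulr_ge0// exprn_ge0.
  - by rewrite ler_pdivlMr ?exprn_gt0.
  - rewrite ler_pM// ?exprn_ge0//.
      rewrite -exprS -natrX ler_nat; elim: (nat_of_ord k) => // i ih.
      by rewrite expnS mulSn mul1n -addn1 addnC leq_add// (leq_trans _ ih).
    by rewrite exprS ler_wpM2l// lerXn2r// nnegrE// divr_ge0// ltW.
rewrite -mulr_sumr.
have -> : 4 * B / r ^+ 2 * m * normc (x - y) =
  (2 * B / r ^+ 2 * m * normc (x - y)) * 2 by field; rewrite gt_eqF.
rewrite ler_wpM2l//.
  by rewrite !mulr_ge0 ?normc_ge0 ?invr_ge0 ?exprn_ge0// ltW.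
have := @sum_geometric_le R (2^-1) n; have -> : (1 - 2^-1 : R)^-1 = 2 by field.
by apply => //; lra.
Qed.

(** The increment of [f] from [w] to [w + h] is estimated twice, by the expansion at [a] and by the
    one at [w]; comparing them bounds [f' w - f' a]. *)
Lemma strict_diff_ccont f (f' : R[i] -> R[i]) a :
  strict_diff f a (f' a) ->
  (exists2 d : R, 0 < d & forall w, normc (w - a) < d -> strict_diff f w (f' w)) ->
  ccont f' a.
Proof.
move=> [C [d [C0 d0 hC]]] [d' d'0 hd'] e e0.
pose D := Num.min (Num.min (d / 2) d') (e / (2 * C + 2)).
have C20 : 0 < 2 * C + 2 by lra.
have D0 : 0 < D by rewrite /D !lt_min !divr_gt0// d'0.
exists D => // w; rewrite /D !lt_min => /andP[/andP[wd wd'] we].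
have [->|wa] := eqVneq w a; first by rewrite subrr normc0.
have [C' [d2 [C'0 d20 hC']]] := hd' _ wd'.
have wa0 : 0 < normc (w - a) by rewrite normc_gt0 subr_eq0.
set p := normc (w - a) in wa0 wd wd' we.
(* [C'] and [d2] depend on [w], so [h] is chosen after them: the error at [w] is then at most [p],
   and the final bound [(2 * C + 2) * p] is free of [C']. *)
pose h := Num.min (Num.min p d2) (p / (C' + 1)).
have h0 : 0 < h by rewrite /h !lt_min wa0 d20 divr_gt0//; lra.
have hp : h <= p by rewrite /h !ge_min lexx.
have hd2 : h <= d2 by rewrite /h !ge_min lexx orbT.
have hC'p : C' * h <= p.
  have : h <= p / (C' + 1) by rewrite /h !ge_min lexx !orbT.
  rewrite ler_pdivlMr; last by lra.
  by move=> H; apply: le_trans H; rewrite mulrC ler_wpM2l ?(ltW h0)//; lra.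
have nh : normc h%:C = h by rewrite normc_real gtr0_norm.
have E : w + h%:C - w = h%:C by rewrite addrC addKr.
have h1 := hC (2 * p) (w + h%:C) w.
have h2 := hC' h (w + h%:C) w hd2.
move: h1 h2; rewrite E nh => h1 h2.
have {}h1 : normc (f (w + h%:C) - f w - f' a * h%:C) <= C * (2 * p) * h.
  apply: h1; [lra| |by rewrite -/p; lra].
  by rewrite addrAC (le_trans (le_normcD _ _))// nh -/p; lra.
have {}h2 : normc (f (w + h%:C) - f w - f' w * h%:C) <= C' * h * h.
  by apply: h2 => //; rewrite subrr normc0 ltW.
have : normc ((f' w - f' a) * h%:C) <= (C * (2 * p) + C' * h) * h.
  have -> : (f' w - f' a) * h%:C = (f (w + h%:C) - f w - f' a * h%:C) -
     (f (w + h%:C) - f w - f' w * h%:C) by ring.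
  rewrite (le_trans (le_normcD _ _))// normcN mulrDl lerD//.
rewrite normcM nh ler_pM2r// => /le_lt_trans; apply.
apply: (@le_lt_trans _ _ ((2 * C + 2) * p)); first by nra.
by rewrite mulrC -ltr_pdivlMr.
Qed.

End StrictDifferentiability.

(** * Measurability and integration of complex-valued functions *)

Section MeasurableC.
Context d (T : measurableType d) {R : realType}.
Implicit Types (D : set T) (f g : T -> R[i]).

Definition cmeasurable D f : Prop :=
  measurable_fun D (fun x => complex.Re (f x)) /\
  measurable_fun D (fun x => complex.Im (f x)).

Lemma cmeasurable_cst D c : cmeasurable D (fun=> c).
Proof. by split; exact: measurable_cst. Qed.

Lemma cmeasurableD D f g : cmeasurable D f -> cmeasurable D g ->
  cmeasurable D (fun x => f x + g x).
Proof.
move=> [f1 f2] [g1 g2]; split.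
  by under eq_fun do rewrite ReD; exact: measurable_funD.
by under eq_fun do rewrite ImD; exact: measurable_funD.
Qed.

Lemma cmeasurableM D f g : cmeasurable D f -> cmeasurable D g ->
  cmeasurable D (fun x => f x * g x).
Proof.
move=> [f1 f2] [g1 g2]; split.
  by under eq_fun do rewrite ReM; apply: measurable_funB; exact: measurable_funM.
by under eq_fun do rewrite ImM; apply: measurable_funD; exact: measurable_funM.
Qed.

Lemma cmeasurableZ D c f : cmeasurable D f -> cmeasurable D (fun x => c * f x).
Proof. by move=> mf; apply: cmeasurableM => //; exact: cmeasurable_cst. Qed.

Lemma cmeasurable_conj D f : cmeasurable D f -> cmeasurable D (fun x => (f x)^*%C).
Proof.
move=> [f1 f2]; split.
  by under eq_fun do rewrite Re_conj.
by under eq_fun do rewrite Im_conj; exact: measurable_funN.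
Qed.

Lemma cmeasurableX D f k : cmeasurable D f -> cmeasurable D (fun x => f x ^+ k).
Proof.
move=> mf; elim: k => [|k ih]; first by under eq_fun do rewrite expr0; exact: cmeasurable_cst.
by under eq_fun do rewrite exprS; exact: cmeasurableM.
Qed.

Lemma cmeasurable_sum D (I : Type) (r : seq I) (F : I -> T -> R[i]) :
  (forall i, cmeasurable D (F i)) -> cmeasurable D (fun x => \sum_(i <- r) F i x).
Proof.
move=> mF; elim: r => [|i r ih].
  by under eq_fun do rewrite big_nil; exact: cmeasurable_cst.
by under eq_fun do rewrite big_cons; exact: cmeasurableD.
Qed.

Lemma cmeasurable_normc2 D f : cmeasurable D f ->
  measurable_fun D (fun x => normc (f x) ^+ 2).
Proof.
move=> [f1 f2]; under eq_fun do rewrite sqr_normcE.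
by apply: measurable_funD; exact: measurable_funX.
Qed.

Lemma cmeasurable_normc D f : cmeasurable D f -> measurable_fun D (fun x => normc (f x)).
Proof.
move=> mf.
have -> : (fun x => normc (f x)) = (fun x => Num.sqrt (normc (f x) ^+ 2)).
  by apply/funext => x; rewrite sqrtr_sqr ger0_norm// normc_ge0.
exact: (measurableT_comp (continuous_measurable_fun (@sqrt_continuous R))
  (cmeasurable_normc2 mf)).
Qed.

Lemma cmeasurable_cvg D (u : nat -> T -> R[i]) f : (forall n, cmeasurable D (u n)) ->
  (forall x, D x -> ccvg \oo (u ^~ x) (f x)) -> cmeasurable D f.
Proof.
move=> mu uf; split; apply/measurable_EFinP.
  apply: (@emeasurable_fun_cvg _ _ _ _ (fun n x => (complex.Re (u n x))%:E)).
    by move=> n; apply/measurable_EFinP; have [] := mu n.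
  by move=> x Dx; apply: cvg_EFin; [exact: nearW|have [] := uf x Dx].
apply: (@emeasurable_fun_cvg _ _ _ _ (fun n x => (complex.Im (u n x))%:E)).
  by move=> n; apply/measurable_EFinP; have [] := mu n.
by move=> x Dx; apply: cvg_EFin; [exact: nearW|have [] := uf x Dx].
Qed.

End MeasurableC.

Section IntegralC.
Context d (T : measurableType d) {R : realType} (mu : {measure set T -> \bar R}).
Variables (D : set T) (mD : measurable D).
Implicit Types (f g : T -> R[i]).

Definition integrableC f : Prop :=
  mu.-integrable D (EFin \o (fun x => complex.Re (f x))) /\
  mu.-integrable D (EFin \o (fun x => complex.Im (f x))).

Lemma integrableC_dominated f (g : T -> R) : cmeasurable D f ->
  mu.-integrable D (EFin \o g) -> (forall x, D x -> normc (f x) <= g x) -> integrableC f.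
Proof.
move=> [f1 f2] ig fg; split; apply: le_integrable ig => //=.
- exact/measurable_EFinP.
- move=> x Dx; rewrite lee_fin (le_trans (Re_le_normc _))//.
  by rewrite (le_trans (fg _ Dx))// ler_norm.
- exact/measurable_EFinP.
- move=> x Dx; rewrite lee_fin (le_trans (Im_le_normc _))//.
  by rewrite (le_trans (fg _ Dx))// ler_norm.
Qed.

Lemma integrableCD f g : integrableC f -> integrableC g -> integrableC (fun x => f x + g x).
Proof.
move=> [f1 f2] [g1 g2]; split.
  by rewrite (_ : _ \o _ = (EFin \o (fun x => complex.Re (f x))) \+
    (EFin \o (fun x => complex.Re (g x))))%E; [exact: integrableD|
    apply/funext => x /=; rewrite ReD].
by rewrite (_ : _ \o _ = (EFin \o (fun x => complex.Im (f x))) \+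
    (EFin \o (fun x => complex.Im (g x))))%E; [exact: integrableD|
    apply/funext => x /=; rewrite ImD].
Qed.

Lemma integralCD f g : integrableC f -> integrableC g ->
  integralC mu D (fun x => f x + g x) = integralC mu D f + integralC mu D g.
Proof.
move=> [f1 f2] [g1 g2]; apply: complex_eqP; rewrite ?ReD ?ImD/=.
  by under eq_Rintegral do rewrite ReD; exact: RintegralD.
by under eq_Rintegral do rewrite ImD; exact: RintegralD.
Qed.

Lemma integrable_realZ (a : R) (f : T -> R) : mu.-integrable D (EFin \o f) ->
  mu.-integrable D (EFin \o (fun x => a * f x)).
Proof.
move=> fi; rewrite (_ : _ \o _ = (fun x => a%:E * (f x)%:E)%E); first exact: integrableZl.
by apply/funext => x.
Qed.

Lemma integrable_realD (f g : T -> R) : mu.-integrable D (EFin \o f) ->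
  mu.-integrable D (EFin \o g) -> mu.-integrable D (EFin \o (fun x => f x + g x)).
Proof.
move=> fi gi; rewrite (_ : _ \o _ = ((EFin \o f) \+ (EFin \o g))%E); first exact: integrableD.
by apply/funext => x.
Qed.

Lemma integrable_realB (f g : T -> R) : mu.-integrable D (EFin \o f) ->
  mu.-integrable D (EFin \o g) -> mu.-integrable D (EFin \o (fun x => f x - g x)).
Proof.
move=> fi gi; under eq_fun do rewrite -mulN1r.
by apply: integrable_realD => //; exact: integrable_realZ.
Qed.

Lemma integrableCZ c f : integrableC f -> integrableC (fun x => c * f x).
Proof.
move=> [f1 f2]; split.
  under eq_fun do rewrite ReM.
  by apply: integrable_realB; exact: integrable_realZ.
under eq_fun do rewrite ImM.
by apply: integrable_realD; exact: integrable_realZ.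
Qed.

Lemma integralCZ c f : integrableC f ->
  integralC mu D (fun x => c * f x) = c * integralC mu D f.
Proof.
move=> [f1 f2]; apply: complex_eqP; rewrite ?ReM ?ImM/=.
  under eq_Rintegral do rewrite ReM.
  rewrite RintegralB//; [|exact: integrable_realZ|exact: integrable_realZ].
  by rewrite !RintegralZl.
under eq_Rintegral do rewrite ImM.
rewrite RintegralD//; [|exact: integrable_realZ|exact: integrable_realZ].
by rewrite !RintegralZl.
Qed.

Lemma integrableCB f g : integrableC f -> integrableC g -> integrableC (fun x => f x - g x).
Proof.
move=> fi gi; under eq_fun do rewrite -mulN1r.
by apply: integrableCD => //; exact: integrableCZ.
Qed.

Lemma integralCB f g : integrableC f -> integrableC g ->
  integralC mu D (fun x => f x - g x) = integralC mu D f - integralC mu D g.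
Proof.
move=> fi gi; under eq_fun do rewrite -mulN1r.
by rewrite integralCD ?integralCZ ?mulN1r//; exact: integrableCZ.
Qed.

Lemma integrableC0 : integrableC (fun=> 0).
Proof. by split; apply: integrable0. Qed.

Lemma integralC0 : integralC mu D (fun=> 0) = 0.
Proof. by apply: complex_eqP => /=; rewrite /Rintegral integral0. Qed.

Lemma integrableC_sum (I : Type) (r : seq I) (F : I -> T -> R[i]) :
  (forall i, integrableC (F i)) -> integrableC (fun x => \sum_(i <- r) F i x).
Proof.
move=> iF; elim: r => [|i r ih].
  by under eq_fun do rewrite big_nil; exact: integrableC0.
by under eq_fun do rewrite big_cons; exact: integrableCD.
Qed.

Lemma integralC_sum (I : Type) (r : seq I) (F : I -> T -> R[i]) :
  (forall i, integrableC (F i)) ->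
  integralC mu D (fun x => \sum_(i <- r) F i x) = \sum_(i <- r) integralC mu D (F i).
Proof.
move=> iF; elim: r => [|i r ih].
  by under eq_fun do rewrite big_nil; rewrite big_nil integralC0.
under eq_fun do rewrite big_cons; rewrite big_cons integralCD ?ih//.
exact: integrableC_sum.
Qed.

Lemma integralC_conj f : integrableC f ->
  integralC mu D (fun x => (f x)^*%C) = (integralC mu D f)^*%C.
Proof.
move=> [f1 f2]; apply: complex_eqP; rewrite ?Re_conj ?Im_conj/=.
  by under eq_Rintegral do rewrite Re_conj.
under eq_Rintegral do rewrite Im_conj -mulN1r.
by rewrite RintegralZl// mulN1r.
Qed.

Lemma eq_integralC f g : (forall x, D x -> f x = g x) -> integralC mu D f = integralC mu D g.
Proof.
move=> fg; apply: complex_eqP => /=; apply: eq_Rintegral => x /set_mem Dx;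
  by rewrite fg.
Qed.

End IntegralC.

Section IntegralCProbability.
Context d (T : measurableType d) {R : realType} (P : probability T R).
Variables (D : set T) (mD : measurable D).
Implicit Types (f g : T -> R[i]).

Lemma integrable_cst_prob (M : R) : P.-integrable D (EFin \o (fun=> M)).
Proof. exact: finite_measure_integrable_cst. Qed.

Lemma integrableC_bounded f M : cmeasurable D f -> (forall x, D x -> normc (f x) <= M) ->
  integrableC P D f.
Proof.
by move=> mf fM; apply: integrableC_dominated fM => //; exact: integrable_cst_prob.
Qed.

Lemma Rintegral_prob_le (f : T -> R) M : 0 <= M -> P.-integrable D (EFin \o f) ->
  (forall x, D x -> `|f x| <= M) -> `|(\int[P]_(x in D) f x)%R| <= M.
Proof.
move=> M0 fi fM; rewrite (le_trans (le_normr_Rintegral _ _))//.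
have PD : (fine (P D) <= 1)%R.
  rewrite -lee_fin fineK ?probability_le1//; exact: fin_num_measure.
apply: (@le_trans _ _ (\int[P]_(x in D) M)%R).
  apply: le_Rintegral => //; last exact: integrable_cst_prob.
  by move/integrable_abse : fi.
by rewrite Rintegral_cst// -[leRHS]mulr1 ler_wpM2l.
Qed.

(** The factor 2 comes from treating real and imaginary parts separately; it is harmless for
    limits. *)
Lemma normc_integralC_le f M : 0 <= M -> integrableC P D f ->
  (forall x, D x -> normc (f x) <= M) -> normc (integralC P D f) <= 2 * M.
Proof.
move=> M0 [f1 f2] fM; rewrite (le_trans (normc_le_ReIm _))// mulr_natl mulr2n lerD//=.
  by apply: Rintegral_prob_le => // x /fM; apply: le_trans; exact: Re_le_normc.
by apply: Rintegral_prob_le => // x /fM; apply: le_trans; exact: Im_le_normc.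
Qed.

End IntegralCProbability.

(** * Derivatives of paths in the complex plane *)

Section PathDerivative.
Context {R : realType}.

Lemma is_derive_epsP (f : R -> R) (t l : R) :
  is_derive t 1 f l <-> (forall e : R, 0 < e -> exists2 d : R, 0 < d &
    forall h, `|h| < d -> `|f (t + h) - f t - l * h| <= e * `|h|).
Proof.
split=> [[df <-] e e0|H].
  have := df; rewrite /derivable => /cvg_ex[m hm].
  have -> : 'D_1 f t = m by rewrite /derive; apply/cvg_lim.
  move/cvgrPdist_le : hm => /(_ _ e0)[d /= d0 hd].
  exists d => // h hh; have [->|h0] := eqVneq h 0.
    by rewrite addr0 subrr mulr0 subr0 normr0 mulr0.
  have := hd h; rewrite /ball_/= sub0r normrN => /(_ hh h0).
  rewrite /GRing.scale/= mulr1 (addrC h) => hm.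
  have -> : f (t + h) - f t - m * h = - ((m - h^-1 * (f (t + h) - f t)) * h).
    by rewrite mulrBl mulrAC mulVf// mul1r opprB.
  by rewrite normrN normrM ler_wpM2r.
suff hl : h^-1 *: ((f \o shift t) (h *: 1) - f t) @[h --> 0^'] --> l.
  apply: DeriveDef; first by apply/cvg_ex; exists l.
  by rewrite /derive; apply/cvg_lim.
apply/cvgrPdist_le => e e0; have [d d0 hd] := H _ e0.
exists d => //= h; rewrite /ball_/= sub0r normrN => hh h0.
rewrite /GRing.scale/= mulr1 (addrC h).
have -> : l - h^-1 * (f (t + h) - f t) = - (h^-1 * (f (t + h) - f t - l * h)).
  by field.
rewrite normrN normrM normfV mulrC ler_pdivrMr ?normr_gt0//.
exact: hd.
Qed.

Definition path_deriv (G : R -> R[i]) (t : R) (l : R[i]) : Prop :=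
  is_derive t 1 (fun s => complex.Re (G s)) (complex.Re l) /\
  is_derive t 1 (fun s => complex.Im (G s)) (complex.Im l).

(** The form with moduli suits composition with complex functions, the form with parts gives access
    to real calculus. *)
Lemma path_deriv_epsP G t l : path_deriv G t l <->
  (forall e : R, 0 < e -> exists2 d : R, 0 < d &
    forall h, `|h| < d -> normc (G (t + h) - G t - l * h%:C) <= e * `|h|).
Proof.
split=> [[/is_derive_epsP H1 /is_derive_epsP H2] e e0|H].
  have e20 : 0 < e / 2 by rewrite divr_gt0.
  have [d1 d10 h1] := H1 _ e20; have [d2 d20 h2] := H2 _ e20.
  exists (Num.min d1 d2); first by rewrite lt_min d10.
  move=> h; rewrite lt_min => /andP[/h1{}h1 /h2{}h2].
  rewrite (le_trans (normc_le_ReIm _))// (splitr e) mulrDl lerD//.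
    by rewrite !ReB ReM/= mulr0 subr0.
  by rewrite !ImB ImM/= mulr0 add0r.
split; apply/is_derive_epsP => e e0; have [d d0 hd] := H _ e0; exists d => // h hh.
  by have := le_trans (Re_le_normc _) (hd h hh); rewrite !ReB ReM/= mulr0 subr0.
by have := le_trans (Im_le_normc _) (hd h hh); rewrite !ImB ImM/= mulr0 add0r.
Qed.

Lemma path_deriv_comp f G t l c : strict_diff f (G t) c -> path_deriv G t l ->
  path_deriv (f \o G) t (c * l).
Proof.
move=> [C [d0 [C0 d00 hf]]] /path_deriv_epsP HG; apply/path_deriv_epsP => e e0.
pose L := normc l + 1.
have L0 : 0 < L by rewrite /L ltr_wpDl// normc_ge0.
have c10 : 0 < normc c + 1 by rewrite ltr_wpDl// normc_ge0.
(* The bound 1 yields [|G (t + h) - G t| <= L * |h|]; the other one makes the error of [G],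
   multiplied by [c], at most [e / 2 * |h|]. *)
have e10 : 0 < Num.min 1 (e / 2 / (normc c + 1)) by rewrite lt_min ltr01 !divr_gt0.
have [d d1 hd] := HG _ e10.
have CL : 0 < 2 * (C * L * L) + 1 by rewrite ltr_wpDl// !mulr_ge0// ltW.
pose D := Num.min (Num.min d (d0 / L)) (e / (2 * (C * L * L) + 1)).
exists D; first by rewrite !lt_min d1 !divr_gt0.
move=> h; rewrite !lt_min => /andP[/andP[h1 h2] h3].
have := hd _ h1; set r := normc _ => hr.
have hG : normc (G (t + h) - G t) <= L * `|h|.
  have -> : G (t + h) - G t = (G (t + h) - G t - l * h%:C) + l * h%:C by rewrite subrK.
  rewrite (le_trans (le_normcD _ _))// normcM normc_real addrC mulrDl lerD//.
  by rewrite (le_trans hr)// ler_wpM2r// ge_min lexx.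
have hm : L * `|h| <= d0 by rewrite mulrC -ler_pdivlMr// ltW.
have H1 := hf (L * `|h|) (G (t + h)) (G t) hm hG.
rewrite subrr normc0 mulr_ge0// ?(ltW L0)// in H1; have {}H1 := H1 isT.
have -> : (f \o G) (t + h) - (f \o G) t - c * l * h%:C =
   (f (G (t + h)) - f (G t) - c * (G (t + h) - G t)) +
   c * (G (t + h) - G t - l * h%:C) by rewrite /=; ring.
rewrite (le_trans (le_normcD _ _))// (splitr e) mulrDl lerD//.
  apply: (le_trans H1); apply: (@le_trans _ _ (C * (L * `|h|) * (L * `|h|))).
    by rewrite ler_wpM2l// !mulr_ge0// ltW.
  have -> : C * (L * `|h|) * (L * `|h|) = (C * L * L * `|h|) * `|h| by ring.
  rewrite ler_wpM2r//.
  have := ltW h3; rewrite ler_pdivlMr// => h3'.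
  have : 0 <= `|h| by []. nra.
rewrite normcM; apply: (@le_trans _ _ (normc c * (e / 2 / (normc c + 1) * `|h|))).
  rewrite ler_wpM2l ?normc_ge0// (le_trans hr)// ler_wpM2r// ge_min lexx orbT//.
rewrite mulrA ler_wpM2r//.
rewrite [leRHS](_ : _ = (normc c + 1) * (e / 2 / (normc c + 1))); last first.
  by field; rewrite gt_eqF.
by rewrite ler_wpM2r ?lerDl// !divr_ge0 ?addr_ge0 ?normc_ge0// ltW.
Qed.

Lemma path_deriv_cst c t : path_deriv (fun=> c) t 0.
Proof. by split; exact: is_derive_cst. Qed.

Lemma path_derivD G H t l m : path_deriv G t l -> path_deriv H t m ->
  path_deriv (fun s => G s + H s) t (l + m).
Proof.
move=> [g1 g2] [h1 h2]; split.
  by under eq_fun do rewrite ReD; rewrite ReD; exact: is_deriveD.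
by under eq_fun do rewrite ImD; rewrite ImD; exact: is_deriveD.
Qed.

Lemma path_derivZ c G t l : path_deriv G t l -> path_deriv (fun s => c * G s) t (c * l).
Proof.
move=> [g1 g2]; split.
  under eq_fun do rewrite ReM; rewrite ReM.
  by apply: is_deriveB; exact: is_deriveZ.
under eq_fun do rewrite ImM; rewrite ImM.
by apply: is_deriveD; exact: is_deriveZ.
Qed.

Lemma path_deriv_real t : path_deriv (fun s : R => s%:C) t 1.
Proof. by split => /=; [exact: is_derive_id|exact: is_derive_cst]. Qed.

Definition cis (t : R) : R[i] := cos t +i* sin t.

Lemma normc_cis t : normc (cis t) = 1.
Proof. by rewrite normcE/= cos2Dsin2 sqrtr1. Qed.

Lemma path_deriv_cis t : path_deriv cis t ('i%C * cis t).
Proof.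
have -> : 'i%C * cis t = (- sin t) +i* cos t.
  by apply: complex_eqP; rewrite ?ReM ?ImM/=; ring.
by split => /=; [exact: is_derive_cos|exact: is_derive_sin].
Qed.

Lemma cis_2pi : cis (2 * pi) = cis 0.
Proof. by rewrite /cis mulr_natl cos2pi sin2pi cos0 sin0. Qed.

Lemma path_deriv_cont G t l : path_deriv G t l -> ccvg (nbhs t) G (G t).
Proof.
by move=> [[g1 _] [g2 _]]; split; apply: differentiable_continuous; exact/derivable1_diffP.
Qed.

Lemma path_derivM G H t l m : path_deriv G t l -> path_deriv H t m ->
  path_deriv (fun s => G s * H s) t (l * H t + G t * m).
Proof.
move=> [g1 g2] [h1 h2]; split.
  under eq_fun do rewrite ReM; apply: is_derive_eq.
  by rewrite !ReD !ReM /GRing.scale/=; ring.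
under eq_fun do rewrite ImM; apply: is_derive_eq.
by rewrite !ImD !ImM /GRing.scale/=; ring.
Qed.

Lemma path_deriv_cisX k t : path_deriv (fun s => cis s ^+ k) t (k%:R * 'i%C * cis t ^+ k).
Proof.
elim: k => [|k ih].
  by rewrite mul0r mul0r; under eq_fun do rewrite expr0; exact: path_deriv_cst.
under eq_fun do rewrite exprS.
have := path_derivM (path_deriv_cis t) ih; congr path_deriv.
by rewrite exprS -natr1; ring.
Qed.

Lemma ccont_comp {T : Type} {F : set_system T} {FF : ProperFilter F} g (G : T -> R[i]) l :
  ccont g l -> ccvg F G l -> ccvg F (fun x => g (G x)) (g l).
Proof.
move=> cg /ccvgP/cvgrPdist_lt cG; apply/ccvgP/cvgrPdist_lt => e e0.
have [d d0 hd] := cg _ e0; near=> x.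
rewrite sub0r normrN ger0_norm ?normc_ge0//; apply: hd.
rewrite -[ltLHS]ger0_norm ?normc_ge0// -normrN -sub0r; near: x; exact: cG.
Unshelve. all: by end_near. Qed.

Lemma strict_diff_cont (f : R[i] -> R[i]) (a c : R[i]) : strict_diff f a c -> ccont f a.
Proof.
move=> [C [d [C0 d0 h]]] e e0.
have c0 : 0 < normc c + C * d + 1 by rewrite ltr_wpDl// addr_ge0 ?normc_ge0// mulr_ge0// ltW.
exists (Num.min d (e / (normc c + C * d + 1))); first by rewrite lt_min d0 divr_gt0.
move=> z; rewrite lt_min => /andP[zd ze].
have := h d z a (lexx _) (ltW zd); rewrite subrr normc0 (ltW d0) => /(_ isT) H.
have -> : f z - f a = (f z - f a - c * (z - a)) + c * (z - a) by rewrite subrK.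
rewrite (le_lt_trans (le_normcD _ _))// normcM.
move: ze; rewrite ltr_pdivlMr// => ze; have := normc_ge0 (z - a); nra.
Qed.

Lemma ccvg_to_complex (p : R * R) : ccvg (nbhs p) to_complex (to_complex p).
Proof. by split => /=; [exact: cvg_fst|exact: cvg_snd]. Qed.

(** The closed disk is compact, as a closed subset of a square in [R * R]. *)
Lemma ccont_bounded g (s : R) : (forall z, normc z <= s -> ccont g z) ->
  exists2 M : R, 0 < M & forall z, normc z <= s -> normc (g z) <= M.
Proof.
move=> cg.
pose K := (fun p : R * R => normc (to_complex p)) @^-1` [set x | x <= s].
have cn : continuous (fun p : R * R => normc (to_complex p)).
  by move=> p; apply: ccvg_normc; exact: ccvg_to_complex.
have cK : compact K.
  apply: (@subclosed_compact _ _ (`[- s, s]%classic `*` `[- s, s]%classic)).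
  - by apply: closed_comp; [move=> p _; exact: cn|exact: closed_le].
  - by apply: compact_setX; exact: segment_compact.
  - move=> [a b]; rewrite /K/= => ab; rewrite !in_itv/= -!ler_norml.
    by split; [exact: le_trans (Re_le_normc (a +i* b)) ab|
      exact: le_trans (Im_le_normc (a +i* b)) ab].
have : compact ((fun p : R * R => normc (g (to_complex p)) : R^o) @` K).
  apply: continuous_compact => //; apply: continuous_in_subspaceT => p /set_mem Kp.
  by apply: ccvg_normc; apply: ccont_comp; [exact: cg|exact: ccvg_to_complex].
move=> /compact_bounded[M [_ hM]]; exists (`|M| + 1); first by rewrite ltr_wpDl.
move=> [a b] zs; rewrite -[leLHS]ger0_norm ?normc_ge0//.
apply: (hM (`|M| + 1)); first by rewrite (le_lt_trans (ler_norm _))// ltrDl.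
by exists (a, b).
Qed.

End PathDerivative.

(** * Angular means and orthonormality of the characters *)

Section CircleMean.
Context {R : realType}.
Local Notation U := (uniform_prob (@lt0_2pi R)).

Definition mean (f : R -> R[i]) : R[i] := integralC U setT f.

Lemma Rintegral_uniform (f : R -> R) : measurable_fun setT (f : measurableTypeR R -> R) ->
  lebesgue_measure.-integrable `[0, 2 * pi] (EFin \o f) ->
  (\int[U]_x f x)%R =
  (2 * pi)^-1 * (\int[lebesgue_measure]_(x in `[0, (2 * pi)%R]) f x)%R.
Proof.
move=> mf fi; rewrite /Rintegral integralE.
have mf' : measurable_fun setT (EFin \o f : measurableTypeR R -> \bar R).
  exact/measurable_EFinP.
rewrite integral_uniform//; last exact: measurable_funepos.
rewrite integral_uniform//; last exact: measurable_funeneg.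
have mI : measurable (`[0, 2 * pi]%classic : set (measurableTypeR R)).
  exact: measurable_itv.
have fA := integrable_pos_fin_num mI fi.
have fB := integrable_neg_fin_num mI fi.
rewrite subr0 [in RHS]integralE -(fineK fA) -(fineK fB).
by rewrite -!EFinM -!EFinB/= -mulrBr.
Qed.

(** Fundamental theorem of calculus over one period. The vanishing of angular means always comes
    from here. *)
Lemma Rintegral_uniform_derive0 (F f : R -> R) :
  (forall t : R, is_derive (t : R) (1 : R) F (f t)) ->
  continuous f -> F (2 * pi) = F 0 -> (\int[U]_x f x)%R = 0.
Proof.
move=> dF cf F2; rewrite Rintegral_uniform; last first.
- by apply: continuous_compact_integrable; [exact: segment_compact|
    exact: continuous_subspaceT].
- exact: continuous_measurable_fun.
have cF : continuous F.
  by move=> x; apply: differentiable_continuous; apply/derivable1_diffP; case: (dF x).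
rewrite /Rintegral (@continuous_FTC2 R f F); first by rewrite F2 subee//= mulr0.
- exact: lt0_2pi.
- exact: continuous_subspaceT.
- split.
  + by move=> x _; case: (dF x).
  + by apply: cvg_at_right_filter; exact: cF.
  + by apply: cvg_at_left_filter; exact: cF.
- by move=> x _; rewrite derive1E; case: (dF x).
Qed.

Lemma mean_path_deriv (G g : R -> R[i]) : (forall t, path_deriv G t (g t)) ->
  (forall t, ccvg (nbhs t) g (g t)) -> G (2 * pi) = G 0 -> mean g = 0.
Proof.
move=> dG cg G2; apply: complex_eqP => /=.
  apply: (@Rintegral_uniform_derive0 (fun t => complex.Re (G t))).
  - by move=> t; case: (dG t).
  - by move=> t; case: (cg t).
  - by rewrite G2.
apply: (@Rintegral_uniform_derive0 (fun t => complex.Im (G t))).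
- by move=> t; case: (dG t).
- by move=> t; case: (cg t).
- by rewrite G2.
Qed.

Lemma ccvg_measurable (g : R -> R[i]) : (forall t, ccvg (nbhs t) g (g t)) ->
  cmeasurable setT (g : measurableTypeR R -> R[i]).
Proof.
by move=> cg; split; apply: continuous_measurable_fun => t; case: (cg t).
Qed.

Lemma integrableC_mean (g : R -> R[i]) M : (forall t, ccvg (nbhs t) g (g t)) ->
  (forall t, normc (g t) <= M) -> integrableC U setT g.
Proof.
by move=> cg gM; apply: (@integrableC_bounded _ _ _ _ _ _ _ M) => //; exact: ccvg_measurable.
Qed.

Lemma ccvg_cis (t : R) : ccvg (nbhs t) cis (cis t).
Proof. exact: path_deriv_cont (path_deriv_cis t). Qed.

Lemma ccvg_cisX k (t : R) : ccvg (nbhs t) (fun s => cis s ^+ k) (cis t ^+ k).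
Proof. exact: path_deriv_cont (path_deriv_cisX k t). Qed.

Lemma mean_cst c : mean (fun=> c) = c.
Proof.
apply: complex_eqP => /=; rewrite Rintegral_cst//=.
  by rewrite probability_setT mulr1.
by rewrite probability_setT mulr1.
Qed.

Lemma mean_cisX k : mean (fun t => cis t ^+ k.+1) = 0.
Proof.
have h : mean (fun t => k.+1%:R * 'i%C * cis t ^+ k.+1) = 0.
  apply: (mean_path_deriv (G := fun t => cis t ^+ k.+1)).
  - by move=> t; exact: path_deriv_cisX.
  - by move=> t; apply: ccvgZ; exact: ccvg_cisX.
  - by rewrite cis_2pi.
move: h; rewrite /mean integralCZ//; last first.
  apply: (@integrableC_mean _ 1) => t; first exact: ccvg_cisX.
  by rewrite normcX normc_cis expr1n.
move/eqP; rewrite mulf_eq0 => /orP[|/eqP//].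
by rewrite mulf_eq0 pnatr_eq0/= eq_complex/= oner_eq0 andbF.
Qed.

Lemma cis_conj (t : R) : cis t * (cis t)^*%C = 1.
Proof. by rewrite mulc_conj normc_cis expr1n. Qed.

Lemma mean_cis_orthonormal j k :
  mean (fun t => cis t ^+ j * (cis t)^*%C ^+ k) = (j == k)%:R.
Proof.
have h n : mean (fun t => (cis t)^*%C ^+ n.+1) = 0.
  rewrite -[RHS]conjc0 -(mean_cisX n) /mean -integralC_conj//.
    by apply: eq_integralC => t _; rewrite rmorphXn.
  apply: (@integrableC_mean _ 1) => t; first exact: ccvg_cisX.
  by rewrite normcX normc_cis expr1n.
have [jk|jk|->] := ltngtP j k.
- rewrite -(subnKC (ltnW jk)) -[RHS](h (k - j).-1) prednK ?subn_gt0//.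
  apply: eq_integralC => t _; rewrite exprD mulrA -exprMn cis_conj expr1n mul1r//.
- rewrite -(subnKC (ltnW jk)) -[RHS](mean_cisX (j - k).-1) prednK ?subn_gt0//.
  apply: eq_integralC => t _; rewrite exprD mulrAC -exprMn cis_conj expr1n mul1r//.
- rewrite -[RHS](mean_cst 1); apply: eq_integralC => t _.
  by rewrite -exprMn cis_conj expr1n.
Qed.

End CircleMean.

(** * Termwise integration and Fourier coefficients of power series *)

Section TermwiseIntegration.
Context {R : realType}.

Lemma hasum_geometric_remainder (u : nat -> R[i]) F (B x : R) N : 0 <= B -> 0 <= x -> x < 1 ->
  hasum u F -> (forall j, normc (u j) <= B * x ^+ j) ->
  normc (F - \sum_(j < N) u j) <= B / (1 - x) * x ^+ N.
Proof.
move=> B0 x0 x1 uF uB; apply: (hasum_le (hasum_tail N uF)) => n.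
apply: (@le_trans _ _ (\sum_(k < n) B * x ^+ (k + N))); first exact: ler_sum.
have -> : \sum_(k < n) B * x ^+ (k + N) = (\sum_(k < n) x ^+ k) * (B * x ^+ N).
  by rewrite mulr_suml; apply: eq_bigr => k _; rewrite exprD; ring.
rewrite [leRHS](_ : _ = (1 - x)^-1 * (B * x ^+ N)); last by ring.
by rewrite ler_wpM2r ?sum_geometric_le// mulr_ge0 ?exprn_ge0.
Qed.

Lemma hasum_geometric_le (u : nat -> R[i]) F (B x : R) : 0 <= B -> 0 <= x -> x < 1 ->
  hasum u F -> (forall j, normc (u j) <= B * x ^+ j) -> normc F <= B / (1 - x).
Proof.
move=> B0 x0 x1 uF uB; have := hasum_geometric_remainder 0 B0 x0 x1 uF uB.
by rewrite big_ord0 subr0 expr0 mulr1.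
Qed.

(** Geometric domination makes the convergence uniform in [t], so on a probability space the
    integral of the remainder is at most twice a uniform bound of it. *)
Lemma hasum_integralC d (T : measurableType d) (P : probability T R)
    (u : nat -> T -> R[i]) (F : T -> R[i]) (B x : R) :
  0 <= B -> 0 <= x -> x < 1 -> (forall j, cmeasurable setT (u j)) ->
  (forall j t, normc (u j t) <= B * x ^+ j) -> (forall t, hasum (u ^~ t) (F t)) ->
  integrableC P setT F /\ hasum (fun j => integralC P setT (u j)) (integralC P setT F).
Proof.
move=> B0 x0 x1 mu uB uF.
have iu j : integrableC P setT (u j) by apply: (@integrableC_bounded _ _ _ _ _ _ _ (B * x ^+ j)).
have mF : cmeasurable setT F.
  apply: (@cmeasurable_cvg _ _ _ _ (fun n t => \sum_(j < n) u j t)) => [n|t _].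
    exact: cmeasurable_sum.
  exact: uF.
have iF : integrableC P setT F.
  apply: (@integrableC_bounded _ _ _ _ _ _ _ (B / (1 - x))) => // t _.
  by apply: hasum_geometric_le (uF t) _ => // j.
split => //; apply/ccvgP.
have h0 : geometric (2 * (B / (1 - x))) x @ \oo --> (0 : R).
  by apply: cvg_geometric; rewrite ger0_norm.
apply: squeeze_cvgr (cvg_cst (0 : R)) h0; apply: nearW => N.
rewrite normc_ge0/= -integralC_sum// -normc_distC -integralCB//; last exact: integrableC_sum.
rewrite -mulrA; apply: normc_integralC_le => //.
- by rewrite mulr_ge0 ?exprn_ge0// divr_ge0// subr_ge0 ltW.
- by apply: integrableCB => //; exact: integrableC_sum.
- move=> t _; apply: (hasum_geometric_remainder N B0 x0 x1 (uF t)) => j; exact: uB.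
Qed.

(** Orthonormality of the characters isolates the [k]-th term. Integrability is part of the
    conclusion because integration over the disk in polar coordinates asks for it. *)
Lemma power_series_mean (c : nat -> R[i]) (f : R[i] -> R[i]) (rho r : R) k : 0 <= r -> r < rho ->
  (forall z, normc z < rho -> hasum (fun j => c j * z ^+ j) (f z)) ->
  integrableC (uniform_prob (@lt0_2pi R)) setT (fun t => f (r%:C * cis t) * (cis t)^*%C ^+ k) /\
  mean (fun t => f (r%:C * cis t) * (cis t)^*%C ^+ k) = c k * r%:C ^+ k.
Proof.
(* At the intermediate radius [s] the terms are bounded, hence they decay like [(r / s) ^+ j] on the
   circle of radius [r]. *)
move=> r0 rr cf; pose s := (r + rho) / 2.
have rs : r < s by rewrite /s; lra.
have sr : s < rho by rewrite /s; lra.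
have s0 : 0 < s by lra.
have [B B0 cB] : exists2 B, 0 < B & forall k, normc (c k) * s ^+ k <= B.
  have /cf/hasum_term_bounded[B B0 h] : normc s%:C < rho.
    by rewrite normc_real gtr0_norm.
  exists B => // j; have := h j.
  by rewrite normcM normcX normc_real gtr0_norm.
have x0 : 0 <= r / s by rewrite divr_ge0// ltW.
have x1 : r / s < 1 by rewrite ltr_pdivrMr// mul1r.
have nz t : normc (r%:C * cis t) = r by rewrite normcM normc_real normc_cis mulr1 ger0_norm.
pose u j t := c j * (r%:C * cis t) ^+ j * (cis t)^*%C ^+ k.
have mcis : cmeasurable setT (cis : measurableTypeR R -> R[i]).
  by apply: ccvg_measurable => t; exact: ccvg_cis.
have [|||fi fs] := @hasum_integralC _ _ (uniform_prob (@lt0_2pi R)) u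
    (fun t => f (r%:C * cis t) * (cis t)^*%C ^+ k) B (r / s) (ltW B0) x0 x1.
- move=> j; apply: cmeasurableM.
    apply: cmeasurableZ; apply: cmeasurableX; exact: cmeasurableZ.
  by apply: cmeasurableX; exact: cmeasurable_conj.
- move=> j t; rewrite !normcM !normcX nz normc_conj normc_cis expr1n mulr1.
  by rewrite expr_div_n mulrA ler_pdivlMr ?exprn_gt0// mulrAC ler_wpM2r ?exprn_ge0.
- move=> t; have h := hasumZ ((cis t)^*%C ^+ k) (cf _ (eq_ind_r (fun y => y < rho) rr (nz t))).
  by rewrite (mulrC (f _)); apply: eq_hasum h => j; rewrite mulrC.
split => //; apply: hasum_unique fs _.
have E j : integralC (uniform_prob (@lt0_2pi R)) setT (u j) = c j * r%:C ^+ j * (j == k)%:R.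
  rewrite -(mean_cis_orthonormal j k) -integralCZ//.
    by apply: eq_integralC => t _; rewrite /u exprMn; ring.
  apply: (@integrableC_mean _ _ 1) => t.
    apply: ccvgM; first exact: ccvg_cisX.
    have -> : (fun y : R => (cis y)^*%C ^+ k) = (fun y => (cis y ^+ k)^*%C).
      by apply/funext => y; rewrite rmorphXn.
    by rewrite -rmorphXn; apply: ccvg_conj; exact: ccvg_cisX.
  by rewrite normcM !normcX normc_conj normc_cis !expr1n mulr1.
have -> : c k * r%:C ^+ k = \sum_(j < k.+1) c j * r%:C ^+ j * (nat_of_ord j == k)%:R.
  rewrite big_ord_recr/= eqxx mulr1 big1 ?add0r// => i _.
  by rewrite ltn_eqF// mulr0.
apply: (eq_hasum (fun j => esym (E j))); apply: hasum_finite => j kj.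
by rewrite gtn_eqF// mulr0.
Qed.

Lemma power_series_unique (c d : nat -> R[i]) (f : R[i] -> R[i]) (rho : R) : 0 < rho ->
  (forall z, normc z < rho -> hasum (fun j => c j * z ^+ j) (f z)) ->
  (forall z, normc z < rho -> hasum (fun j => d j * z ^+ j) (f z)) -> c =1 d.
Proof.
move=> rho0 hc hd k; have r0 : 0 < rho / 2 by rewrite divr_gt0.
have r1 : rho / 2 < rho by lra.
have [_ h1] := power_series_mean k (ltW r0) r1 hc.
have [_ h2] := power_series_mean k (ltW r0) r1 hd.
move: h1; rewrite h2 => /mulIf ->//.
by rewrite expf_neq0// eq_complex/= eqxx andbT gt_eqF.
Qed.

End TermwiseIntegration.

(** * Cauchy's formula by contraction of the circle *)

Section CauchyFormula.
Context {R : realType}.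
Local Notation U := (uniform_prob (@lt0_2pi R)).
Variables (f f' : R[i] -> R[i]) (z0 : R[i]) (r : R).
Hypothesis df : forall a, normc a < 1 -> strict_diff f a (f' a).
Hypotheses (z0r : normc z0 < r) (r1 : r < 1).

(** At the point [w = r * cis t] this is [w / (w - z0)], Cauchy's kernel for the measure
    [dt / 2 pi]; the conjugate of [cis t], which is its inverse, displays it as the sum of a
    geometric series. *)
Let cauchy_kernel (t : R) : R[i] := (1 - z0 / r%:C * (cis t)^*%C)^-1.
(** The homothety with centre [z0]: it is the point [z0] for [x = 0] and the circle of radius [r]
    for [x = 1]. *)
Let zeta (x t : R) : R[i] := z0 + x%:C * (r%:C * cis t - z0).
(** Differentiation under the integral takes place on an open interval of parameters, hence a margin
    around [[0, 1]]; within it the path stays in the closed disk of radius [s = (1 + r) / 2]. *)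
Let delta : R := (1 - r) / 4.
Let s : R := r + 2 * delta.

Let r0 : 0 < r. Proof. exact: le_lt_trans (normc_ge0 _) z0r. Qed.
Let rC0 : r%:C != 0 :> R[i].
Proof. by rewrite eq_complex/= eqxx andbT gt_eqF// r0. Qed.
Let q : R := normc z0 / r.
Let q0 : 0 <= q. Proof. by rewrite divr_ge0 ?normc_ge0// ltW// r0. Qed.
Let q1 : q < 1. Proof. by rewrite ltr_pdivrMr ?r0// mul1r. Qed.
Let nq t : normc (z0 / r%:C * (cis t)^*%C) = q.
Proof. by rewrite !normcM normc_conj normc_cis mulr1 normcV normc_real gtr0_norm ?r0. Qed.
Let kden t : 1 - z0 / r%:C * (cis t)^*%C != 0.
Proof.
rewrite -normc_gt0; have := lerB_normc 1 (z0 / r%:C * (cis t)^*%C).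
by rewrite normc1 nq => /(lt_le_trans _); apply; rewrite subr_gt0 q1.
Qed.
Let kernelE t : (r%:C * cis t - z0) * cauchy_kernel t = r%:C * cis t.
Proof.
have -> : r%:C * cis t - z0 = r%:C * cis t * (1 - z0 / r%:C * (cis t)^*%C).
  by rewrite mulrBr mulr1 mulrACA cis_conj mulr1 (mulrC r%:C (z0 / _)) divfK.
by rewrite -mulrA /cauchy_kernel mulfV ?mulr1// kden.
Qed.

Let kernel_hasum t : hasum (fun j => (z0 / r%:C) ^+ j * (cis t)^*%C ^+ j) (cauchy_kernel t).
Proof.
apply: (@eq_hasum _ (fun j => (z0 / r%:C * (cis t)^*%C) ^+ j)) => [j|]; first by rewrite exprMn.
set w := z0 / r%:C * (cis t)^*%C.
apply/ccvgP; have h0 : geometric ((1 - q)^-1) q @ \oo --> (0 : R).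
  by apply: cvg_geometric; rewrite ger0_norm ?q1 ?q0.
apply: squeeze_cvgr (cvg_cst (0 : R)) h0; apply: nearW => N.
rewrite normc_ge0/=.
have -> : \sum_(j < N) w ^+ j - cauchy_kernel t = - (w ^+ N * cauchy_kernel t).
  apply: (mulfI (kden t)); rewrite mulrBr -[X in X * \sum_(j < N) _]opprB mulNr -subrX1.
  by rewrite mulrN mulrCA /cauchy_kernel mulfV ?kden// mulr1; ring.
rewrite normcN normcM normcX nq mulrC ler_wpM2r ?exprn_ge0 ?q0//.
rewrite /cauchy_kernel normcV lef_pV2 ?posrE ?subr_gt0 ?q1 ?normc_gt0 ?kden//.
by have := lerB_normc 1 w; rewrite normc1 nq.
Qed.

Let kernel_bound t : normc (cauchy_kernel t) <= (1 - q)^-1.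
Proof.
rewrite /cauchy_kernel normcV lef_pV2 ?posrE ?subr_gt0 ?q1 ?normc_gt0 ?kden//.
by have := lerB_normc 1 (z0 / r%:C * (cis t)^*%C); rewrite normc1 nq.
Qed.

Let mkernel : cmeasurable setT (cauchy_kernel : measurableTypeR R -> R[i]).
Proof.
apply: (@cmeasurable_cvg _ _ _ _ (fun n t => \sum_(j < n) (z0 / r%:C) ^+ j * (cis t)^*%C ^+ j)).
  move=> n; apply: cmeasurable_sum => j; apply: cmeasurableZ; apply: cmeasurableX.
  by apply: cmeasurable_conj; apply: ccvg_measurable => t; exact: ccvg_cis.
by move=> t _; exact: kernel_hasum.
Qed.

Lemma mean_kernel (g : R -> R[i]) M : 0 <= M ->
  cmeasurable setT (g : measurableTypeR R -> R[i]) -> (forall t, normc (g t) <= M) ->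
  hasum (fun j => (z0 / r%:C) ^+ j * mean (fun t => g t * (cis t)^*%C ^+ j))
    (mean (fun t => g t * cauchy_kernel t)).
Proof.
move=> M0 mg gM.
have mcis j : cmeasurable setT (fun t : measurableTypeR R => (cis t)^*%C ^+ j : R[i]).
  apply: cmeasurableX; apply: cmeasurable_conj.
  by apply: ccvg_measurable => t; exact: ccvg_cis.
have [|||_ h] := @hasum_integralC _ _ _ U
    (fun j t => (z0 / r%:C) ^+ j * (g t * (cis t)^*%C ^+ j))
    (fun t => g t * cauchy_kernel t) M q M0 q0 q1.
- by move=> j; apply: cmeasurableZ; exact: cmeasurableM.
- move=> j t; rewrite !normcM !normcX normc_conj normc_cis expr1n mulr1 normcM normcV normc_real.
  by rewrite gtr0_norm ?r0// -/q mulrC ler_wpM2r// exprn_ge0 ?q0.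
- move=> t; have := hasumZ (g t) (kernel_hasum t).
  by apply: eq_hasum => j; rewrite mulrCA.
apply: eq_hasum h => j; rewrite /mean integralCZ//.
apply: (@integrableC_bounded _ _ _ _ _ _ _ M) => //; first exact: cmeasurableM.
by move=> t _; rewrite normcM normcX normc_conj normc_cis expr1n mulr1.
Qed.

Let mean_kernel1 : mean cauchy_kernel = 1.
Proof.
have m1 : cmeasurable setT (fun _ : measurableTypeR R => 1 : R[i]) by exact: cmeasurable_cst.
have := mean_kernel ler01 m1 (fun t => _); rewrite normc1 lexx => /(_ (fun=> isT)).
have -> : (fun t => 1 * cauchy_kernel t) = cauchy_kernel by apply/funext => t; rewrite mul1r.
move=> h; apply: hasum_unique h _.
have E j : mean (fun t => 1 * (cis t)^*%C ^+ j) = (j == 0)%:R :> R[i].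
  by have := @mean_cis_orthonormal R 0 j; under eq_fun do rewrite expr0; rewrite eq_sym.
apply: (@eq_hasum _ (fun j => (j == 0%N)%:R)) => [j|].
  by rewrite E; case: j => [|j]; rewrite ?expr0 ?mulr1// mulr0.
have := @hasum_finite R (fun j => (j == 0%N)%:R) 1; rewrite big_ord1/=; apply.
by case.
Qed.

Let delta0 : 0 < delta. Proof. by rewrite /delta; have := r1; lra. Qed.
Let s1 : s < 1. Proof. by rewrite /s /delta; have := r1; lra. Qed.
Let zeta_s x t : x \in `]-delta, 1 + delta[ -> normc (zeta x t) <= s.
Proof.
rewrite in_itv/= => /andP[x1 x2].
have -> : zeta x t = (1 - x)%:C * z0 + x%:C * (r%:C * cis t).
  by rewrite /zeta rmorphB/= rmorph1; ring.
rewrite (le_trans (le_normcD _ _))// !normcM !normc_real normc_cis mulr1 (gtr0_norm r0).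
have h1 := z0r; have h0 := normc_ge0 z0; have hr := r1; have hr0 := r0; have hd := delta0.
have [x0|x0] := leP 0 x; last first.
  rewrite (ltr0_norm x0) ger0_norm; last by lra.
  by rewrite /s; nra.
have [x1'|x1'] := leP x 1.
  by rewrite !ger0_norm//; [rewrite /s; nra|lra].
rewrite ler0_norm; last by lra.
by rewrite ger0_norm// /s; nra.
Qed.

Let cf' a : normc a < 1 -> ccont f' a.
Proof.
move=> a1; apply: (strict_diff_ccont (df a1)); exists (1 - normc a); first by rewrite subr_gt0.
move=> w wa; apply: df; rewrite -(subrK a w) (le_lt_trans (le_normcD _ _))//.
by rewrite -ltrBrDr.
Qed.

Let bf : exists2 M, 0 < M & forall z, normc z <= s -> normc (f z) <= M.
Proof.
apply: ccont_bounded => z zs; apply: strict_diff_cont (df _).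
exact: le_lt_trans zs s1.
Qed.
Let bf' : exists2 M, 0 < M & forall z, normc z <= s -> normc (f' z) <= M.
Proof. by apply: ccont_bounded => z zs; apply: cf'; exact: le_lt_trans zs s1. Qed.

Let zeta_deriv_x x t : path_deriv (zeta ^~ t) x (r%:C * cis t - z0).
Proof.
have := path_derivD (path_deriv_cst z0 x)
  (path_derivZ (r%:C * cis t - z0) (path_deriv_real x)).
rewrite add0r mulr1; congr path_deriv.
by apply/funext => y; rewrite /zeta mulrC.
Qed.

Let zeta_deriv_t x t : path_deriv (zeta x) t (x%:C * (r%:C * ('i%C * cis t))).
Proof.
have := path_derivD (path_deriv_cst z0 t) (path_derivZ x%:C
  (path_derivD (path_derivZ r%:C (path_deriv_cis t)) (path_deriv_cst (- z0) t))).
by rewrite add0r addr0.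
Qed.

(** The derivative of [Phi x t] in [x]: the kernel turns the velocity [r * cis t - z0] into
    [r * cis t]. *)
Let W x t := f' (zeta x t) * (r%:C * cis t).

Let ccvgW x t : x \in `]-delta, 1 + delta[ -> ccvg (nbhs t) (W x) (W x t).
Proof.
move=> xI; apply: ccvgM; last by apply: ccvgZ; exact: ccvg_cis.
apply: ccont_comp; last exact: path_deriv_cont (zeta_deriv_t x t).
by apply: cf'; exact: le_lt_trans (zeta_s t xI) s1.
Qed.

(** Multiplied by [x * 'i], [W x] is the derivative in [t] of the closed loop [f (zeta x t)]; the
    factor can be divided out because [x != 0]. *)
Let mean_W x : x \in `]-delta, 1 + delta[ -> x != 0 -> mean (W x) = 0.
Proof.
move=> xI x0.
have h : mean (fun t => (x%:C * 'i%C) * W x t) = 0.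
  apply: (mean_path_deriv (G := fun t => f (zeta x t))).
  - move=> t; have := path_deriv_comp (df (le_lt_trans (zeta_s t xI) s1)) (zeta_deriv_t x t).
    by congr path_deriv; rewrite /W; ring.
  - by move=> t; apply: ccvgZ; exact: ccvgW.
  - by rewrite /zeta cis_2pi.
move: h; rewrite /mean integralCZ//.
  move/eqP; rewrite mulf_eq0 => /orP[|/eqP//].
  by rewrite mulf_eq0 !eq_complex/= !eqxx oner_eq0 (negbTE x0).
have [M M0 hM] := bf'.
apply: (@integrableC_mean _ _ (M * r)) => t; first exact: ccvgW.
rewrite !normcM normc_real normc_cis mulr1 gtr0_norm ?r0// ler_wpM2r ?(ltW r0)//.
by apply: hM; exact: zeta_s.
Qed.

Let Phi x t := f (zeta x t) * cauchy_kernel t.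

Let mPhi x : x \in `]-delta, 1 + delta[ ->
  cmeasurable setT ((fun t => f (zeta x t)) : measurableTypeR R -> R[i]).
Proof.
move=> xI; apply: ccvg_measurable => t; apply: ccont_comp.
  by apply: strict_diff_cont (df _); exact: le_lt_trans (zeta_s t xI) s1.
exact: path_deriv_cont (zeta_deriv_t x t).
Qed.

Let iPhi x : x \in `]-delta, 1 + delta[ -> integrableC U setT (Phi x).
Proof.
move=> xI; have [M M0 hM] := bf.
apply: (@integrableC_bounded _ _ _ _ _ _ _ (M / (1 - q))) => //.
  by apply: cmeasurableM => //; exact: mPhi.
move=> t _; rewrite normcM ler_pM ?normc_ge0 ?kernel_bound//.
by apply: hM; exact: zeta_s.
Qed.

Let dPhi x t : x \in `]-delta, 1 + delta[ -> path_deriv (Phi ^~ t) x (W x t).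
Proof.
move=> xI.
have := path_derivZ (cauchy_kernel t)
  (@path_deriv_comp _ f (zeta ^~ t) x _ _ (df (le_lt_trans (zeta_s t xI) s1)) (zeta_deriv_x x t)).
have -> : cauchy_kernel t * (f' (zeta x t) * (r%:C * cis t - z0)) = W x t.
  by rewrite /W -[in RHS]kernelE; ring.
by congr path_deriv; apply/funext => y; rewrite /Phi/= mulrC.
Qed.

(** The mean value theorem is a real statement, so it is applied to a part [p], which will be [Re]
    or [Im]. *)
Let mean_Phi_part (p : R[i] -> R) : (forall z, `|p z| <= normc z) ->
  (forall G x l, path_deriv G x l -> is_derive (x : R) (1 : R) (fun y => p (G y)) (p l)) ->
  (forall g, integrableC U setT g -> U.-integrable setT (EFin \o (fun t => p (g t)))) ->
  (forall g, mean g = 0 -> (\int[U]_t p (g t))%R = 0) ->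
  (\int[U]_t p (Phi 1 t))%R = (\int[U]_t p (Phi 0 t))%R.
Proof.
move=> pn pd pint p0; have hd := delta0.
have [M M0 hM] := bf'.
have derF x : x \in `]-delta, 1 + delta[ ->
    is_derive (x : R) (1 : R) (fun y => (\int[U]_t p (Phi y t))%R) (\int[U]_t p (W x t))%R.
  move=> xI; have mT : measurable [set: measurableTypeR R] by exact: measurableT.
  have dP y t : `]-delta, 1 + delta[%classic y -> partial1of2 (fun y t => p (Phi y t)) y t = p (W y t).
    move=> yI; rewrite /partial1of2 derive1E.
    by case: (pd _ _ _ (dPhi t (yI : y \in `]-delta, 1 + delta[))).
  have H1 y : `]-delta, 1 + delta[%classic y -> U.-integrable setT (EFin \o (fun t => p (Phi y t))).
    by move=> yI; apply: pint; exact: iPhi.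
  have H2 y (t : measurableTypeR R) : `]-delta, 1 + delta[%classic y -> [set: measurableTypeR R] t ->
      derivable (fun y => p (Phi y t)) y 1.
    by move=> yI _; case: (pd _ _ _ (dPhi t (yI : y \in `]-delta, 1 + delta[))).
  have H3 : U.-integrable setT (EFin \o (fun _ : measurableTypeR R => M * r)).
    exact: integrable_cst_prob.
  have H4 y (t : measurableTypeR R) : `]-delta, 1 + delta[%classic y -> [set: measurableTypeR R] t ->
      `|partial1of2 (fun y t => p (Phi y t)) y t| <= M * r.
    move=> yI _; rewrite dP// (le_trans (pn _))// !normcM normc_real normc_cis mulr1.
    rewrite gtr0_norm ?r0// ler_wpM2r ?(ltW r0)//.
    by apply: hM; exact: zeta_s.
  have Mr (t : measurableTypeR R) : 0 <= M * r by rewrite mulr_ge0// ltW// r0.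
  apply: DeriveDef.
    exact: (derivable_under_integral mT xI H1 H2 Mr H3 H4).
  rewrite -derive1E (differentiation_under_integral mT xI H1 H2 Mr H3 H4).
  by apply: eq_Rintegral => t _; exact: dP.
have sub x : x \in `[(0:R), 1] -> x \in `]-delta, 1 + delta[.
  by rewrite !in_itv/= => /andP[h1 h2]; apply/andP; split; lra.
have cF : {within `[(0:R), 1], continuous (fun y => (\int[U]_t p (Phi y t))%R)}.
  apply: derivable_within_continuous => x /sub xI; by case: (derF x xI).
(* The point given by the mean value theorem is interior, hence nonzero, as [mean_W] demands. *)
have [c /[dup] cI] := @MVT R (fun y => (\int[U]_t p (Phi y t))%R)
   (fun x => (\int[U]_t p (W x t))%R) 0 1 ltr01
   (fun x xI => derF x (sub x (subset_itv_oo_cc xI))) cF.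
rewrite in_itv/= => /andP[c0 c1]; rewrite (p0 (W c)) ?mul0r; first by move=> /= /eqP; rewrite subr_eq0 => /eqP.
by apply: mean_W; [apply: sub; exact: subset_itv_oo_cc|rewrite gt_eqF].
Qed.

(** The mean of [Phi x] is the same at both ends: at [x = 0] it is [f z0], the kernel having mean 1,
    and at [x = 1] the expansion of the kernel gives the series. *)
Lemma cauchy_formula : hasum (fun j => (z0 / r%:C) ^+ j *
  mean (fun t => f (r%:C * cis t) * (cis t)^*%C ^+ j)) (f z0).
Proof.
have I1 : 1 \in `]-delta, 1 + delta[ by have := delta0; rewrite in_itv/= => ?; apply/andP; split; lra.
have I0 : 0 \in `]-delta, 1 + delta[ by have := delta0; rewrite in_itv/= => ?; apply/andP; split; lra.
have z1 t : zeta 1 t = r%:C * cis t by rewrite /zeta mul1r addrC subrK.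
have z00 t : zeta 0 t = z0 by rewrite /zeta mul0r addr0.
have : mean (Phi 1) = mean (Phi 0).
  apply: complex_eqP => /=.
    apply: (mean_Phi_part (@Re_le_normc R)).
    - by move=> G x l [].
    - by move=> g [].
    - by move=> g /(congr1 (@complex.Re R)).
  apply: (mean_Phi_part (@Im_le_normc R)).
  - by move=> G x l [].
  - by move=> g [].
  - by move=> g /(congr1 (@complex.Im R)).
have [M M0 hM] := bf.
have -> : mean (Phi 0) = f z0.
  transitivity (mean (fun t => f z0 * cauchy_kernel t)).
    by apply: eq_integralC => t _; rewrite /Phi z00.
  rewrite /mean integralCZ//; first by rewrite -/(mean cauchy_kernel) mean_kernel1 mulr1.
  by apply: (@integrableC_bounded _ _ _ _ _ _ _ ((1 - q)^-1)) => // t _; exact: kernel_bound.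
move=> <-.
have -> : mean (Phi 1) = mean (fun t => f (r%:C * cis t) * cauchy_kernel t).
  by apply: eq_integralC => t _; rewrite /Phi z1.
apply: (mean_kernel (ltW M0)) => [|t].
  by have := mPhi I1; under eq_fun do rewrite z1.
by rewrite -z1; apply: hM; exact: zeta_s.
Qed.

End CauchyFormula.

(** Cauchy's formula expands [f] on each smaller disk, with coefficients computed on its boundary;
    uniqueness of coefficients makes them independent of the radius. *)
Lemma disk_expansion {R : realType} (f : R[i] -> R[i]) :
  (forall a, normc a < 1 -> analytic_at f a) ->
  exists c : nat -> R[i], forall z, normc z < 1 -> hasum (fun k => c k * z ^+ k) (f z).
Proof.
move=> af.
have /choice[f' df] (a : R[i]) : exists c, normc a < 1 -> strict_diff f a c.
  have [a1|a1] := boolP (normc a < 1); last by exists 0.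
  by have [c hc] := analytic_strict_diff (af _ a1); exists c.
pose c (r : R) j := (r%:C^-1) ^+ j * mean (fun t => f (r%:C * cis t) * (cis t)^*%C ^+ j).
have H r z : normc z < r -> r < 1 -> hasum (fun j => c r j * z ^+ j) (f z).
  move=> zr r1; have := cauchy_formula df zr r1; apply: eq_hasum => j.
  by rewrite /c exprMn; ring.
have h0 : 0 < (2^-1 : R) by [].
exists (c (2^-1)) => z z1.
(* [r] exceeds [|z|], to reach [z], and [2^-1], so that its coefficients can be compared with the
   reference ones on the disk of radius [2^-1]. *)
pose r := (Num.max (normc z) (2^-1) + 1) / 2.
have rz : normc z < r.
  have : normc z <= Num.max (normc z) (2^-1) by rewrite le_max lexx.
  by rewrite /r; lra.
have r2 : 2^-1 < r :> R.
  have : 2^-1 <= Num.max (normc z) (2^-1) by rewrite le_max lexx orbT.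
  by rewrite /r; lra.
have r1 : r < 1.
  have : Num.max (normc z) (2^-1) < 1 by rewrite gt_max z1/=; lra.
  by rewrite /r; lra.
have -> : c 2^-1 = c r.
  apply/funext; apply: (power_series_unique h0 (f := f)) => w hw; apply: H => //.
    lra.
  exact: lt_trans hw r2.
exact: H.
Qed.

(** * Integration over the disk in polar coordinates *)

Section RadialIntegration.
Context {R : realType} (mu : probability (measurableTypeR R) R).
Local Notation U := (uniform_prob (@lt0_2pi R)).
Hypothesis mu01 : mu `[0%R, 1%R]%classic = 1%E.
Hypothesis mu1 : mu [set 1%R] = 0%E.

(** Half-open, so that [polar] sends it into the open disk; the endpoint 1 has mass 0. *)
Definition I01 : set (measurableTypeR R) := `[0%R, 1%R[%classic.

Lemma measurable_I01 : measurable I01.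
Proof. exact: measurable_itv. Qed.

Lemma measurable_setC_I01 : measurable (~` I01).
Proof. by apply: measurableC; exact: measurable_I01. Qed.

Lemma mu_setC_I01 : mu (~` I01) = 0%E.
Proof.
have -> : ~` I01 = ~` (`[0%R, 1%R]%classic) `|` [set 1%R] :> set (measurableTypeR R).
  apply/seteqP; split => [x|x].
    rewrite /I01/= !in_itv/= => /negP; rewrite negb_and -!ltNge => /orP[x0|x1].
      by left; apply/negP; rewrite negb_and -!ltNge x0.
    have [->|x1'] := eqVneq x 1; first by right.
    left => /andP[_ xle1]; move: x1.
    by rewrite -leNgt le_eqVlt eq_sym (negbTE x1')/= ltNge xle1.
  rewrite /I01/= !in_itv/= => -[h|->]; last by rewrite ltxx andbF.
  by apply: contra_not h => /andP[-> /ltW].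
apply/eqP; rewrite eq_le measure_ge0 andbT.
have mC : measurable (~` (`[0%R, 1%R]%classic) : set (measurableTypeR R)).
  by apply: measurableC; exact: measurable_itv.
have mS : measurable ([set 1%R] : set (measurableTypeR R)) by exact: measurable_set1.
rewrite (le_trans (measureU2 _ mC mS))//.
have E : (mu (~` `[0%R, 1%R]%classic) + mu [set 1%R] = 0)%E.
  by rewrite mu1 adde0 probability_setC ?mu01 ?subee//; exact: measurable_itv.
by have /eqP := E; rewrite eq_le => /andP[].
Qed.

Lemma measurable_normc_to_complex :
  measurable_fun setT (fun p : R * R => normc (to_complex p)).
Proof.
apply: cmeasurable_normc; split => /=; [exact: measurable_fst|exact: measurable_snd].
Qed.

Lemma measurable_plane_disk : measurable (@plane_disk R).
Proof.
have := measurable_normc_to_complex measurableT (measurable_itv `]-oo, (1:R)[).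
by rewrite setTI; congr measurable.
Qed.

Lemma to_complex_polar (r t : R) : to_complex (polar (r, t)) = r%:C * cis t.
Proof. by apply: complex_eqP; rewrite ?ReM ?ImM/=; ring. Qed.

Lemma polar_disk (r t : R) : I01 r -> plane_disk (polar (r, t)).
Proof.
rewrite /I01/= in_itv/= => /andP[r0 r1].
change (normc (to_complex (polar (r, t))) < 1).
by rewrite to_complex_polar normcM normc_cis mulr1 normc_real ger0_norm.
Qed.

Lemma nuE (A : set (R * R)) : nu mu A = (mu \x U)%E (polar @^-1` A).
Proof. by []. Qed.

Lemma integral_restrict_I01 (f : measurableTypeR R -> \bar R) : mu.-integrable setT f ->
  (\int[mu]_x f x = \int[mu]_(x in I01) f x)%E.
Proof.
move=> fi; rewrite (@negligible_integral _ _ _ mu setT (~` I01))//.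
- by rewrite setTD setCK.
- exact: measurable_setC_I01.
- exact: mu_setC_I01.
Qed.

Lemma integrable_polar (F : R * R -> R) :
  (nu mu).-integrable plane_disk (EFin \o F) ->
  (mu \x U)%E.-integrable setT (((EFin \o F) \_ plane_disk) \o polar).
Proof.
have mD := measurable_plane_disk.
move=> /(integrable_mkcond _ mD) /integrableP[mG iG].
apply/integrableP; split.
  exact: (measurableT_comp mG (@measurable_polar R)).
apply: le_lt_trans iG.
rewrite [leRHS](_ : _ = \int[pushforward (mu \x U)%E polar]_x `|((EFin \o F) \_ plane_disk) x|)%E//.
rewrite ge0_integral_pushforward//.
exact: measurableT_comp.
Qed.

(** Change of variables along [polar], combined with Fubini. The extension by 0 outside the disk is
    invisible for [r] in [I01]. *)
Lemma radial_integral (F : R * R -> R) (h : R -> R) :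
  (nu mu).-integrable plane_disk (EFin \o F) ->
  (forall r, I01 r -> U.-integrable setT (EFin \o (fun t => F (polar (r, t)))) /\
     (\int[U]_t F (polar (r, t)))%R = h r) ->
  (\int[nu mu]_(p in plane_disk) F p)%R = (\int[mu]_(r in I01) h r)%R.
Proof.
move=> iF Fh; have mD := measurable_plane_disk.
have /integrableP[mG _] := (integrable_mkcond _ mD).1 iF.
rewrite /Rintegral; congr fine.
rewrite integral_mkcond.
rewrite [LHS](_ : _ = \int[pushforward (mu \x U)%E polar]_x ((EFin \o F) \_ plane_disk) x)%E//.
have iP := integrable_polar iF.
rewrite integral_pushforward//.
rewrite preimage_setT -integral12_prod_meas1//.
rewrite integral_restrict_I01; last exact: integrable_fubini_F.
apply: eq_integral => r /set_mem Ir; rewrite /fubini_F.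
have [ir <-] := Fh _ Ir.
have -> : (\int[U]_t (((EFin \o F) \_ plane_disk) \o polar) (r, t) =
           \int[U]_t (F (polar (r, t)))%:E)%E.
  by apply: eq_integral => t _ /=; rewrite patchE mem_set//; exact: polar_disk.
rewrite /Rintegral fineK//; apply: integrable_fin_num => //.
Qed.

Lemma radial_integralC (H : R[i] -> R[i]) (h : R -> R[i]) :
  integrableC (nu mu) plane_disk (fun p => H (to_complex p)) ->
  (forall r : R, I01 r -> integrableC U setT (fun t => H (r%:C * cis t)) /\
     mean (fun t => H (r%:C * cis t)) = h r) ->
  integralC (nu mu) plane_disk (fun p => H (to_complex p)) = integralC mu I01 h.
Proof.
move=> [i1 i2] Hh; apply: complex_eqP => /=; apply: radial_integral => // r Ir.
  have [[j1 j2] e] := Hh _ Ir; have {e} := congr1 (@complex.Re R) e => /= e.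
  have E : (fun t => complex.Re (H (to_complex (polar (r, t))))) =
      (fun t => complex.Re (H (r%:C * cis t))).
    by apply/funext => t; rewrite to_complex_polar.
  by split; [have := j1; rewrite -E|rewrite -e -E].
have [[j1 j2] e] := Hh _ Ir; have {e} := congr1 (@complex.Im R) e => /= e.
have E : (fun t => complex.Im (H (to_complex (polar (r, t))))) =
    (fun t => complex.Im (H (r%:C * cis t))).
  by apply/funext => t; rewrite to_complex_polar.
by split; [have := j2; rewrite -E|rewrite -e -E].
Qed.

(** Serves to transfer a bound on [q] valid off a [mu]-null set to the symbol [q(|z|)] on the
    disk. *)
Lemma nu_radial_negligible (B : set (measurableTypeR R)) : measurable B -> mu B = 0%E ->
  (nu mu).-negligible (plane_disk `&` [set p | B (normc (to_complex p))]).
Proof.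
move=> mB B0; have mD := measurable_plane_disk.
have mA : measurable (plane_disk `&` [set p : R * R | B (normc (to_complex p))]).
  apply: measurableI => //.
  by have := measurable_normc_to_complex measurableT mB; rewrite setTI.
exists (plane_disk `&` [set p : R * R | B (normc (to_complex p))]); split => //.
apply/eqP; rewrite eq_le measure_ge0 andbT nuE.
(* For negative [r] the modulus of [polar (r, t)] is [- r], so membership in [B] says nothing about
   [r]; such [r] are adjoined as part of a null set. *)
have mBI : measurable (B `|` ~` I01) by apply: measurableU => //; exact: measurable_setC_I01.
have -> : 0%E = (mu \x U)%E ((B `|` ~` I01) `*` setT).
  rewrite product_measure1E//= probability_setT mule1; apply/esym/eqP.
  rewrite eq_le measure_ge0 andbT (le_trans (measureU2 _ mB measurable_setC_I01))//.
  have E : (mu B + mu (~` I01) = 0)%E by rewrite B0 mu_setC_I01 adde0.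
  by have /eqP := E; rewrite eq_le => /andP[].
apply: le_measure; rewrite ?inE.
- have := @measurable_polar R measurableT _ mA; by rewrite setTI.
- exact: measurableX.
move=> [r t] [_ h]; split => //.
have {}h : B (normc (to_complex (polar (r, t)))) := h.
rewrite to_complex_polar in h.
have [Ir|] := pselect (I01 r); last by right.
left; move: h; rewrite normcM normc_cis mulr1 normc_real.
by move: Ir; rewrite /I01/= in_itv/= => /andP[r0 _]; rewrite ger0_norm.
Qed.

End RadialIntegration.

Section Conjugation.
Context {R : realType}.
Implicit Types z w : R[i].

Lemma conjcD z w : (z + w)^*%C = z^*%C + w^*%C. Proof. exact: rmorphD. Qed.
Lemma conjcB z w : (z - w)^*%C = z^*%C - w^*%C. Proof. exact: rmorphB. Qed.
Lemma conjcM z w : (z * w)^*%C = z^*%C * w^*%C. Proof. exact: rmorphM. Qed.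
Lemma conjcX z k : (z ^+ k)^*%C = z^*%C ^+ k. Proof. exact: rmorphXn. Qed.
Lemma real_complexX (x : R) k : (x ^+ k)%:C = x%:C ^+ k. Proof. exact: rmorphXn. Qed.
Lemma conjc_sum (I : Type) (r : seq I) (F : I -> R[i]) :
  (\sum_(i <- r) F i)^*%C = \sum_(i <- r) (F i)^*%C.
Proof. exact: rmorph_sum. Qed.
Lemma Re_real (x : R) : complex.Re x%:C = x. Proof. by []. Qed.
Lemma Im_real (x : R) : complex.Im x%:C = 0. Proof. by []. Qed.

End Conjugation.

(** * Square-integrable functions on the disk and their inner product *)

Section SquareIntegrable.
Context {R : realType} (mu : probability (measurableTypeR R) R).
Implicit Types (u v : R[i] -> R[i]).
Let mD := @measurable_plane_disk R.

Definition L2disk u : Prop :=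
  cmeasurable (@plane_disk R) (fun p => u (to_complex p)) /\
  (nu mu).-integrable plane_disk (EFin \o (fun p => normc (u (to_complex p)) ^+ 2)).

Definition sqnorm u : R := (\int[nu mu]_(p in plane_disk) (normc (u (to_complex p)) ^+ 2))%R.

Lemma sqnorm_ge0 u : 0 <= sqnorm u.
Proof. by apply: Rintegral_ge0 => p _; rewrite sqr_ge0. Qed.

Lemma cmeasurable_to_complex : cmeasurable setT (@to_complex R).
Proof. by split; [exact: measurable_fst|exact: measurable_snd]. Qed.

Lemma cmeasurable_subset d (T : measurableType d) (A : set T) (f : T -> R[i]) :
  measurable A -> cmeasurable setT f -> cmeasurable A f.
Proof. by move=> mA [f1 f2]; split; exact: measurable_funTS. Qed.

Lemma eq_cmeasurable d (T : measurableType d) (A : set T) (f g : T -> R[i]) :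
  (forall x, A x -> f x = g x) -> cmeasurable A f -> cmeasurable A g.
Proof.
by move=> fg [f1 f2]; split; [apply: eq_measurable_fun f1|apply: eq_measurable_fun f2] => x;
  rewrite inE => Ax; rewrite fg.
Qed.

Lemma L2disk_dominated u (F : R * R -> R) : cmeasurable (@plane_disk R) (fun p => u (to_complex p)) ->
  (nu mu).-integrable plane_disk (EFin \o F) ->
  (forall p, plane_disk p -> normc (u (to_complex p)) ^+ 2 <= F p) -> L2disk u.
Proof.
move=> mu' iF uF; split => //; apply: le_integrable iF => //.
  by apply/measurable_EFinP; exact: cmeasurable_normc2.
move=> p Dp /=; rewrite lee_fin ger0_norm ?sqr_ge0// (le_trans (uF _ Dp))//.
exact: ler_norm.
Qed.

Lemma eq_L2disk u v : (forall z, disk z -> u z = v z) -> L2disk u -> L2disk v.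
Proof.
move=> uv [mu' iu]; split.
  by apply: eq_cmeasurable mu' => p Dp; rewrite uv.
by apply: eq_integrable iu => // p; rewrite inE => Dp /=; rewrite uv.
Qed.

Lemma L2disk_bounded u M : cmeasurable (@plane_disk R) (fun p => u (to_complex p)) ->
  (forall z, disk z -> normc (u z) <= M) -> L2disk u.
Proof.
move=> mu' uM; apply: (@L2disk_dominated _ (fun=> M ^+ 2)) => //.
  exact: integrable_cst_prob.
by move=> p Dp; rewrite lerXn2r ?nnegrE ?normc_ge0//; [exact: le_trans (normc_ge0 _) (uM _ Dp)|exact: uM].
Qed.

Lemma L2disk0 : L2disk (fun=> 0).
Proof.
by apply: (@L2disk_bounded _ 0) => [|z _]; [exact: cmeasurable_cst|rewrite normc0].
Qed.

Lemma L2diskD u v : L2disk u -> L2disk v -> L2disk (fun z => u z + v z).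
Proof.
move=> [mu' iu] [mv iv].
apply: (@L2disk_dominated _ (fun p => 2 * normc (u (to_complex p)) ^+ 2 +
    2 * normc (v (to_complex p)) ^+ 2)).
- exact: cmeasurableD.
- by apply: integrable_realD => //; apply: integrable_realZ.
- move=> p _; set a := u _; set b := v _.
  have := le_normcD a b; have := normc_ge0 (a + b); have := normc_ge0 a; have := normc_ge0 b.
  set x := normc a; set y := normc b; set w := normc (a + b) => y0 x0 w0 h.
  have : w ^+ 2 <= (x + y) ^+ 2 by rewrite lerXn2r ?nnegrE ?addr_ge0.
  have := sqr_ge0 (x - y); nra.
Qed.

Lemma L2diskZ c u : L2disk u -> L2disk (fun z => c * u z).
Proof.
move=> [mu' iu]; split; first exact: cmeasurableZ.
have /= := integrable_realZ mD (normc c ^+ 2) iu.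
by congr (_.-integrable _ _); apply/funext => p /=; rewrite normcM exprMn.
Qed.

Lemma L2diskB u v : L2disk u -> L2disk v -> L2disk (fun z => u z - v z).
Proof.
move=> hu hv; apply: (@eq_L2disk (fun z => u z + -1 * v z)) => [z _|]; first by rewrite mulN1r.
by apply: L2diskD => //; exact: L2diskZ.
Qed.

Lemma L2disk_sum (I : Type) (r : seq I) (F : I -> R[i] -> R[i]) :
  (forall i, L2disk (F i)) -> L2disk (fun z => \sum_(i <- r) F i z).
Proof.
move=> hF; elim: r => [|i r ih].
  by under eq_fun do rewrite big_nil; exact: L2disk0.
by under eq_fun do rewrite big_cons; exact: L2diskD.
Qed.

Lemma inner_integrable u v : L2disk u -> L2disk v ->
  integrableC (nu mu) plane_disk (fun p => u (to_complex p) * ((v (to_complex p))^*)%C).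
Proof.
move=> [mu' iu] [mv iv].
apply: (@integrableC_dominated _ _ _ _ _ mD _ (fun p => normc (u (to_complex p)) ^+ 2 +
    normc (v (to_complex p)) ^+ 2)).
- by apply: cmeasurableM => //; exact: cmeasurable_conj.
- exact: integrable_realD.
- move=> p _; rewrite normcM normc_conj.
  have := sqr_ge0 (normc (u (to_complex p)) - normc (v (to_complex p))).
  have := normc_ge0 (u (to_complex p)); have := normc_ge0 (v (to_complex p)); nra.
Qed.

Lemma innerDl u v w : L2disk u -> L2disk v -> L2disk w ->
  inner mu (fun z => u z + v z) w = inner mu u w + inner mu v w.
Proof.
move=> hu hv hw; rewrite /inner -integralCD//; try exact: inner_integrable.
by apply: eq_integralC => p _; rewrite mulrDl.
Qed.

Lemma innerZl c u w : L2disk u -> L2disk w ->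
  inner mu (fun z => c * u z) w = c * inner mu u w.
Proof.
move=> hu hw; rewrite /inner -integralCZ//; last exact: inner_integrable.
by apply: eq_integralC => p _; rewrite mulrA.
Qed.

Lemma inner_conj u v : L2disk u -> L2disk v -> inner mu v u = (inner mu u v)^*%C.
Proof.
move=> hu hv; rewrite /inner -integralC_conj//; last exact: inner_integrable.
by apply: eq_integralC => p _; rewrite rmorphM/= conjcK mulrC.
Qed.

Lemma eq_inner u u' v v' : (forall z, disk z -> u z = u' z) -> (forall z, disk z -> v z = v' z) ->
  inner mu u v = inner mu u' v'.
Proof. by move=> uu vv; apply: eq_integralC => p Dp; rewrite uu// vv. Qed.

Lemma innerBl u v w : L2disk u -> L2disk v -> L2disk w ->
  inner mu (fun z => u z - v z) w = inner mu u w - inner mu v w.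
Proof.
move=> hu hv hw; rewrite -[in RHS]mulN1r -innerZl// -innerDl//; last exact: L2diskZ.
by apply: eq_inner => // z _; rewrite mulN1r.
Qed.

Lemma inner_suml (I : Type) (r : seq I) (F : I -> R[i] -> R[i]) w :
  (forall i, L2disk (F i)) -> L2disk w ->
  inner mu (fun z => \sum_(i <- r) F i z) w = \sum_(i <- r) inner mu (F i) w.
Proof.
move=> hF hw; elim: r => [|i r ih].
  rewrite big_nil -[RHS](integralC0 (nu mu) (@plane_disk R)).
  by apply: eq_integralC => p _; rewrite big_nil mul0r.
rewrite big_cons -ih -innerDl//; last exact: L2disk_sum.
by apply: eq_inner => // z _; rewrite big_cons.
Qed.

Lemma innerDr u v w : L2disk u -> L2disk v -> L2disk w ->
  inner mu w (fun z => u z + v z) = inner mu w u + inner mu w v.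
Proof.
move=> hu hv hw; rewrite inner_conj//; last exact: L2diskD.
by rewrite innerDl// conjcD -!inner_conj.
Qed.

Lemma innerZr c u w : L2disk u -> L2disk w ->
  inner mu w (fun z => c * u z) = c^*%C * inner mu w u.
Proof.
move=> hu hw; rewrite inner_conj//; last exact: L2diskZ.
by rewrite innerZl// conjcM -!inner_conj.
Qed.

Lemma innerBr u v w : L2disk u -> L2disk v -> L2disk w ->
  inner mu w (fun z => u z - v z) = inner mu w u - inner mu w v.
Proof.
move=> hu hv hw; rewrite inner_conj//; last exact: L2diskB.
by rewrite innerBl// conjcB -!inner_conj.
Qed.

Lemma inner_sumr (I : Type) (r : seq I) (F : I -> R[i] -> R[i]) w :
  (forall i, L2disk (F i)) -> L2disk w ->
  inner mu w (fun z => \sum_(i <- r) F i z) = \sum_(i <- r) inner mu w (F i).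
Proof.
move=> hF hw; rewrite inner_conj//; last exact: L2disk_sum.
by rewrite inner_suml// conjc_sum; apply: eq_bigr => i _; rewrite -inner_conj.
Qed.

Lemma inner_sqnorm u : L2disk u -> inner mu u u = (sqnorm u)%:C.
Proof.
move=> hu; apply: complex_eqP => /=.
  by apply: eq_Rintegral => p _; rewrite mulc_conj.
rewrite (@eq_Rintegral _ _ _ _ _ (fun=> 0)); last by move=> p _; rewrite mulc_conj.
by rewrite /Rintegral integral0.
Qed.

(* Expand [0 <= |t u + v|^2] for both signs of t. *)
Lemma Re_inner_le u v t : L2disk u -> L2disk v -> 0 < t ->
  2 * t * `|complex.Re (inner mu u v)| <= t ^+ 2 * sqnorm u + sqnorm v.
Proof.
move=> hu hv t0.
have H s : 0 <= s ^+ 2 * sqnorm u + 2 * s * complex.Re (inner mu u v) + sqnorm v.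
  have hsu : L2disk (fun z => s%:C * u z) by exact: L2diskZ.
  have := sqnorm_ge0 (fun z => s%:C * u z + v z).
  have := inner_sqnorm (L2diskD hsu hv); rewrite innerDl ?innerDr//; try exact: L2diskD.
  rewrite !innerZl// !innerZr// (@inner_conj u v)// !inner_sqnorm// conjc_real.
  move=> E; have Er : complex.Re _ = sqnorm _ := congr1 (@complex.Re R) E.
  rewrite -Er.
  rewrite !ReD !ReM !ImM !Re_conj !Re_real !Im_real.
  by congr (0 <= _); ring.
have [h|h] := leP 0 (complex.Re (inner mu u v)).
  by rewrite ger0_norm//; have := H (- t); rewrite sqrrN; lra.
by rewrite ltr0_norm//; have := H t; lra.
Qed.

(** A substitute for Cauchy-Schwarz, in the form in which the density of finite combinations of the
    [e_ k] is used. *)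
Lemma inner_eq0_approx u (c : R[i]) : L2disk u ->
  (forall e : R, 0 < e -> exists v, [/\ L2disk v, inner mu u v = c & sqnorm v <= e]) -> c = 0.
Proof.
move=> hu happ.
have main u' x : L2disk u' -> (forall e : R, 0 < e -> exists v, [/\ L2disk v,
    `|complex.Re (inner mu u' v)| = x & sqnorm v <= e]) -> x <= 0.
  move=> hu' H; have n0 := sqnorm_ge0 u'.
  rewrite leNgt; apply/negP => x0.
  (* This [t] gives [t ^+ 2 * sqnorm u' <= t * x]; with [sqnorm v <= t * x / 2], [Re_inner_le] then
     reads [2 * t * x <= 3 / 2 * t * x], which is absurd. *)
  pose t := x / (sqnorm u' + 1).
  have t0 : 0 < t by rewrite divr_gt0// ltr_wpDl.
  have txx : t * (sqnorm u' + 1) = x by rewrite divfK// gt_eqF// ltr_wpDl.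
  have [v [hv vx ve]] := H (t * x / 2) (divr_gt0 (mulr_gt0 t0 x0) (ltr0Sn _ _)).
  have := Re_inner_le hu' hv t0; rewrite vx.
  have : t ^+ 2 * sqnorm u' <= t * x by rewrite -txx mulrA -expr2 ler_wpM2l ?sqr_ge0// lerDl.
  have := mulr_gt0 t0 x0; nra.
have hR : complex.Re c = 0.
  apply/eqP; rewrite -normr_eq0 -normr_le0 normr_id; apply: (main u) => // e /happ[v [hv <- ve]].
  by exists v.
have hI : complex.Im c = 0.
  apply/eqP; rewrite -normr_eq0 -normr_le0 normr_id.
  (* The imaginary part of [c] is, up to sign, the real part obtained for ['i * u]. *)
  apply: (main (fun z => 'i%C * u z)) => [|e /happ[v [hv <- ve]]]; first exact: L2diskZ.
  exists v; split => //; rewrite innerZl// ReM [complex.Re 'i%C]/= [complex.Im 'i%C]/= mul0r mul1r sub0r normrN//.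
by apply: complex_eqP.
Qed.

End SquareIntegrable.

(** * Moments of [mu] and norms of monomials *)

Section Moments.
Context {R : realType} (mu : probability (measurableTypeR R) R).
Hypothesis mu01 : mu `[0%R, 1%R]%classic = 1%E.
Hypothesis mu1 : mu [set 1%R] = 0%E.
Hypothesis supp1 : supp mu 1.
Let mI := @measurable_I01 R.

Definition moment (p : nat) : R := (\int[mu]_(r in I01) (r ^+ p))%R.

Lemma I01P (r : R) : I01 r -> 0 <= r /\ r < 1.
Proof. by rewrite /I01/= in_itv/= => /andP. Qed.

Lemma measurable_exprn (A : set (measurableTypeR R)) p :
  measurable_fun A (fun r : measurableTypeR R => r ^+ p).
Proof. by apply: measurable_funX; exact: measurable_id. Qed.

Lemma integrable_mul_exprn (f : R -> R) p : mu.-integrable I01 (EFin \o f) ->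
  mu.-integrable I01 (EFin \o (fun r => f r * r ^+ p)).
Proof.
move=> fi; have /integrableP[/measurable_EFinP mf _] := fi.
apply: le_integrable fi => //.
  by apply/measurable_EFinP; apply: measurable_funM => //; exact: measurable_exprn.
move=> r /I01P[r0 r1] /=; rewrite lee_fin normrM ler_piMr//.
by rewrite ger0_norm ?exprn_ge0// exprn_ile1// ltW.
Qed.

Lemma integrable_exprn p : mu.-integrable I01 (EFin \o (fun r => r ^+ p)).
Proof.
have := @integrable_mul_exprn (fun=> 1) p (integrable_cst_prob mu mI 1).
by under eq_fun do rewrite mul1r.
Qed.

Lemma integrableC_mul_exprn (f : R -> R[i]) p : integrableC mu I01 f ->
  integrableC mu I01 (fun r => f r * (r ^+ p)%:C).
Proof.
move=> [f1 f2]; split.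
  have := integrable_mul_exprn p f1; congr (_.-integrable _ _).
  by apply/funext => r /=; rewrite ReM/= mulr0 subr0.
have := integrable_mul_exprn p f2; congr (_.-integrable _ _).
by apply/funext => r /=; rewrite ImM/= mulr0 add0r.
Qed.

(** Markov's inequality. *)
Lemma Rintegral_ge_cst (f : R -> R) (A : set (measurableTypeR R)) c :
  measurable A -> A `<=` I01 -> mu.-integrable I01 (EFin \o f) ->
  (forall r, I01 r -> 0 <= f r) -> (forall r, A r -> c <= f r) -> 0 <= c ->
  c * fine (mu A) <= (\int[mu]_(r in I01) f r)%R.
Proof.
move=> mA AI fi f0 cf c0; rewrite -lee_fin /Rintegral fineK; last exact: integrable_fin_num.
rewrite EFinM fineK; last exact: fin_num_measure.
rewrite -[leLHS](integral_cst mu mA c%:E).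
have /integrableP[mf _] := fi.
apply: (@le_trans _ _ (\int[mu]_(r in A) (f r)%:E)%E).
  apply: ge0_le_integral => //.
  exact: measurable_funS mf.
by apply: ge0_subset_integral => // r Ir; rewrite lee_fin f0.
Qed.

Lemma mu_near1_gt0 (s : R) : 0 <= s -> s < 1 ->
  0 < fine (mu `]s, 1[%classic).
Proof.
move=> s0 s1; rewrite fine_gt0//; apply/andP; split; last first.
  by rewrite ltey_eq fin_num_measure//; exact: measurable_itv.
(* The support gives mass to neighbourhoods of 1 in the whole line; what lies in [[1, 2[] is
   null. *)
have oU : open (`]s, 2[%classic : set R) by exact: interval_open.
have h := supp1 oU.
apply: lt_le_trans (h _) _; first by rewrite /= in_itv/= s1/=; lra.
have mC := @measurable_setC_I01 R.
have mA : measurable (`]s, 1[%classic : set (measurableTypeR R)) by exact: measurable_itv.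
apply: (@le_trans _ _ (mu (`]s, 1[%classic `|` ~` I01))).
  apply: le_measure; rewrite ?inE; [exact: measurable_itv|exact: measurableU|].
  move=> x /=; rewrite !in_itv/= => /andP[sx x2].
  have [x1|x1] := ltP x 1; first by left; rewrite sx.
  by right; rewrite /I01/= in_itv/= => /andP[_]; rewrite ltNge x1.
apply: (le_trans (measureU2 _ mA mC)).
have E : (mu `]s, 1%R[%classic + mu (~` I01) = mu `]s, 1%R[%classic)%E.
  by rewrite (mu_setC_I01 mu01 mu1) adde0.
by have /eqP := E; rewrite eq_le => /andP[].
Qed.

(** The mass of []s, 1[] alone contributes this much. It is what will make square-summable
    coordinates define power series that converge on the whole disk. *)
Lemma moment_lower (s : R) : 0 <= s -> s < 1 ->
  exists2 m, 0 < m & forall p, m * s ^+ p <= moment p.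
Proof.
move=> s0 s1; exists (fine (mu `]s, 1[%classic)); first exact: mu_near1_gt0.
move=> p; rewrite mulrC; apply: Rintegral_ge_cst.
- exact: measurable_itv.
- by move=> r /=; rewrite /I01/= !in_itv/= => /andP[/ltW sr ->]; rewrite (le_trans s0 sr).
- exact: integrable_exprn.
- by move=> r /I01P[r0 _]; rewrite exprn_ge0.
- move=> r; rewrite /= in_itv/= => /andP[sr _].
  by rewrite lerXn2r ?nnegrE ?(ltW sr)// (le_trans s0)// ltW.
- by rewrite exprn_ge0.
Qed.

Lemma moment_gt0 p : 0 < moment p.
Proof.
have h0 : (0 : R) <= 2^-1 by [].
have h1 : (2^-1 : R) < 1 by lra.
have [m m0 h] := moment_lower h0 h1.
by apply: lt_le_trans (h p); rewrite mulr_gt0// exprn_gt0.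
Qed.

Lemma gammaE p : gamma_ mu p%:R = moment p.
Proof.
rewrite /gamma_ /moment /Rintegral; congr fine.
have mJ : measurable (`[0%R, 1%R]%classic : set (measurableTypeR R)) by exact: measurable_itv.
have mS : measurable ([set 1%R] : set (measurableTypeR R)) by exact: measurable_set1.
transitivity (\int[mu]_(x in `[0%R, 1%R]%classic) (x ^+ p)%:E)%E.
  apply: eq_integral => x; rewrite inE/= in_itv/= => /andP[x0 _].
  by rewrite powR_mulrn.
rewrite (@negligible_integral _ _ _ mu `[0%R, 1%R]%classic [set 1%R])//.
  congr integral; apply/seteqP; split => [x|x]; rewrite /I01/= !in_itv/=.
    by move=> [/andP[-> x1] /eqP xn]; rewrite lt_neqAle xn x1.
  by move=> /andP[-> x1]; split; [rewrite ltW|apply/eqP; rewrite lt_eqF].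
apply: le_integrable (integrable_cst_prob mu mJ 1) => //.
  by apply/measurable_EFinP; exact: measurable_exprn.
move=> x /=; rewrite in_itv/= => /andP[x0 x1].
by rewrite lee_fin normr1 ger0_norm ?exprn_ge0// exprn_ile1.
Qed.

(** The norm of [z ^+ k]. *)
Definition sg (k : nat) : R := Num.sqrt (moment (2 * k)).

Lemma sg_gt0 k : 0 < sg k. Proof. by rewrite sqrtr_gt0 moment_gt0. Qed.

Lemma sgC_neq0 k : (sg k)%:C != 0 :> R[i].
Proof. by rewrite eq_complex/= eqxx andbT gt_eqF// sg_gt0. Qed.

Lemma sqr_sg k : sg k ^+ 2 = moment (2 * k).
Proof. by rewrite sqr_sqrtr// ltW// moment_gt0. Qed.

Lemma e_E k z : disk z -> e_ mu k z = ((sg k)%:C)^-1 * z ^+ k.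
Proof.
move=> dz; rewrite /e_ mem_set// gammaE powRN powR12_sqrt ?ltW ?moment_gt0//.
by rewrite real_complexV.
Qed.

Lemma e_notin k z : ~ disk z -> e_ mu k z = 0.
Proof. by move=> dz; rewrite /e_ memNset. Qed.

Definition power_on (c : nat -> R[i]) (f : R[i] -> R[i]) : Prop :=
  forall z, normc z < 1 -> hasum (fun k => c k * z ^+ k) (f z).

Lemma power_on_cmeasurable c f : power_on c f ->
  cmeasurable (@plane_disk R) (fun p => f (to_complex p)).
Proof.
move=> cf.
apply: (@cmeasurable_cvg _ _ _ _ (fun n p => \sum_(k < n) c k * to_complex p ^+ k)).
  move=> n; apply: cmeasurable_sum => k; apply: cmeasurableZ; apply: cmeasurableX.
  by apply: cmeasurable_subset; [exact: measurable_plane_disk|exact: cmeasurable_to_complex].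
by move=> p Dp; exact: cf.
Qed.

(** Angular integration leaves only the coefficient [c k]. With [phi = 1] this computes coordinates,
    with [phi = q] the diagonal entries of [D]. *)
Lemma inner_radial (phi : R -> R[i]) f c (w : R[i]) k : power_on c f ->
  integrableC mu I01 phi -> L2disk mu (fun z => phi (normc z) * f z) ->
  L2disk mu (fun z => w * z ^+ k) ->
  inner mu (fun z => phi (normc z) * f z) (fun z => w * z ^+ k) =
  c k * w^*%C * integralC mu I01 (fun r => phi r * (r ^+ (2 * k))%:C).
Proof.
move=> cf iphi L2f L2w.
rewrite -integralCZ//; last exact: integrableC_mul_exprn.
apply: (radial_integralC mu01 mu1
  (H := fun z => phi (normc z) * f z * (w * z ^+ k)^*%C)).
  exact: (inner_integrable L2f L2w).
move=> r /I01P[r0 r1].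
have [i1 e1] := power_series_mean k r0 r1 cf.
have E t : phi (normc (r%:C * cis t)) * f (r%:C * cis t) * (w * (r%:C * cis t) ^+ k)^*%C =
    (phi r * w^*%C * (r ^+ k)%:C) * (f (r%:C * cis t) * (cis t)^*%C ^+ k).
  rewrite normcM normc_cis mulr1 normc_real ger0_norm// conjcM.
  rewrite [((r%:C * cis t) ^+ k)^*%C](_ : _ = (r ^+ k)%:C * (cis t)^*%C ^+ k).
    by ring.
  by rewrite conjcX conjcM conjc_real exprMn real_complexX.
rewrite (funext E); split; first exact: integrableCZ.
rewrite /mean integralCZ// -/(mean _) e1 mul2n -addnn exprD real_complexM !real_complexX.
by ring.
Qed.

End Moments.

(** * The Bergman space as a sequence space *)

Section BergmanSpace.
Context {R : realType} (mu : probability (measurableTypeR R) R).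
Hypothesis mu01 : mu `[0%R, 1%R]%classic = 1%E.
Hypothesis mu1 : mu [set 1%R] = 0%E.
Hypothesis supp1 : supp mu 1.
Let mD := @measurable_plane_disk R.
Let mI := @measurable_I01 R.
Let sg0 := sgC_neq0 mu01 mu1 supp1.
Implicit Types (f g h u : R[i] -> R[i]) (y : nat -> R[i]).

(** [y] lists coordinates in the basis [e_], hence the division by the norms of the monomials. *)
Definition expands y f : Prop := power_on (fun k => y k / (sg mu k)%:C) f.

Lemma L2disk_monomial w k : L2disk mu (fun z : R[i] => w * z ^+ k).
Proof.
apply: (@L2disk_bounded _ _ _ (normc w)).
  apply: cmeasurableZ; apply: cmeasurableX.
  by apply: cmeasurable_subset; [exact: measurable_plane_disk|exact: cmeasurable_to_complex].
move=> z dz; rewrite normcM normcX ler_piMr ?normc_ge0//.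
by rewrite exprn_ile1 ?normc_ge0// ltW.
Qed.

Lemma L2disk_e k : L2disk mu (e_ mu k).
Proof.
apply: (@eq_L2disk _ _ (fun z => ((sg mu k)%:C)^-1 * z ^+ k)); last exact: L2disk_monomial.
by move=> z dz; rewrite (e_E mu01 mu1 supp1).
Qed.

Lemma inner_e f c k : power_on c f -> L2disk mu f ->
  inner mu f (e_ mu k) = c k * (sg mu k)%:C.
Proof.
move=> cf hf; have i1 : integrableC mu I01 (fun=> 1 : R[i]).
  have n1 (r : measurableTypeR R) : I01 r -> normc (1 : R[i]) <= 1 by move=> _; rewrite normc1.
  have mc : cmeasurable I01 (fun _ : measurableTypeR R => 1 : R[i]) by exact: cmeasurable_cst.
  exact: (@integrableC_bounded _ _ _ mu _ mI _ 1 mc n1).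
have hf1 : L2disk mu (fun z => 1 * f z) by apply: (@eq_L2disk _ _ f) => // z _; rewrite mul1r.
have := inner_radial mu01 mu1 cf i1 hf1 (L2disk_monomial ((sg mu k)%:C^-1) k).
have -> : integralC mu I01 (fun r => 1 * (r ^+ (2 * k))%:C) = (sg mu k)%:C ^+ 2.
  rewrite -real_complexX (sqr_sg mu01 mu1 supp1).
  apply: complex_eqP => /=.
    by apply: eq_Rintegral => r _; rewrite mul1r mul0r subr0.
  rewrite (@eq_Rintegral _ _ _ _ _ (fun=> 0)); last by move=> r _; rewrite mul0r mulr0 addr0.
  by rewrite /Rintegral integral0.
rewrite conjc_inv conjc_real expr2 mulrA divfK ?sg0// => <-.
by apply: eq_inner => z dz; rewrite ?mul1r// (e_E mu01 mu1 supp1).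
Qed.

Lemma expands_coords y f k : expands y f -> L2disk mu f -> coords mu f k = y k.
Proof. by move=> ef hf; rewrite /coords (inner_e k ef hf) divfK ?sg0. Qed.

Lemma power_on_expands c f : power_on c f -> L2disk mu f -> expands (coords mu f) f.
Proof.
move=> cf hf z z1; have := cf z z1; apply: eq_hasum => k.
by rewrite /coords (inner_e k cf hf) mulfK ?sg0.
Qed.

Lemma expands_e j : expands (fun k => (k == j)%:R) (e_ mu j).
Proof.
move=> z z1; rewrite (e_E mu01 mu1 supp1)//.
have h : forall k, (j.+1 <= k)%N -> (k == j)%:R / (sg mu k)%:C * z ^+ k = 0 :> R[i].
  by move=> k jk; rewrite gtn_eqF// !mul0r.
have := hasum_finite h; rewrite big_ord_recr/= eqxx mul1r big1 ?add0r// => i _.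
by rewrite ltn_eqF// !mul0r.
Qed.

Lemma inner_ee j k : inner mu (e_ mu j) (e_ mu k) = (k == j)%:R.
Proof. exact: (expands_coords k (expands_e j) (L2disk_e j)). Qed.

Definition comb N y (z : R[i]) : R[i] := \sum_(k < N) y k * e_ mu k z.

Lemma L2disk_comb N y : L2disk mu (comb N y).
Proof. by apply: L2disk_sum => k; apply: L2diskZ; exact: L2disk_e. Qed.

Lemma inner_comb u N y : L2disk mu u ->
  inner mu u (comb N y) = \sum_(k < N) (y k)^*%C * coords mu u k.
Proof.
move=> hu; rewrite /comb inner_sumr//; last by move=> k; apply: L2diskZ; exact: L2disk_e.
by apply: eq_bigr => k _; rewrite innerZr//; exact: L2disk_e.
Qed.

Lemma coords_comb N y k : coords mu (comb N y) k = if (k < N)%N then y k else 0.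
Proof.
rewrite /coords /comb inner_suml; [|by move=> i; apply: L2diskZ; exact: L2disk_e|exact: L2disk_e].
have E i : inner mu (fun z => y i * e_ mu i z) (e_ mu k) = y i * (k == i)%:R.
  by rewrite innerZl; [rewrite inner_ee|exact: L2disk_e|exact: L2disk_e].
under eq_bigr do rewrite E.
case: ifPn => [kN|]; last first.
  rewrite -leqNgt => Nk; rewrite big1// => i _.
  by rewrite gtn_eqF ?mulr0// (leq_trans (ltn_ord i)).
rewrite (bigD1 (Ordinal kN))//= eqxx mulr1 big1 ?addr0// => i ik.
rewrite (_ : k == i = false) ?mulr0//; apply: contraNF ik => /eqP ki.
by apply/eqP/val_inj.
Qed.

Lemma sqnorm_comb N y : sqnorm mu (comb N y) = \sum_(k < N) normc (y k) ^+ 2.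
Proof.
apply: complexI; rewrite -inner_sqnorm; last exact: L2disk_comb.
rewrite inner_comb; last exact: L2disk_comb.
rewrite rmorph_sum; apply: eq_bigr => k _ /=.
by rewrite coords_comb ltn_ord mulrC mulc_conj.
Qed.

Lemma bessel u N : L2disk mu u -> \sum_(k < N) normc (coords mu u k) ^+ 2 <= sqnorm mu u.
Proof.
move=> hu; set c := comb N (coords mu u).
have hc : L2disk mu c by exact: L2disk_comb.
set S := \sum_(k < N) _.
have uc : inner mu u c = S%:C.
  rewrite inner_comb// rmorph_sum; apply: eq_bigr => k _ /=.
  by rewrite mulrC mulc_conj.
suff E : sqnorm mu (fun z => u z - c z) = sqnorm mu u - S.
  by rewrite -subr_ge0 -E sqnorm_ge0.
apply: complexI; rewrite -inner_sqnorm; last exact: L2diskB.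
rewrite innerBl//; last exact: L2diskB.
rewrite !innerBr// (@inner_conj _ _ u c)// uc conjc_real !inner_sqnorm// sqnorm_comb.
by rewrite -/S !rmorphB/=; ring.
Qed.

Lemma expands_cvg y f p : expands y f -> plane_disk p ->
  ccvg \oo (fun N => comb N y (to_complex p)) (f (to_complex p)).
Proof.
move=> ef dp; have := ef _ dp.
change (hasum (fun k => y k / (sg mu k)%:C * to_complex p ^+ k) (f (to_complex p)) ->
  hasum (fun k => y k * e_ mu k (to_complex p)) (f (to_complex p))).
apply: eq_hasum => k.
by rewrite (e_E mu01 mu1 supp1)// mulrA.
Qed.

(* Fatou's lemma applied to the partial sums. *)
Lemma expands_sqnorm_le y f M : expands y f ->
  (forall N, \sum_(k < N) normc (y k) ^+ 2 <= M) -> L2disk mu f /\ sqnorm mu f <= M.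
Proof.
move=> ef yM.
have mf : cmeasurable (@plane_disk R) (fun p => f (to_complex p)) by exact: power_on_cmeasurable ef.
have mf2 : measurable_fun (@plane_disk R) (fun p => (normc (f (to_complex p)) ^+ 2)%:E).
  by apply/measurable_EFinP; exact: cmeasurable_normc2.
have le1 : (\int[nu mu]_(p in plane_disk) (normc (f (to_complex p)) ^+ 2)%:E <= M%:E)%E.
  pose F N (p : R * R) := (normc (comb N y (to_complex p)) ^+ 2)%:E.
  have mF N : measurable_fun plane_disk (F N).
    apply/measurable_EFinP; apply: cmeasurable_normc2.
    by have [] := L2disk_comb N y.
  have F0 N p : plane_disk p -> (0 <= F N p)%E by move=> _; rewrite lee_fin sqr_ge0.
  have h := fatou (nu mu) mD mF F0.
  have -> : (\int[nu mu]_(p in plane_disk) (normc (f (to_complex p)) ^+ 2)%:E =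
      \int[nu mu]_(p in plane_disk) limn_einf (F ^~ p))%E.
    apply: eq_integral => p; rewrite inE => dp.
    have cF : F N p @[N --> \oo] --> (normc (f (to_complex p)) ^+ 2)%:E.
      apply: cvg_EFin; first exact: nearW.
      by rewrite /comp/=; apply: cvgM; apply: ccvg_normc; exact: expands_cvg.
    by rewrite is_cvg_limn_einfE; [apply/esym/cvg_lim|apply: cvgP cF].
  apply: (le_trans h); rewrite limn_einf_lim; apply: lime_le; first exact: is_cvg_einfs.
  apply: nearW => N; apply: (@le_trans _ _ (\int[nu mu]_(x in plane_disk) F N x)%E).
    by apply: ereal_inf_lbound; exists N => //=.
  have [_ iN] := L2disk_comb N y.
  rewrite -[leLHS]fineK; last exact: integrable_fin_num.
  by rewrite lee_fin (_ : fine _ = sqnorm mu (comb N y))// sqnorm_comb.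
have hf : L2disk mu f.
  split => //; apply/integrableP; split => //; apply: le_lt_trans (ltry M).
  apply: le_trans le1; rewrite le_eqVlt; apply/orP; left; apply/eqP.
  by apply: eq_integral => p _; rewrite /= ger0_norm// sqr_ge0.
split => //; rewrite -lee_fin /sqnorm /Rintegral fineK//.
by have [_ i] := hf; exact: integrable_fin_num.
Qed.

Lemma bergman_intro y f : expands y f -> (forall z, ~ disk z -> f z = 0) -> L2disk mu f ->
  bergman mu f.
Proof.
move=> ef f0 [_ /integrableP[_ hf]]; split => //.
  by move=> z dz; apply: (power_series_analytic ef).
apply: le_lt_trans hf; rewrite le_eqVlt; apply/orP; left; apply/eqP.
by apply: eq_integral => p _; rewrite /= ger0_norm// sqr_ge0.
Qed.

Lemma bergman_expands f : bergman mu f -> L2disk mu f /\ expands (coords mu f) f.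
Proof.
move=> [af f0 fi]; have [c cf] := disk_expansion af.
have mf : cmeasurable (@plane_disk R) (fun p => f (to_complex p)) by exact: power_on_cmeasurable cf.
have hf : L2disk mu f.
  split => //; apply/integrableP; split.
    by apply/measurable_EFinP; exact: cmeasurable_normc2.
  apply: le_lt_trans fi; rewrite le_eqVlt; apply/orP; left; apply/eqP.
  by apply: eq_integral => p _; rewrite /= ger0_norm// sqr_ge0.
by split => //; exact: power_on_expands cf hf.
Qed.

Lemma bergman_e k : bergman mu (e_ mu k).
Proof.
by apply: (bergman_intro (expands_e k)); [move=> z; exact: e_notin|exact: L2disk_e].
Qed.

(** [sg] is bounded below by geometric sequences of ratio arbitrarily close to 1, so the series
    converges at every point of the disk, and [expands_sqnorm_le] controls its norm. *)
Lemma riesz_fischer y M : (forall N, \sum_(k < N) normc (y k) ^+ 2 <= M) ->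
  exists f, [/\ bergman mu f, expands y f & coords mu f =1 y].
Proof.
move=> yM.
have M0 : 0 <= M by have := yM 0%N; rewrite big_ord0.
have yk k : normc (y k) <= M + 1.
  have := yM k.+1; rewrite big_ord_recr/= => h.
  have h2 : normc (y k) ^+ 2 <= M by apply: le_trans h; rewrite lerDr sumr_ge0// => i _; rewrite sqr_ge0.
  have := normc_ge0 (y k); nra.
have /choice[f0 hf0] (z : R[i]) : exists l, disk z -> hasum (fun k => y k / (sg mu k)%:C * z ^+ k) l.
  have [dz|dz] := pselect (disk z); last by exists 0.
  have nz := normc_ge0 z; have z1 : normc z < 1 := dz.
  pose s := (normc z + 1) / 2.
  have s0 : 0 < s by rewrite /s; lra.
  have s1 : s < 1 by rewrite /s; lra.
  have zs : normc z < s by rewrite /s; lra.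
  have [m m0 hm] := moment_lower mu01 mu1 supp1 (ltW s0) s1.
  have sgm k : Num.sqrt m * s ^+ k <= sg mu k.
    rewrite -(@ler_pXn2r _ 2)// ?nnegrE ?mulr_ge0 ?exprn_ge0 ?sqrtr_ge0 ?(ltW s0)//.
    by rewrite exprMn sqr_sqrtr ?(ltW m0)// -exprM mulnC (sqr_sg mu01 mu1 supp1).
  have sm0 : 0 < Num.sqrt m by rewrite sqrtr_gt0.
  suff [l hl] : exists l, hasum (fun k => y k / (sg mu k)%:C * z ^+ k) l by exists l.
  apply: (@hasum_exists _ _ (geometric ((M + 1) / Num.sqrt m) (normc z / s))); last first.
    have x0 : 0 <= normc z / s by apply: divr_ge0 => //; exact: ltW.
    apply: is_cvg_geometric_series; rewrite ger0_norm//.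
    by rewrite ltr_pdivrMr// mul1r.
  move=> k; rewrite /geometric/= !normcM normcX normcV normc_real gtr0_norm; last exact: sg_gt0.
  have -> : (M + 1) / Num.sqrt m * (normc z / s) ^+ k =
      (M + 1) / (Num.sqrt m * s ^+ k) * normc z ^+ k.
    by rewrite expr_div_n invfM; ring.
  rewrite ler_wpM2r ?exprn_ge0// ler_pM ?normc_ge0// ?invr_ge0 ?(ltW (sg_gt0 _ _ _ _))//.
  by rewrite lef_pV2 ?posrE ?mulr_gt0 ?exprn_gt0 ?sg_gt0.
pose f z := if z \in disk then f0 z else 0.
have ef : expands y f by move=> z z1; rewrite /f mem_set//; exact: hf0.
have [hf _] := expands_sqnorm_le ef yM.
exists f; split => //.
  by apply: (bergman_intro ef) => // z dz; rewrite /f memNset.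
by move=> k; exact: expands_coords.
Qed.

(** Removing the first [N] coordinates leaves a function whose norm [expands_sqnorm_le] bounds by
    the tail of a convergent series. *)
Lemma expands_approx y h e : expands y h -> L2disk mu h -> 0 < e ->
  exists N, sqnorm mu (fun z => h z - comb N y z) <= e.
Proof.
move=> eh hh e0; pose T n := \sum_(k < n) normc (y k) ^+ 2.
have Tnd : nondecreasing_seq T.
  apply/nondecreasing_seqP => n; rewrite /T big_ord_recr/= lerDl sqr_ge0//.
have TM n : T n <= sqnorm mu h.
  apply: le_trans (bessel n hh); apply: ler_sum => k _.
  by rewrite (expands_coords k eh hh).
have cT : cvgn T by apply: nondecreasing_is_cvgn => //; exists (sqnorm mu h) => _ [n _ <-].
have TL := nondecreasing_cvgn_le Tnd cT.
have /cvgrPdist_lt/(_ _ e0)[N _ hN] := cT.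
exists N.
have eN : expands (fun k => if (k < N)%N then 0 else y k) (fun z => h z - comb N y z).
  move=> z z1.
  have fin := @hasum_finite R (fun k => (if (k < N)%N then y k else 0) / (sg mu k)%:C * z ^+ k) N.
  have /fin{}fin : forall k, (N <= k)%N -> (if (k < N)%N then y k else 0) / (sg mu k)%:C * z ^+ k = 0.
    by move=> k; rewrite leqNgt => /negbTE ->; rewrite !mul0r.
  have := hasumD (eh z z1) (hasumZ (-1) fin).
  have -> : h z + -1 * \sum_(k < N) (if (k < N)%N then y k else 0) / (sg mu k)%:C * z ^+ k =
      h z - comb N y z.
    rewrite mulN1r; congr (_ - _); apply: eq_bigr => k _.
    by rewrite ltn_ord (e_E mu01 mu1 supp1)// mulrA.
  by apply: eq_hasum => k; case: ifP => _; ring.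
have [] := expands_sqnorm_le (M := e) eN => // n.
have [nN|Nn] := leqP n N.
  rewrite big1 ?(ltW e0)// => k _; rewrite (leq_trans (ltn_ord k) nN) normc0 expr0n//.
have -> : \sum_(k < n) normc (if (k < N)%N then 0 else y k) ^+ 2 = T n - T N.
  rewrite /T -!(big_mkord xpredT (fun k => normc (if (k < N)%N then 0 else y k) ^+ 2)).
  rewrite -!(big_mkord xpredT (fun k => normc (y k) ^+ 2)).
  rewrite (big_cat_nat (n := N) (p := n))//=; last exact: ltnW.
  rewrite [X in _ = X - _](big_cat_nat (n := N) (p := n))//=; last exact: ltnW.
  rewrite addrAC subrr add0r big_nat big1 ?add0r; last first.
    by move=> k /= kN; rewrite kN normc0 expr0n.
  by apply: eq_big_nat => k /andP[Nk _]; rewrite ltnNge Nk.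
have := hN N (leqnn N); have := TL n; have := TL N.
by move=> h1 h2; rewrite ger0_norm ?subr_ge0//; lra.
Qed.

(** Finite combinations of the [e_ k] approximate [h], and [u] is orthogonal to all of them. *)
Lemma inner_bergman_eq0 u h : L2disk mu u -> bergman mu h -> (forall k, coords mu u k = 0) ->
  inner mu u h = 0.
Proof.
move=> hu /bergman_expands[hh eh] u0; apply: (inner_eq0_approx hu) => e e0.
have [N hN] := expands_approx eh hh e0.
exists (fun z => h z - comb N (coords mu h) z); split => //.
  by apply: L2diskB => //; exact: L2disk_comb.
rewrite innerBr//; last exact: L2disk_comb.
by rewrite inner_comb// big1 ?subr0// => k _; rewrite u0 mulr0.
Qed.

(** Bessel and Riesz-Fischer produce an element with the coordinates of [u]; its difference with [u]
    has zero coordinates, so it is orthogonal to the Bergman space and [xget] has something to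
    choose. *)
Lemma bergman_projP u : L2disk mu u ->
  bergman mu (bergman_proj mu u) /\ coords mu (bergman_proj mu u) =1 coords mu u.
Proof.
move=> hu; have [g [bg _ gu]] := riesz_fischer (fun N => bessel N hu).
have [hg _] := bergman_expands bg.
have ex : exists g, bergman mu g /\ forall h, bergman mu h -> inner mu (fun z => u z - g z) h = 0.
  exists g; split => // h bh; apply: inner_bergman_eq0 => //; first exact: L2diskB.
  move=> k; rewrite /coords innerBl//; last exact: L2disk_e.
  by have := gu k; rewrite /coords => ->; rewrite subrr.
have [bP hP] := xgetPex (fun=> 0) ex; split => // k.
have [hPu _] := bergman_expands bP.
have := hP _ (bergman_e k); rewrite innerBl//; last exact: L2disk_e.
by move/eqP; rewrite subr_eq0 => /eqP.
Qed.

Lemma adjointP A g : (exists h, bergman mu h /\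
    forall f, bergman mu f -> inner mu (A f) g = inner mu f h) ->
  bergman mu (adjoint mu A g) /\
  forall f, bergman mu f -> inner mu (A f) g = inner mu f (adjoint mu A g).
Proof. by move=> ex; have [] := xgetPex (fun=> 0) ex. Qed.

End BergmanSpace.

(** * Multiplication by an essentially bounded radial symbol *)

Section EssentiallyBounded.
Context {R : realType} (mu : probability (measurableTypeR R) R).
Hypothesis mu01 : mu `[0%R, 1%R]%classic = 1%E.
Hypothesis mu1 : mu [set 1%R] = 0%E.
Variable (q : R -> R[i]).
Hypothesis qL : Linfty01 mu q.
Let mD := @measurable_plane_disk R.
Let mI := @measurable_I01 R.

Lemma I01_intro (r : R) : 0 <= r -> r < 1 -> I01 r.
Proof. by move=> r0 r1; rewrite /I01/= in_itv/= r0. Qed.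

Lemma subset_I01 : I01 `<=` (`[0%R, 1%R]%classic : set (measurableTypeR R)).
Proof. by move=> r /I01P[r0 r1] /=; rewrite in_itv/= r0 ltW. Qed.

Lemma Linfty01_cmeasurable : cmeasurable I01 (q : measurableTypeR R -> R[i]).
Proof.
by have [q1 q2 _] := qL; split; [apply: measurable_funS q1|apply: measurable_funS q2] => //;
  exact: subset_I01.
Qed.

(** Trades the almost-everywhere bound for a measurable null set, which can be removed from a domain
    or lifted to the disk. *)
Lemma Linfty01_bound : exists M B, [/\ 0 <= M, measurable B, mu B = 0%E &
  forall r, I01 r -> ~ B r -> normc (q r) <= M].
Proof.
have [_ _ [M [B [mB B0 hB]]]] := qL; exists `|M|, B; split => // r Ir nBr.
apply: contrapT => nq; apply: nBr; apply: hB => /= h; apply: nq.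
have [r0 r1] := I01P Ir.
by apply: le_trans (h _) (ler_norm _); rewrite r0 ltW.
Qed.

Lemma Linfty01_integrable : integrableC mu I01 q.
Proof.
have [q1 q2] := Linfty01_cmeasurable; have [M [B [M0 mB B0 hB]]] := Linfty01_bound.
have main (p : R[i] -> R) : (forall z, `|p z| <= normc z) ->
    measurable_fun I01 (fun r : measurableTypeR R => p (q r)) ->
    mu.-integrable I01 (EFin \o (fun r => p (q r))).
  move=> pn mp; apply/integrableP; split; first exact/measurable_EFinP.
  have := integrable_cst_prob mu mI M => /integrableP[_].
  apply: le_lt_trans; apply: ae_ge0_le_integral => //.
  - by apply/measurable_EFinP; exact: measurableT_comp.
  - exists B; split => // r /= h; apply: contrapT => nBr; apply: h => Ir.
    by rewrite lee_fin (le_trans (pn _))// (le_trans (hB _ Ir nBr))// ler_norm.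
by split; apply: main => //; [exact: Re_le_normc|exact: Im_le_normc].
Qed.

Lemma L2disk_Linfty01 f : L2disk mu f -> L2disk mu (fun z => q (normc z) * f z).
Proof.
move=> [mf iF]; have [q1 q2] := Linfty01_cmeasurable; have [M [B [M0 mB B0 hB]]] := Linfty01_bound.
have mn : measurable_fun (@plane_disk R) (fun p => normc (to_complex p) : measurableTypeR R).
  by apply: measurable_funTS; exact: measurable_normc_to_complex.
have sub : (fun p => normc (to_complex p) : measurableTypeR R) @` (@plane_disk R) `<=` I01.
  by move=> _ [p dp <-]; apply: I01_intro; [exact: normc_ge0|exact: dp].
have mq : cmeasurable (@plane_disk R) (fun p => q (normc (to_complex p)) * f (to_complex p)).
  apply: cmeasurableM => //; split.
    exact: (measurable_comp mI sub q1 mn).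
  exact: (measurable_comp mI sub q2 mn).
split => //; apply/integrableP; split.
  by apply/measurable_EFinP; exact: cmeasurable_normc2.
have /integrableP[mF' +] := integrable_realZ mD (M ^+ 2) iF.
apply: le_lt_trans; apply: ae_ge0_le_integral => //.
- by apply: measurableT_comp => //; apply/measurable_EFinP; exact: cmeasurable_normc2.
- by apply: measurableT_comp.
- apply: negligibleS (nu_radial_negligible mu01 mu1 mB B0) => p.
  have key : plane_disk p -> ~ B (normc (to_complex p)) ->
      (`|(normc (q (normc (to_complex p)) * f (to_complex p)) ^+ 2)%:E| <=
       `|(M ^+ 2 * normc (f (to_complex p)) ^+ 2)%:E|)%E.
    move=> dp nB.
    have h0 : normc (q (normc (to_complex p)) * f (to_complex p)) ^+ 2 <=
        M ^+ 2 * normc (f (to_complex p)) ^+ 2.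
      rewrite normcM exprMn; apply: ler_pM; rewrite ?sqr_ge0//.
      apply: lerXn2r; rewrite ?nnegrE ?normc_ge0//; apply: hB => //.
      by apply: I01_intro; [exact: normc_ge0|exact: dp].
    by rewrite !abse_EFin lee_fin ger0_norm ?sqr_ge0// (le_trans h0)// ler_norm.
  move=> h.
  have [dp|ndp] := pselect (plane_disk p); last by exfalso; apply: h.
  by split => //; apply: contrapT => nB; apply: h => dp'; exact: key.
Qed.

End EssentiallyBounded.

(** * Matrices of the operators in the basis [e_] *)

Section Operators.
Context {R : realType} (mu : probability (measurableTypeR R) R).
Hypothesis mu01 : mu `[0%R, 1%R]%classic = 1%E.
Hypothesis mu1 : mu [set 1%R] = 0%E.
Hypothesis supp1 : supp mu 1.
Variables (n : nat) (q : R -> R[i]).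
Hypothesis qL : Linfty01 mu q.
Let mI := @measurable_I01 R.
Let sg0 := sgC_neq0 mu01 mu1 supp1.
Implicit Types (f g h u : R[i] -> R[i]) (y : nat -> R[i]).

Let T := toeplitz mu (fun z => z ^+ n).
Let D := toeplitz mu (fun z => q (normc z)).

(** [T] maps [e_ (k - n)] to [tau k * e_ k] for [n <= k]. The value 0 for [k < n] neutralizes the
    truncated subtraction [k - n]. *)
Definition tau (k : nat) : R := if (n <= k)%N then sg mu k / sg mu (k - n) else 0.
Definition lam (k : nat) : R[i] :=
  integralC mu I01 (fun r => q r * (r ^+ (2 * k))%:C) / (moment mu (2 * k))%:C.

Lemma L2disk_mulX f : L2disk mu f -> L2disk mu (fun z => z ^+ n * f z).
Proof.
move=> [mf iF]; apply: L2disk_dominated iF _.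
  apply: cmeasurableM => //; apply: cmeasurableX.
  by apply: cmeasurable_subset; [exact: measurable_plane_disk|exact: cmeasurable_to_complex].
move=> p dp; rewrite normcM exprMn ler_piMl ?sqr_ge0// exprn_ile1 ?normc_ge0// normcX.
by rewrite exprn_ile1 ?normc_ge0// ltW.
Qed.

Lemma toeplitzX_coords f : bergman mu f ->
  bergman mu (T f) /\ forall k, coords mu (T f) k = (tau k)%:C * coords mu f (k - n).
Proof.
move=> bf; have [hf ef] := bergman_expands mu01 mu1 supp1 bf.
have hu := L2disk_mulX hf.
have [bT cT] := bergman_projP mu01 mu1 supp1 hu; split => // k.
have cu : power_on (fun j => if (n <= j)%N then coords mu f (j - n) / (sg mu (j - n))%:C else 0)
    (fun z => z ^+ n * f z).
  move=> z z1; have /(hasumZ (z ^+ n)) h := ef z z1.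
  apply/ccvgP; have /ccvgP {}h := h.
  rewrite -(cvg_shiftn n); apply: cvg_trans h; apply: near_eq_cvg.
  apply: nearW => N /=; congr (normc (_ - _)).
  rewrite (addnC N) [RHS]big_split_ord/= [X in _ = X + _]big1 ?add0r.
    by apply: eq_bigr => i _; rewrite leq_addr addKn exprD; ring.
  by move=> i _; rewrite leqNgt ltn_ord mul0r.
rewrite cT {1}/coords (inner_e mu01 mu1 supp1 k cu hu) /tau; case: ifP => nk; last by rewrite !mul0r.
by rewrite real_complexM real_complexV; ring.
Qed.

Lemma toeplitzq_coords f : bergman mu f ->
  bergman mu (D f) /\ forall k, coords mu (D f) k = lam k * coords mu f k.
Proof.
move=> bf; have [hf ef] := bergman_expands mu01 mu1 supp1 bf.
have hu := L2disk_Linfty01 mu01 mu1 qL hf.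
have [bD cD] := bergman_projP mu01 mu1 supp1 hu; split => // k; rewrite cD.
have := inner_radial mu01 mu1 ef (Linfty01_integrable qL) hu (L2disk_monomial mu ((sg mu k)%:C^-1) k).
rewrite conjc_inv conjc_real /lam -(sqr_sg mu01 mu1 supp1) real_complexX.
have -> : inner mu (fun z => q (normc z) * f z) (fun z => (sg mu k)%:C^-1 * z ^+ k) =
  coords mu (fun z => q (normc z) * f z) k.
  by apply: eq_inner => z dz //; rewrite (e_E mu01 mu1 supp1).
by move=> ->; field; exact: sg0.
Qed.

(** The domain on which [J] is followed, stable under all its factors: inner products and the series
    of [diag_invsqrt] become finite sums, and adjoint vectors can be written down. *)
Definition fin y f : Prop :=
  [/\ bergman mu f, coords mu f =1 y & exists N, forall k, (N <= k)%N -> y k = 0].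

Lemma fin_inner y g N u : fin y g -> (forall k, (N <= k)%N -> y k = 0) -> L2disk mu u ->
  inner mu u g = \sum_(k < N) (y k)^*%C * coords mu u k.
Proof.
move=> [bg cg _] yN hu; rewrite -(inner_comb mu01 mu1 supp1)//.
suff -> : g = fun z => if z \in disk then comb mu N y z else 0.
  by apply: eq_inner => z dz//; rewrite mem_set.
have [hg eg] := bergman_expands mu01 mu1 supp1 bg; apply/funext => z.
case: ifPn => [/set_mem dz|/negP dz]; last first.
  by case: bg => _ -> //; apply: contra_not dz => dz; exact: mem_set.
apply: hasum_unique (eg z dz) _.
have h : forall k, (N <= k)%N -> coords mu g k / (sg mu k)%:C * z ^+ k = 0.
  by move=> k Nk; rewrite cg yN// !mul0r.
have := hasum_finite h; congr hasum; apply: eq_bigr => k _.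
by rewrite cg (e_E mu01 mu1 supp1)// mulrA.
Qed.

Lemma fin_comb N y : fin (fun k => if (k < N)%N then y k else 0) (comb mu N y).
Proof.
split; last by exists N => k; rewrite leqNgt => /negbTE ->.
  have hc := L2disk_comb mu01 mu1 supp1 N y.
  apply: (@bergman_intro _ _ (fun k => if (k < N)%N then y k else 0)) => //; last first.
    by move=> z dz; rewrite /comb big1// => k _; rewrite e_notin ?mulr0.
  move=> z z1.
  have h : forall k, (N <= k)%N -> (if (k < N)%N then y k else 0) / (sg mu k)%:C * z ^+ k = 0.
    by move=> k; rewrite leqNgt => /negbTE ->; rewrite !mul0r.
  have := hasum_finite h; congr hasum; apply: eq_bigr => k _.
  by rewrite ltn_ord (e_E mu01 mu1 supp1)// mulrA.
by move=> k; rewrite (coords_comb mu01 mu1 supp1).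
Qed.

Lemma eq_fin y z f : y =1 z -> fin y f -> fin z f.
Proof. by move=> /funext ->. Qed.

Lemma fin_exists y : (exists N, forall k, (N <= k)%N -> y k = 0) -> exists f, fin y f.
Proof.
move=> [N hN]; exists (comb mu N y).
by apply: eq_fin (fin_comb N y) => k; case: ltnP => // /hN ->.
Qed.

Lemma fin_e k : fin (fun j => (j == k)%:R) (e_ mu k).
Proof.
split; [exact: (bergman_e mu01 mu1 supp1)|by move=> j; exact: (inner_ee mu01 mu1 supp1)|].
by exists k.+1 => j kj; rewrite gtn_eqF.
Qed.

Lemma bergman_lin a f g : bergman mu f -> bergman mu g -> bergman mu (fun z => a * f z + g z).
Proof.
move=> bf bg; have [hf ef] := bergman_expands mu01 mu1 supp1 bf.
have [hg eg] := bergman_expands mu01 mu1 supp1 bg.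
apply: (@bergman_intro _ _ (fun k => a * coords mu f k + coords mu g k)).
- move=> z z1; have := hasumD (hasumZ a (ef z z1)) (eg z z1); apply: eq_hasum => k; ring.
- by move=> z dz; case: bf => _ -> //; case: bg => _ -> //; rewrite mulr0 addr0.
- by apply: L2diskD => //; exact: L2diskZ.
Qed.

Lemma fin_lin a y z f g : fin y f -> fin z g ->
  fin (fun k => a * y k + z k) (fun x => a * f x + g x).
Proof.
move=> [bf cf [N hN]] [bg cg [M hM]]; split.
- exact: bergman_lin.
- have [hf _] := bergman_expands mu01 mu1 supp1 bf.
  have [hg _] := bergman_expands mu01 mu1 supp1 bg.
  have he k := L2disk_e mu01 mu1 supp1 k.
  move=> k; rewrite -cf -cg /coords innerDl//; first by rewrite innerZl.
  exact: L2diskZ.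
- exists (maxn N M) => k; rewrite geq_max => /andP[/hN -> /hM ->].
  by rewrite mulr0 addr0.
Qed.

Lemma finD y z f g : fin y f -> fin z g -> fin (fun k => y k + z k) (fun x => f x + g x).
Proof.
move=> hf hg; have := fin_lin 1 hf hg.
by under eq_fun do rewrite mul1r; under [X in fin _ X]eq_fun do rewrite mul1r.
Qed.

Lemma finB y z f g : fin y f -> fin z g -> fin (fun k => y k - z k) (fun x => f x - g x).
Proof.
move=> hf hg; have := fin_lin (-1) hg hf.
by under eq_fun do rewrite mulN1r addrC; under [X in fin _ X]eq_fun do rewrite mulN1r addrC.
Qed.

Lemma fin_toeplitzX y f : fin y f -> fin (fun k => (tau k)%:C * y (k - n)%N) (T f).
Proof.
move=> [bf cf [N hN]]; have [bT cT] := toeplitzX_coords bf; split => // [k|].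
  by rewrite cT cf.
exists (N + n)%N => k Nk; rewrite hN ?mulr0//.
by rewrite leq_subRL; [rewrite addnC|apply: leq_trans Nk; exact: leq_addl].
Qed.

Lemma fin_toeplitzq y f : fin y f -> fin (fun k => lam k * y k) (D f).
Proof.
move=> [bf cf [N hN]]; have [bD cD] := toeplitzq_coords bf; split => // [k|].
  by rewrite cD cf.
by exists N => k Nk; rewrite hN ?mulr0.
Qed.

(** One vector with the adjoint property makes [xget] return such a vector, and pairing with each
    [e_ k] forces its coordinates. *)
Lemma fin_adjoint A z g h : fin z h ->
  (forall f, bergman mu f -> inner mu (A f) g = inner mu f h) -> fin z (adjoint mu A g).
Proof.
move=> [bh ch hN] hA.
have [ba ha] : bergman mu (adjoint mu A g) /\
    forall f, bergman mu f -> inner mu (A f) g = inner mu f (adjoint mu A g).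
  by apply: adjointP; exists h.
split => // k; rewrite -ch /coords.
have [hh _] := bergman_expands mu01 mu1 supp1 bh.
have [ha2 _] := bergman_expands mu01 mu1 supp1 ba.
have he := L2disk_e mu01 mu1 supp1 k.
rewrite (inner_conj he ha2) (inner_conj he hh); congr (_^*%C).
by rewrite -ha ?hA//; exact: (bergman_e mu01 mu1 supp1).
Qed.

Lemma fin_adjoint_toeplitzX y g : fin y g ->
  fin (fun k => (tau (k + n))%:C * y (k + n)%N) (adjoint mu T g).
Proof.
move=> fg; have [_ _ [N hN]] := fg.
have hN' : forall k, (N <= k)%N -> (tau (k + n))%:C * y (k + n)%N = 0.
  by move=> k Nk; rewrite hN ?mulr0// (leq_trans Nk)// leq_addr.
have [h fh] : exists h, fin (fun k => (tau (k + n))%:C * y (k + n)%N) h.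
  by apply: fin_exists; exists N.
apply: (fin_adjoint fh) => f bf.
have [hf _] := bergman_expands mu01 mu1 supp1 bf.
have [bT cT] := toeplitzX_coords bf.
have [hT _] := bergman_expands mu01 mu1 supp1 bT.
have hN2 : forall k, (n + N <= k)%N -> y k = 0.
  by move=> k Nk; apply: hN; rewrite (leq_trans _ Nk)// leq_addl.
rewrite (fin_inner fg hN2 hT) (fin_inner fh hN' hf) big_split_ord/= big1 ?add0r.
  apply: eq_bigr => k _; rewrite cT addKn conjcM conjc_real (addnC n); ring.
by move=> i _; rewrite cT /tau leqNgt ltn_ord mul0r mulr0.
Qed.

Lemma fin_adjoint_toeplitzq y g : fin y g ->
  fin (fun k => (lam k)^*%C * y k) (adjoint mu D g).
Proof.
move=> fg; have [_ _ [N hN]] := fg.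
have hN' : forall k, (N <= k)%N -> (lam k)^*%C * y k = 0.
  by move=> k Nk; rewrite hN ?mulr0.
have [h fh] : exists h, fin (fun k => (lam k)^*%C * y k) h.
  by apply: fin_exists; exists N.
apply: (fin_adjoint fh) => f bf.
have [hf _] := bergman_expands mu01 mu1 supp1 bf.
have [bD cD] := toeplitzq_coords bf.
have [hD _] := bergman_expands mu01 mu1 supp1 bD.
rewrite (fin_inner fg hN hD) (fin_inner fh hN' hf).
by apply: eq_bigr => k _; rewrite cD conjcM conjcK; ring.
Qed.

Lemma fin_diag_invsqrt A y f : fin y f ->
  fin (fun k => (complex.Re (inner mu (A (e_ mu k)) (e_ mu k)) `^ (- 2^-1))%:C * y k)
    (diag_invsqrt mu A f).
Proof.
move=> [bf cf [N hN]].
set d := fun k => _.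
have -> : diag_invsqrt mu A f = comb mu N d.
  apply/funext => z; rewrite /diag_invsqrt.
  have h : forall k, (N <= k)%N ->
      (complex.Re (inner mu (A (e_ mu k)) (e_ mu k)) `^ (- 2^-1))%:C
      * inner mu f (e_ mu k) * e_ mu k z = 0.
    by move=> k Nk; have := cf k; rewrite /coords => ->; rewrite hN// mulr0 mul0r.
  have /hasum_seriesP hs := hasum_finite h.
  rewrite (cvg_lim _ hs)//; apply: eq_bigr => k _.
  by have := cf k; rewrite /coords /d => ->.
apply: eq_fin (fin_comb N d) => k; case: ltnP => // Nk.
by rewrite /d hN ?mulr0.
Qed.

(** Diagonal entries of [[T^*, T]]; the subtracted term is 0 for [k < n]. *)
Definition dd (k : nat) : R := tau (k + n) ^+ 2 - tau k ^+ 2.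
(** The entry of [J] in row [k] and column [k + n]. *)
Definition band (k : nat) : R[i] :=
  (dd k `^ (- 2^-1) * dd (k + n) `^ (- 2^-1) * tau (k + n))%:C * (lam (k + n) - lam k).

Let C := commutator (adjoint mu T) T.

Lemma fin_commutator y f : fin y f -> fin (fun k => (dd k)%:C * y k) (C f).
Proof.
move=> hf; apply: eq_fin (finB (fin_adjoint_toeplitzX (fin_toeplitzX hf))
  (fin_toeplitzX (fin_adjoint_toeplitzX hf))) => k /=.
rewrite addnK /dd rmorphB/= !real_complexX; have [nk|kn] := leqP n k.
  by rewrite subnK//; ring.
by rewrite [tau k]/tau leqNgt kn/=; ring.
Qed.

Lemma commutator_diagE k : complex.Re (inner mu (C (e_ mu k)) (e_ mu k)) = dd k.
Proof.
have [_ h _] := fin_commutator (fin_e k).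
by have := h k; rewrite /coords => ->; rewrite eqxx mulr1.
Qed.

Lemma band_conj k : (band k)^*%C =
  (dd k `^ (- 2^-1) * dd (k + n) `^ (- 2^-1) * tau (k + n))%:C * ((lam (k + n))^*%C - (lam k)^*%C).
Proof. by rewrite /band [LHS]conjcM conjc_real conjcB. Qed.

(** [[T^*, D]] lowers degrees by [n] and gives the superdiagonal, [[D^*, T]] raises them and gives
    the subdiagonal. *)
Lemma J_coords y f j : fin y f -> coords mu (J_op mu n q f) j =
  band j * y (j + n)%N + (if (n <= j)%N then (band (j - n))^*%C * y (j - n)%N else 0).
Proof.
move=> hf.
have hS z g : fin z g -> fin (fun k => (dd k `^ (- 2^-1))%:C * z k) (diag_invsqrt mu C g).
  move=> /(fin_diag_invsqrt C); apply: eq_fin => k; by rewrite commutator_diagE.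
have h1 := hS _ _ hf.
have h2 := finB (fin_adjoint_toeplitzX (fin_toeplitzq h1)) (fin_toeplitzq (fin_adjoint_toeplitzX h1)).
have h3 := finB (fin_adjoint_toeplitzq (fin_toeplitzX h1)) (fin_toeplitzX (fin_adjoint_toeplitzq h1)).
have [_ -> _] := hS _ _ (finD h2 h3).
have [nj|jn] := leqP n j; last first.
  rewrite /band [tau j]/tau leqNgt jn/= !real_complexM.
  (* Generalizing the entries leaves a polynomial identity. [t0] stands for [tau j], which is 0
     since [j < n], and kills the terms indexed by [j - n]. *)
  have alg (a b c l1 l y1 lc t0 x w lm : R[i]) : t0 = 0 ->
    a * ((c * (l1 * (b * y1)) - l * (c * (b * y1))) + (lc * (t0 * (x * w)) - t0 * (lm * (x * w)))) =
    a * b * c * (l1 - l) * y1 + 0 by move=> ->; ring.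
  exact: alg.
rewrite band_conj /band subnK// !real_complexM.
have alg (a b c l1 l y1 lc t x w lm : R[i]) :
  a * ((c * (l1 * (b * y1)) - l * (c * (b * y1))) + (lc * (t * (x * w)) - t * (lm * (x * w)))) =
  a * b * c * (l1 - l) * y1 + x * a * t * (lc - lm) * w by ring.
exact: alg.
Qed.

End Operators.

(** * Weighted means and variances of [r ^+ N] *)

Section Variance.
Context {R : realType} (mu : probability (measurableTypeR R) R).
Hypothesis mu01 : mu `[0%R, 1%R]%classic = 1%E.
Hypothesis mu1 : mu [set 1%R] = 0%E.
Hypothesis supp1 : supp mu 1.
Variable N : nat.
Hypothesis N0 : (0 < N)%N.
Let mI := @measurable_I01 R.
Let G := moment mu.
Let G0 p : 0 < G p. Proof. exact: moment_gt0. Qed.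

Definition wmean (p : nat) : R := moment mu (p + N) / moment mu p.

(** The centre [c] is left free so that two weights can be compared about a common centre; the
    variance is the minimum over [c]. *)
Definition wsqdist (c : R) (p : nat) : R :=
  (\int[mu]_(r in I01) ((r ^+ N - c) ^+ 2 * r ^+ p))%R.

(* Variance of [r ^+ N] for the weight [r ^+ p] on [mu], which is not normalized. *)
Definition wvar (p : nat) : R := wsqdist (wmean p) p.

Lemma integrable_wsqdist c p :
  mu.-integrable I01 (EFin \o (fun r => (r ^+ N - c) ^+ 2 * r ^+ p)).
Proof.
apply: integrable_mul_exprn.
have -> : (fun r : measurableTypeR R => (r ^+ N - c) ^+ 2) =
    (fun r => r ^+ (2 * N) + ((- (2 * c)) * r ^+ N + c ^+ 2)).
  by apply/funext => r; rewrite mul2n -addnn exprD; ring.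
apply: integrable_realD => //; first exact: integrable_exprn.
apply: integrable_realD => //; last exact: integrable_cst_prob.
by apply: integrable_realZ => //; exact: integrable_exprn.
Qed.

Lemma wsqdistE c p : wsqdist c p =
  moment mu (p + 2 * N) - 2 * c * moment mu (p + N) + c ^+ 2 * moment mu p.
Proof.
have i k := @integrable_exprn R mu k.
transitivity (\int[mu]_(r in I01) (r ^+ (p + 2 * N) + ((- (2 * c)) * r ^+ (p + N) +
    c ^+ 2 * r ^+ p)))%R.
  by apply: eq_Rintegral => r _; rewrite mul2n -addnn !exprD; ring.
rewrite RintegralD//; last by apply: integrable_realD => //; exact: integrable_realZ.
rewrite RintegralD//; [|exact: integrable_realZ|exact: integrable_realZ].
by rewrite !RintegralZl// mulNr addrA.
Qed.

(** Steiner's identity for second moments about different centres. *)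
Lemma wsqdist_wvar c p : wsqdist c p = wvar p + (wmean p - c) ^+ 2 * moment mu p.
Proof.
rewrite /wvar !wsqdistE /wmean; have := G0 p; rewrite /G => /lt0r_neq0 h.
by field.
Qed.

Lemma wvar_le c p : wvar p <= wsqdist c p.
Proof. by rewrite wsqdist_wvar lerDl mulr_ge0 ?sqr_ge0// ltW// G0. Qed.

Lemma wvarE p : wvar p = moment mu (p + 2 * N) - moment mu (p + N) ^+ 2 / moment mu p.
Proof. 
rewrite /wvar wsqdistE /wmean; have := G0 p; rewrite /G => /lt0r_neq0 h.
by field.
Qed.

(** []s, 1[] has positive mass and is a countable union of intervals []s, t]] with [t < 1], so these
    are not all null. The lower bound for the variance uses such mass at a distance from 1. *)
Lemma exists_itv_gt0 (s : R) : 0 <= s -> s < 1 ->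
  exists2 t : R, s < t < 1 & 0 < fine (mu `]s, t]%classic).
Proof.
move=> s0 s1; apply: contrapT => hn.
(* [k.+2] keeps the right endpoint strictly above [s]. *)
pose F (k : nat) : set (measurableTypeR R) := `]s, 1 - (1 - s) / k.+2%:R]%classic.
have Fk k : mu (F k) = 0%E.
  apply/eqP; rewrite eq_le measure_ge0 andbT leNgt; apply/negP => h; apply: hn.
  have d0 : 0 < (1 - s) / k.+2%:R by rewrite divr_gt0// subr_gt0.
  exists (1 - (1 - s) / k.+2%:R); last first.
    by rewrite fine_gt0// h/= ltey_eq fin_num_measure//; exact: measurable_itv.
  rewrite gtrBl d0 andbT ltrBrDl -ltrBrDr ltr_pdivrMr// ltr_pMr ?subr_gt0//.
  by rewrite ltr1n.
have : mu.-negligible (\bigcup_k F k).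
  have neg k : mu.-negligible (F k).
    by exists (F k); split => //; exact: measurable_itv.
  exact: negligible_bigcup.
have -> : \bigcup_k F k = `]s, 1[%classic.
  apply/seteqP; split => x.
    move=> [k _]; rewrite /F/= !in_itv/= => /andP[-> h]; rewrite (le_lt_trans h)//.
    by rewrite gtrBl divr_gt0// subr_gt0.
  rewrite /= in_itv/= => /andP[sx x1].
  have x10 : 0 < 1 - x by rewrite subr_gt0.
  have h0 : 0 <= (1 - s) / (1 - x) by rewrite divr_ge0 ?subr_ge0 ?ltW.
  have h := ltW (archi_boundP h0).
  exists (Num.bound ((1 - s) / (1 - x))) => //; rewrite /F/= in_itv/= sx/=.
  rewrite lerBrDl -lerBrDr ler_pdivrMr// mulrC -ler_pdivrMr//.
  by apply: (le_trans h); rewrite ler_nat (leq_trans (leqnSn _)).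
have mA : measurable (`]s, 1[%classic : set (measurableTypeR R)) by exact: measurable_itv.
move=> /(negligibleP mu mA) h.
by have := mu_near1_gt0 mu01 mu1 supp1 s0 s1; rewrite h/= ltxx.
Qed.

(** The intervals []s, t]] and []t', 1[] both have positive mass and are separated: wherever the
    mean lies, [r ^+ N] stays at distance at least [rho] from it on one of them. *)
Lemma wvar_lower (s : R) : 0 <= s -> s < 1 ->
  exists2 m, 0 < m & forall p, m * s ^+ p <= wvar p.
Proof.
move=> s0 s1; have [t /andP[st t1] h1] := exists_itv_gt0 s0 s1.
have t0 : 0 <= t by rewrite (le_trans s0)// ltW.
pose t' := (t + 1) / 2.
have tt' : t < t' by rewrite /t'; lra.
have t'1 : t' < 1 by rewrite /t'; lra.
have t'0 : 0 <= t' by rewrite (le_trans t0)// ltW.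
have h2 := mu_near1_gt0 mu01 mu1 supp1 t'0 t'1.
pose rho := (t' ^+ N - t ^+ N) / 2.
have rho0 : 0 < rho by rewrite divr_gt0// subr_gt0 ltrXn2r// -lt0n.
have X0 := integrable_wsqdist; have sN c r p : I01 r -> 0 <= (r ^+ N - c) ^+ 2 * r ^+ p :> R.
  by move=> /I01P[r0 _]; rewrite mulr_ge0 ?sqr_ge0 ?exprn_ge0.
exists (rho ^+ 2 * Num.min (fine (mu `]s, t]%classic)) (fine (mu `]t', 1[%classic))).
  by rewrite mulr_gt0 ?exprn_gt0// lt_min h1.
move=> p; set c := wmean p; rewrite mulrAC.
have cst0 : 0 <= rho ^+ 2 * s ^+ p by rewrite mulr_ge0 ?sqr_ge0 ?exprn_ge0.
have bnd r : s < r -> rho <= `|r ^+ N - c| -> rho ^+ 2 * s ^+ p <= (r ^+ N - c) ^+ 2 * r ^+ p.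
  move=> sr hr; rewrite ler_pM ?sqr_ge0 ?exprn_ge0//.
    by rewrite -(real_normK (num_real (r ^+ N - c))) lerXn2r ?nnegrE ?(ltW rho0).
  by rewrite lerXn2r ?nnegrE ?(ltW sr)// (le_trans s0)// ltW.
have [hc|hc] := leP ((t' ^+ N + t ^+ N) / 2) c.
  apply: (@le_trans _ _ (rho ^+ 2 * s ^+ p * fine (mu `]s, t]%classic))).
    by rewrite ler_wpM2l// ge_min lexx.
  have mA : measurable (`]s, t]%classic : set (measurableTypeR R)) by exact: measurable_itv.
  have sA : (`]s, t]%classic : set (measurableTypeR R)) `<=` I01.
    move=> r /=; rewrite in_itv/= => /andP[sr rt].
    by apply: I01_intro; [rewrite (le_trans s0)// ltW|exact: le_lt_trans rt t1].
  apply: (Rintegral_ge_cst mA sA) => //.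
  - by move=> r; exact: sN.
  - move=> r; rewrite /= in_itv/= => /andP[sr rt]; apply: bnd => //.
    have : r ^+ N <= t ^+ N by rewrite lerXn2r ?nnegrE// (le_trans s0)// ltW.
    by move=> h; rewrite distrC (le_trans _ (ler_norm _))// /rho; lra.
apply: (@le_trans _ _ (rho ^+ 2 * s ^+ p * fine (mu `]t', 1[%classic))).
  by rewrite ler_wpM2l// ge_min lexx orbT.
have mA : measurable (`]t', 1[%classic : set (measurableTypeR R)) by exact: measurable_itv.
have sA : (`]t', 1[%classic : set (measurableTypeR R)) `<=` I01.
  move=> r /=; rewrite in_itv/= => /andP[t'r r1].
  by apply: I01_intro => //; rewrite (le_trans t'0)// ltW.
apply: (Rintegral_ge_cst mA sA) => //.
- by move=> r; exact: sN.
- move=> r; rewrite /= in_itv/= => /andP[t'r r1]; apply: bnd.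
    by rewrite (lt_trans st)// (lt_trans tt').
  have : t' ^+ N <= r ^+ N by rewrite lerXn2r ?nnegrE ?(ltW t'r)// (le_trans t'0)// ltW.
  by move=> h; rewrite (le_trans _ (ler_norm _))// /rho; lra.
Qed.

Lemma wvar_gt0 p : 0 < wvar p.
Proof.
have h0 : (0 : R) <= 2^-1 by [].
have h1 : (2^-1 : R) < 1 by lra.
have [m m0 h] := wvar_lower h0 h1.
by apply: lt_le_trans (h p); rewrite mulr_gt0// exprn_gt0.
Qed.

(** Comparison with a ratio [s'] strictly between [s] and 1. It makes the contribution of [[0, s]]
    negligible with respect to the variance. *)
Lemma geometric_wvar (s e : R) : 0 <= s -> s < 1 -> 0 < e ->
  exists P, forall p, (P <= p)%N -> s ^+ p <= e * wvar p.
Proof.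
move=> s0 s1 e0; pose s' := (s + 1) / 2.
have ss' : s < s' by rewrite /s'; lra.
have s'1 : s' < 1 by rewrite /s'; lra.
have s'0 : 0 < s' by rewrite (le_lt_trans s0).
have [m m0 hm] := wvar_lower (ltW s'0) s'1.
have x0 : 0 <= s / s' by rewrite divr_ge0// ltW.
have x1 : s / s' < 1 by rewrite ltr_pdivrMr// mul1r.
have /cvgrPdist_lt := @cvg_geometric R 1 (s / s') ltac:(by rewrite ger0_norm).
move=> /(_ (e * m) (mulr_gt0 e0 m0))[P _ hP]; exists P => p Pp.
have := hP p Pp; rewrite /geometric/= mul1r sub0r normrN ger0_norm ?exprn_ge0// => /ltW h.
apply: (@le_trans _ _ (e * (m * s' ^+ p))); last by rewrite ler_wpM2l// ltW.
have -> : s ^+ p = (s / s') ^+ p * s' ^+ p by rewrite -exprMn divfK// gt_eqF.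
by rewrite mulrA ler_wpM2r// exprn_ge0// ltW.
Qed.

Lemma expN_le1 (r : R) : I01 r -> 0 <= r ^+ N <= 1.
Proof. by move=> /I01P[r0 r1]; rewrite exprn_ge0// exprn_ile1// ltW. Qed.

Lemma wmean_ge0 p : 0 <= wmean p.
Proof. by rewrite divr_ge0// ltW// G0. Qed.

Lemma moment_le p k : moment mu (p + k) <= moment mu p.
Proof.
apply: le_Rintegral => //; [exact: integrable_exprn|exact: integrable_exprn|].
move=> r /I01P[r0 r1]; by rewrite exprD ler_piMr ?exprn_ge0// exprn_ile1 ?(ltW r1).
Qed.

(** Equality would make the variance nonpositive. *)
Lemma wmean_lt1 p : wmean p < 1.
Proof.
rewrite lt_neqAle; apply/andP; split; last first.
  by rewrite ler_pdivrMr ?G0// mul1r moment_le.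
apply/negP => /eqP m1; have := wvar_gt0 p; rewrite /wvar m1 ltNge => /negP; apply.
have e : moment mu (p + N) = moment mu p.
  by move: m1; rewrite /wmean => /(congr1 ( *%R^~ (moment mu p))); rewrite divfK ?gt_eqF ?G0// mul1r.
have h := moment_le (p + N) N.
by rewrite wsqdistE e mul2n -addnn addnA; move: h; rewrite e; lra.
Qed.

Lemma wvar_le_moment p : wvar p <= moment mu p.
Proof.
apply: (le_trans (wvar_le 0 p)); rewrite wsqdistE mulr0 mul0r subr0 expr0n mul0r addr0.
exact: moment_le.
Qed.

(* The term [s ^+ p] is what allows [r < s]. *)
Lemma weight_split (s r Y : R) p : 0 <= s -> s < 1 -> I01 r -> 0 <= Y <= 1 ->
  s ^+ N * (Y * r ^+ p) - s ^+ p <= Y * r ^+ (p + N).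
Proof.
move=> s0 s1 /[dup] Ir /I01P[r0 r1] /andP[Y0 Y1].
have sN : 0 <= s ^+ N <= 1 by rewrite exprn_ge0// exprn_ile1// ltW.
case/andP: sN => sN0 sN1.
have [rs|sr] := ltP r s.
  have h : r ^+ p <= s ^+ p by rewrite lerXn2r ?nnegrE// ltW.
  have h2 : 0 <= r ^+ p by rewrite exprn_ge0.
  apply: (@le_trans _ _ 0); last by rewrite mulr_ge0// exprn_ge0.
  rewrite subr_le0; apply: le_trans h.
  rewrite -[leRHS]mul1r ler_pM// ?mulr_ge0//.
  by rewrite -[leRHS]mul1r ler_wpM2r.
rewrite lerBlDr; apply: (@le_trans _ _ (Y * r ^+ (p + N))); last by rewrite lerDl exprn_ge0.
rewrite exprD [leLHS]mulrC -mulrA ler_wpM2l// ler_wpM2l ?exprn_ge0//.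
by rewrite lerXn2r ?nnegrE.
Qed.

(** Used with [Y = 1] for the means and with the squared distance to a centre for the variances. *)
Lemma Rintegral_weight_split (s : R) (Y : R -> R) p : 0 <= s -> s < 1 ->
  mu.-integrable I01 (EFin \o Y) -> (forall r, I01 r -> 0 <= Y r <= 1) ->
  s ^+ N * (\int[mu]_(r in I01) (Y r * r ^+ p))%R - s ^+ p <=
  (\int[mu]_(r in I01) (Y r * r ^+ (p + N)))%R.
Proof.
move=> s0 s1 iY Y01.
have i1 := integrable_mul_exprn p iY; have i2 := integrable_mul_exprn (p + N) iY.
have i3 := integrable_cst_prob mu mI (s ^+ p).
have i4 := integrable_realZ mI (s ^+ N) i1.
apply: (@le_trans _ _ (\int[mu]_(r in I01) (s ^+ N * (Y r * r ^+ p) - s ^+ p))%R).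
  rewrite RintegralB// RintegralZl// lerB// Rintegral_cst//.
  rewrite -[leRHS]mulr1 ler_wpM2l ?exprn_ge0// -lee_fin fineK ?probability_le1//.
  exact: fin_num_measure.
apply: le_Rintegral => //; first exact: integrable_realB.
by move=> r Ir; apply: weight_split => //; exact: Y01.
Qed.

(** Bernoulli's inequality; the maximum with 0 keeps [s] in [[0, 1[] when [e] is large. *)
Lemma exists_expN_ge (e : R) : 0 < e -> exists s : R, [/\ 0 <= s, s < 1 & 1 - e <= s ^+ N].
Proof.
move=> e0; pose s := Num.max 0 (1 - e / N%:R).
have N0' : 0 < N%:R :> R by rewrite ltr0n.
have s0 : 0 <= s by rewrite le_max lexx.
have s1 : s < 1 by rewrite gt_max ltr01/= gtrBl divr_gt0.
exists s; split => //.
have h : 1 - s <= e / N%:R by rewrite lerBlDr -lerBlDl le_max lexx orbT.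
have h2 : 1 - s ^+ N <= N%:R * (1 - s).
  have -> : 1 - s ^+ N = (1 - s) * \sum_(i < N) s ^+ i.
    rewrite -[in LHS](expr1n R N) subrXX; congr (_ * _).
    by apply: eq_bigr => i _; rewrite expr1n mul1r.
  rewrite mulrC ler_wpM2r ?subr_ge0 ?(ltW s1)//.
  have -> : N%:R = \sum_(i < N) (1 : R) by rewrite sumr_const card_ord.
  by apply: ler_sum => i _; rewrite exprn_ile1// ltW.
have h3 : N%:R * (e / N%:R) = e by field; rewrite gt_eqF.
have h4 : N%:R * (1 - s) <= N%:R * (e / N%:R) by rewrite ler_wpM2l// ltW.
lra.
Qed.

(** The loss [s ^+ p] in the change of weight is small relative to the variance, hence to the
    moment. *)
Lemma wmean_cvg1 e : 0 < e -> exists P, forall p, (P <= p)%N -> 1 - e <= wmean p.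
Proof.
move=> e0; have e20 : 0 < e / 2 by rewrite divr_gt0.
have [s [s0 s1 sN]] := exists_expN_ge e20.
have [P hP] := geometric_wvar s0 s1 e20.
exists P => p /hP h; have hv := wvar_le_moment p.
have Gp : 0 < moment mu p by exact: G0.
have hs : s ^+ p <= e / 2 * moment mu p by apply: (le_trans h); rewrite ler_wpM2l// ltW.
have Y01 : forall r : measurableTypeR R, I01 r -> 0 <= (1 : R) <= 1 by rewrite ler01 lexx.
have := Rintegral_weight_split p s0 s1 (integrable_cst_prob mu mI 1) Y01.
have E k : (\int[mu]_(r in I01) (1 * r ^+ k))%R = moment mu k.
  by apply: eq_Rintegral => r _; rewrite mul1r.
rewrite !E => key; rewrite /wmean ler_pdivlMr//.
have : (1 - e / 2) * moment mu p <= s ^+ N * moment mu p by rewrite ler_wpM2r// ltW.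
lra.
Qed.

(** A variance is at most the second moment about any centre: the mean for [p], taken as common
    centre, gives the upper bound, and the mean for [p + N] the lower one. *)
Lemma wvar_ratio e : 0 < e -> exists P, forall p, (P <= p)%N ->
  (1 - e) * wvar p <= wvar (p + N) <= wvar p.
Proof.
move=> e0; have e20 : 0 < e / 2 by rewrite divr_gt0.
have [s [s0 s1 sN]] := exists_expN_ge e20.
have [P hP] := geometric_wvar s0 s1 e20.
exists P => p /hP h; apply/andP; split; last first.
  apply: (le_trans (wvar_le (wmean p) (p + N))).
  apply: le_Rintegral => //; [exact: integrable_wsqdist|exact: integrable_wsqdist|].
  move=> r /I01P[r0 r1]; rewrite ler_wpM2l ?sqr_ge0// exprD ler_piMr ?exprn_ge0//.
  by rewrite exprn_ile1 ?(ltW r1).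
set c := wmean (p + N).
have c0 : 0 <= c := wmean_ge0 _; have c1 : c < 1 := wmean_lt1 _.
have Y01 : forall r : measurableTypeR R, I01 r -> 0 <= (r ^+ N - c) ^+ 2 <= 1.
  move=> r /expN_le1/andP[x0 x1]; rewrite sqr_ge0/=; nra.
have iY : mu.-integrable I01 (EFin \o (fun r => (r ^+ N - c) ^+ 2)).
  have := integrable_wsqdist c 0; congr (_.-integrable _ _).
  by apply/funext => r /=; rewrite expr0 mulr1.
have := Rintegral_weight_split p s0 s1 iY Y01.
rewrite -/(wsqdist c p) -/(wsqdist c (p + N)) -/(wvar (p + N)) => key.
have h1 : s ^+ N * wvar p <= s ^+ N * wsqdist c p by rewrite ler_wpM2l ?exprn_ge0// wvar_le.
have h2 : (1 - e / 2) * wvar p <= s ^+ N * wvar p by rewrite ler_wpM2r// ltW// wvar_gt0.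
lra.
Qed.

Lemma normc_integralC_ae_le (F : R -> R[i]) (g : R -> R) (B : set (measurableTypeR R)) :
  measurable B -> mu B = 0%E -> integrableC mu I01 F -> mu.-integrable I01 (EFin \o g) ->
  (forall r, I01 r -> ~ B r -> normc (F r) <= g r) ->
  normc (integralC mu I01 F) <= 2 * (\int[mu]_(r in I01) g r)%R.
Proof.
move=> mB B0 [F1 F2] ig Fg.
have mIB : measurable (I01 `\` B) by exact: measurableD.
have red (f : R -> R) : mu.-integrable I01 (EFin \o f) ->
    mu.-integrable (I01 `\` B) (EFin \o f) /\
    (\int[mu]_(r in I01) f r)%R = (\int[mu]_(r in I01 `\` B) f r)%R.
  move=> fi; split; first by apply: integrableS fi => //; exact: subDsetl.
  by rewrite /Rintegral (@negligible_integral _ _ _ mu I01 B).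
have main (p : R[i] -> R) : (forall z, `|p z| <= normc z) ->
    mu.-integrable I01 (EFin \o (fun r => p (F r))) ->
    `|(\int[mu]_(r in I01) p (F r))%R| <= (\int[mu]_(r in I01) g r)%R.
  move=> pn pi; have [pi' ->] := red _ pi; have [ig' ->] := red _ ig.
  rewrite (le_trans (le_normr_Rintegral _ _))//; apply: le_Rintegral => //.
    by move/integrable_abse : pi'.
  by move=> r [Ir nBr]; rewrite (le_trans (pn _))// Fg.
rewrite (le_trans (normc_le_ReIm _))// mulr_natl mulr2n lerD//=; apply: main => //.
  exact: Re_le_normc.
exact: Im_le_normc.
Qed.

End Variance.

(** * Increments of [q] near 1 *)

Section StrictDerivativeAtOne.
Context {R : realType}.
Variables (q q' : R -> R[i]).
Hypothesis qC1 : C1_near1 q q'.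

Lemma path_deriv_exprn k (t : R) :
  path_deriv (fun s : R => (s ^+ k)%:C) t (k%:R * t ^+ k.-1)%:C.
Proof.
elim: k => [|k ih].
  by rewrite mul0r; under eq_fun do rewrite expr0; exact: path_deriv_cst.
under eq_fun do rewrite exprS real_complexM.
have := path_derivM (path_deriv_real t) ih; congr path_deriv.
rewrite mul1r -real_complexM -rmorphD/=; congr (_%:C).
by case: k {ih} => [|k]/=; rewrite ?expr0 ?mul0r ?mulr0 ?addr0 ?mul1r// exprS -!natr1; ring.
Qed.

(** At interior points the derivative relative to [[0, 1]] is two-sided. *)
Lemma C1_near1_path_deriv : exists2 s : R, 0 <= s < 1 &
  forall x, s < x < 1 -> path_deriv q x (q' x).
Proof.
have [delta [/andP[d0 d1] dq _]] := qC1.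
exists (1 - delta); first by apply/andP; split; lra.
move=> x /andP[sx x1]; apply/path_deriv_epsP => e e0.
have eC : 0 < e%:C :> R[i] by rewrite ltcR.
have xI : 1 - delta < x <= 1 by rewrite sx ltW.
have /cvgrPdist_le/(_ _ eC) := dq _ xI.
rewrite near_withinE => -[d /= dd0 hd].
have x0 : 0 < x by lra.
exists (Num.min d (Num.min x (1 - x))).
  by rewrite !lt_min dd0 x0 subr_gt0.
move=> h; rewrite !lt_min => /and3P[h1 h2 h3].
have [->|h0] := eqVneq h 0.
  by rewrite addr0 subrr mulr0 subr0 normc0 normr0 mulr0.
have := hd (x + h).
have hb : `|x - (x + h)| < d by rewrite opprD addrA subrr add0r normrN.
move=> /(_ hb); have xh : x + h != x by rewrite -subr_eq0 addrAC subrr add0r.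
move=> /(_ xh).
have xhI : `[(0 : R), 1]%classic (x + h).
  rewrite /= in_itv/=; move: h2 h3; rewrite !ltr_norml => /andP[a b] /andP[a' b'].
  by apply/andP; split; lra.
move=> /(_ xhI).
have hC0 : h%:C != 0 :> R[i] by rewrite eq_complex/= eqxx andbT.
have -> : x + h - x = h by rewrite addrAC subrr add0r.
change ((normc (q' x - (q (x + h) - q x) / h%:C))%:C <= e%:C ->
  normc (q (x + h) - q x - q' x * h%:C) <= e * `|h|).
rewrite lecR => H.
have -> : q (x + h) - q x - q' x * h%:C = - ((q' x - (q (x + h) - q x) / h%:C) * h%:C).
  by field.
by rewrite normcN normcM normc_real ler_wpM2r.
Qed.

Lemma C1_near1_cont (e : R) : 0 < e -> exists2 s : R, 0 <= s < 1 &
  forall x, s < x < 1 -> normc (q' x - q' 1) < e.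
Proof.
move=> e0; have [delta [/andP[d0 d1] _ cq']] := qC1.
have eC : 0 < e%:C :> R[i] by rewrite ltcR.
have /subspace_continuousP := cq' => /(_ 1).
have I1 : `]1 - delta, 1]%classic (1 : R) by rewrite /= in_itv/= lexx andbT gtrBl.
move=> /(_ I1)/cvgrPdist_lt/(_ _ eC); rewrite near_withinE => -[d /= dd0 hd].
exists (Num.max 0 (Num.max (1 - delta) (1 - d))).
  by rewrite le_max lexx/= !gt_max ltr01/= !gtrBl d0.
move=> x; rewrite !gt_max => /andP[/and3P[x0 xd xdd] x1].
have hb : `|1 - x| < d by rewrite ger0_norm ?subr_ge0 ?(ltW x1)//; lra.
have := hd x hb.
have xI : `]1 - delta, 1]%classic x by rewrite /= in_itv/= xd ltW.
move=> /(_ xI).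
change ((normc (q' 1 - q' x))%:C < e%:C -> normc (q' x - q' 1) < e).
by rewrite ltcR normc_distC.
Qed.

(** In the factorization of [r ^+ N - t ^+ N] the term [r ^+ N.-1] alone suffices. Errors relative
    to [r - t] thereby become errors relative to [r ^+ N - t ^+ N]. *)
Lemma expn_dist_ge N (r t : R) : (0 < N)%N -> 2^-1 <= r -> 2^-1 <= t ->
  (2^-1) ^+ N.-1 * `|r - t| <= `|r ^+ N - t ^+ N|.
Proof.
move=> N0 r2 t2; have h : (0 : R) < 2^-1 by [].
have r0 : 0 <= r by rewrite (le_trans (ltW h)).
have t0 : 0 <= t by rewrite (le_trans (ltW h)).
rewrite subrXX normrM mulrC ler_wpM2l//.
rewrite (le_trans _ (ler_norm _))//; case: N N0 => // N _ /=.
rewrite big_ord_recl/= subn0 expr0 mulr1; apply: (@le_trans _ _ (r ^+ N)).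
  by rewrite lerXn2r ?nnegrE ?(ltW h).
by rewrite lerDl sumr_ge0// => i _; rewrite mulr_ge0// exprn_ge0.
Qed.

(** The derivative of [q - kap * r ^+ N] tends to 0 at 1, so the mean value theorem makes its
    increments small relative to [r - t], hence to [r ^+ N - t ^+ N]. *)
Lemma C1_near1_strict N (e : R) : (0 < N)%N -> 0 < e ->
  exists2 s : R, 0 <= s < 1 & forall r t, s < r < 1 -> s < t < 1 ->
    normc (q r - q t - q' 1 / N%:R * (r ^+ N - t ^+ N)%:C) <= e * `|r ^+ N - t ^+ N|.
Proof.
move=> N0 e0; pose c : R := (2^-1) ^+ N.-1.
have c0 : 0 < c by rewrite exprn_gt0.
(* A factor 2 goes to the two terms of [bphi], another to real and imaginary parts, and [c] to the
   passage from [r - t] to [r ^+ N - t ^+ N]. *)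
pose e' := e * c / 4.
have e'0 : 0 < e' by rewrite divr_gt0// mulr_gt0.
have [s1 /andP[s10 s11] dq] := C1_near1_path_deriv.
have [s2 /andP[s20 s21] cq] := C1_near1_cont e'0.
have nq0 : 0 < normc (q' 1) + 1 by rewrite ltr_wpDl// normc_ge0.
have [s3 [s30 s31 s3N]] := exists_expN_ge N0 (divr_gt0 e'0 nq0).
pose s := Num.max (2^-1) (Num.max s1 (Num.max s2 s3)).
have half1 : (2^-1 : R) < 1 by lra.
have sP x : s < x -> [/\ 2^-1 < x, s1 < x, s2 < x & s3 < x].
  by rewrite /s !gt_max => /and4P.
exists s; first by rewrite /s le_max invr_ge0 ler0n/= !gt_max half1 s11 s21.
pose kap := q' 1 / N%:R.
have NC : N%:R != 0 :> R[i] by rewrite pnatr_eq0 -lt0n.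
have dphi x : s < x < 1 -> path_deriv (fun y => q y - kap * (y ^+ N)%:C) x
    (q' x - kap * (N%:R * x ^+ N.-1)%:C).
  move=> /andP[/sP[_ h _ _] x1].
  have hx : s1 < x < 1 by rewrite h.
  have := path_derivD (dq _ hx) (path_derivZ (- kap) (path_deriv_exprn N x)).
  by rewrite mulNr; congr path_deriv; apply/funext => y; rewrite mulNr.
have bphi x : s < x < 1 -> normc (q' x - kap * (N%:R * x ^+ N.-1)%:C) <= 2 * e'.
  move=> /andP[/sP[h2 _ h3 h4] x1].
  have hx : s2 < x < 1 by rewrite h3.
  have x0 : 0 <= x by rewrite (le_trans s20)// ltW.
  have -> : q' x - kap * (N%:R * x ^+ N.-1)%:C = (q' x - q' 1) + q' 1 * (1 - x ^+ N.-1)%:C.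
    rewrite real_complexM rmorph_nat rmorphB/= rmorph1 /kap.
    by rewrite mulrA divfK//; ring.
  rewrite (le_trans (le_normcD _ _))// mulr_natl mulr2n lerD ?(ltW (cq _ hx))//.
  rewrite normcM normc_real.
  have xN : 1 - e' / (normc (q' 1) + 1) <= x ^+ N.-1.
    apply: (le_trans s3N); apply: (@le_trans _ _ (x ^+ N)).
      by rewrite lerXn2r ?nnegrE// ltW.
    by rewrite -[in leLHS](prednK N0) exprS ler_piMl ?exprn_ge0// ltW.
  rewrite ger0_norm; last by rewrite subr_ge0 exprn_ile1// ltW.
  apply: (@le_trans _ _ ((normc (q' 1) + 1) * (e' / (normc (q' 1) + 1)))).
    by rewrite ler_pM ?normc_ge0 ?subr_ge0 ?exprn_ile1 ?lerDl// ?(ltW x1)//; lra.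
  by rewrite mulrC divfK// gt_eqF.
have main (p : R[i] -> R) : (forall z, `|p z| <= normc z) -> (forall a b, p (a - b) = p a - p b) ->
    (forall G x l, path_deriv G x l -> is_derive (x : R) (1 : R) (fun y => p (G y)) (p l)) ->
    forall r t, s < t -> t <= r -> r < 1 ->
    `|p (q r - q t - kap * (r ^+ N - t ^+ N)%:C)| <= 2 * e' * `|r - t|.
  move=> pn pB pd r t st tr r1.
  have sub x : x \in `[t, r] -> s < x < 1.
    by rewrite in_itv/= => /andP[a b]; rewrite (lt_le_trans st)// (le_lt_trans b).
  have [c' cI] : exists2 c, c \in `[t, r] & p (q r - kap * (r ^+ N)%:C) -
      p (q t - kap * (t ^+ N)%:C) = p (q' c - kap * (N%:R * c ^+ N.-1)%:C) * (r - t).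
    apply: (@MVT_segment R (fun y => p (q y - kap * (y ^+ N)%:C))
       (fun x => p (q' x - kap * (N%:R * x ^+ N.-1)%:C))) => //.
      by move=> x xI; apply: pd; apply: dphi; apply: sub; exact: subset_itv_oo_cc.
    by apply: derivable_within_continuous => x /sub/dphi/pd [].
  have -> : q r - q t - kap * (r ^+ N - t ^+ N)%:C =
      (q r - kap * (r ^+ N)%:C) - (q t - kap * (t ^+ N)%:C) by rewrite rmorphB/=; ring.
  rewrite (pB (q r - kap * (r ^+ N)%:C)) => ->; rewrite normrM ler_wpM2r// (le_trans (pn _))//.
  by apply: bphi; exact: sub.
have both r t : s < t -> t <= r -> r < 1 ->
    normc (q r - q t - kap * (r ^+ N - t ^+ N)%:C) <= e * `|r ^+ N - t ^+ N|.
  move=> st tr r1; apply: (@le_trans _ _ (4 * e' * `|r - t|)).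
    rewrite (le_trans (normc_le_ReIm _))//.
    have h1 := main _ (@Re_le_normc R) (@ReB R) (fun G x l => @proj1 _ _) r t st tr r1.
    have h2 := main _ (@Im_le_normc R) (@ImB R) (fun G x l => @proj2 _ _) r t st tr r1.
    by move: h1 h2; rewrite -/kap; lra.
  have [h _ _ _] := sP _ st.
  have h' : 2^-1 < r by exact: lt_le_trans h tr.
  have := expn_dist_ge N0 (ltW h') (ltW h); rewrite -/c => h3.
  have -> : 4 * e' * `|r - t| = e * (c * `|r - t|) by rewrite /e'; field.
  by rewrite ler_wpM2l// ltW.
move=> r t /andP[sr r1] /andP[st t1]; have [tr|rt] := leP t r; first exact: both.
have := both t r sr (ltW rt) t1; rewrite (distrC (t ^+ N)) -normcN.
by congr (normc _ <= _); rewrite /kap !rmorphB/=; ring.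
Qed.

End StrictDerivativeAtOne.

(** * Limit of the entries of the band *)

Section BandLimit.
Context {R : realType} (mu : probability (measurableTypeR R) R).
Hypothesis mu01 : mu `[0%R, 1%R]%classic = 1%E.
Hypothesis mu1 : mu [set 1%R] = 0%E.
Hypothesis supp1 : supp mu 1.
Variables (q q' : R -> R[i]).
Hypothesis qL : Linfty01 mu q.
Hypothesis qC1 : C1_near1 q q'.
Let mI := @measurable_I01 R.
Let G0 p : 0 < moment mu p. Proof. exact: moment_gt0. Qed.

Definition qmoment (p : nat) : R[i] := integralC mu I01 (fun r => q r * (r ^+ p)%:C).

Lemma integrableC_real (g : R -> R) : mu.-integrable I01 (EFin \o g) ->
  integrableC mu I01 (fun r => (g r)%:C).
Proof. by move=> ig; split => //=; exact: integrable0. Qed.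

Lemma integralC_real (g : R -> R) :
  integralC mu I01 (fun r => (g r)%:C) = (\int[mu]_(r in I01) g r)%R%:C.
Proof. by apply: complex_eqP => //=; rewrite /Rintegral integral0. Qed.

Section weight.
Variable N : nat.
Hypothesis N0 : (0 < N)%N.
Let kap := q' 1 / N%:R.

(* Covariance of [q] and [r ^+ N] for the weight [r ^+ p], again not normalized. *)
Definition wcov (p : nat) : R[i] := qmoment (p + N) - (wmean mu N p)%:C * qmoment p.

(** [r ^+ N - m] has zero weighted mean, so the constant [a] contributes nothing and can be chosen
    at will, while its square integrates to the variance. *)
Lemma wcov_recentered (a : R[i]) p :
  let m := wmean mu N p in
  let F := fun r : R => (q r - a - kap * (r ^+ N - m)%:C) * ((r ^+ N - m) * r ^+ p)%:C in
  integrableC mu I01 F /\ integralC mu I01 F = wcov p - kap * (wvar mu N p)%:C.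
Proof.
move=> m F; have iq := Linfty01_integrable qL.
have i1 := integrableC_mul_exprn (p + N) iq; have i2 := integrableC_mul_exprn p iq.
have x1 := integrable_exprn mu (p + N); have x2 := integrable_exprn mu p.
have x3 := integrable_realZ mI m x2.
have x4 := integrable_realB mI x1 x3.
have x5 := integrable_wsqdist mu N m p.
have j4 := integrableC_real x4; have j5 := integrableC_real x5.
have z1 := integrableCZ mI m%:C i2.
have z2 := integrableCZ mI a j4; have z3 := integrableCZ mI kap j5.
have E : F = fun r => (q r * (r ^+ (p + N))%:C - m%:C * (q r * (r ^+ p)%:C)) -
    a * (r ^+ (p + N) - m * r ^+ p)%:C - kap * ((r ^+ N - m) ^+ 2 * r ^+ p)%:C.
  apply/funext => r; rewrite /F exprD !(rmorphM, rmorphB, rmorphXn)/=; ring.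
split; first by rewrite E; do 2 (apply: integrableCB => //); exact: integrableCB.
rewrite E integralCB//; last by apply: integrableCB => //; exact: integrableCB.
rewrite integralCB//; last exact: integrableCB.
rewrite integralCB// !integralCZ// !integralC_real -/(wsqdist mu N m p) -/(wvar mu N p).
rewrite RintegralB// RintegralZl// -/(moment mu (p + N)) -/(moment mu p).
have -> : m * moment mu p = moment mu (p + N) by rewrite /m /wmean divfK// gt_eqF// G0.
by rewrite subrr mulr0 subr0.
Qed.

Lemma exists_root_expn (m : R) : 0 <= m -> exists2 r : R, 0 <= r & r ^+ N = m.
Proof.
move=> m0; exists (m `^ (N%:R^-1)); first exact: powR_ge0.
by rewrite -powR_mulrn ?powR_ge0// -powRrM mulVf ?powRr1// pnatr_eq0 -lt0n.
Qed.

(** For [r > s] the integrand is at most [e / 4] times that of the variance; for [r <= s] it is at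
    most [M' * s ^+ p], eventually below [e / 4] of the variance. The factor 2 of
    [normc_integralC_ae_le] accounts for the rest of [e]. *)
Lemma wcov_limit (e : R) : 0 < e -> exists P, forall p, (P <= p)%N ->
  normc (wcov p - kap * (wvar mu N p)%:C) <= e * wvar mu N p.
Proof.
move=> e0; have e40 : 0 < e / 4 by rewrite divr_gt0.
have [s /andP[s0 s1] hs] := C1_near1_strict qC1 N0 e40.
rewrite -/kap in hs.
have [M [B [M0 mB B0 hB]]] := Linfty01_bound qL.
pose t0 := (s + 1) / 2.
have t0s : s < t0 < 1 by rewrite /t0; apply/andP; split; lra.
(* [rs] varies with [p] and may fall into the exceptional set [B], so [q rs] is bounded by
   comparison with the fixed point [t0] through [hs]. *)
pose M' := M + normc (q t0) + 2 * normc kap + e / 4.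
have k0 := normc_ge0 kap; have qt0 := normc_ge0 (q t0).
have M'0 : 0 < M' by rewrite /M'; lra.
have sN : s ^+ N < 1 by rewrite exprn_ilt1// -lt0n.
(* With this margin the mean exceeds [s ^+ N], so its root [rs] lies above [s]. *)
have e10 : 0 < (1 - s ^+ N) / 2 by rewrite divr_gt0// subr_gt0.
have [P1 h1] := wmean_cvg1 mu01 mu1 supp1 N0 e10.
have [P2 h2] := geometric_wvar mu01 mu1 supp1 N0 s0 s1 (divr_gt0 e40 M'0).
exists (maxn P1 P2) => p; rewrite geq_max => /andP[/h1{}h1 /h2{}h2].
set m := wmean mu N p in h1.
have m0 : 0 <= m by exact: wmean_ge0.
have m1 : m < 1 by exact: wmean_lt1.
have [rs rs0 rsN] := exists_root_expn m0.
have rsI : s < rs < 1.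
  apply/andP; split; rewrite ltNge; apply/negP => h.
    have : rs ^+ N <= s ^+ N by rewrite lerXn2r ?nnegrE.
    by rewrite rsN; lra.
  have : 1 <= rs ^+ N by rewrite exprn_ege1.
  by rewrite rsN leNgt m1.
have [iF <-] := wcov_recentered (q rs) p.
rewrite -/m in iF *.
have x5 := integrable_wsqdist mu N m p.
pose g (r : R) := e / 4 * ((r ^+ N - m) ^+ 2 * r ^+ p) + M' * s ^+ p.
have ig : mu.-integrable I01 (EFin \o g).
  by apply: integrable_realD => //; [exact: integrable_realZ|exact: integrable_cst_prob].
have V0 := wvar_gt0 mu01 mu1 supp1 N0 p.
have ms0 : 0 <= M' * s ^+ p by rewrite mulr_ge0 ?exprn_ge0// ltW.
apply: (@le_trans _ _ (2 * (\int[mu]_(r in I01) g r)%R)); last first.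
  have -> : (\int[mu]_(r in I01) g r)%R = e / 4 * wvar mu N p + M' * s ^+ p * fine (mu I01).
    rewrite RintegralD//; [|exact: integrable_realZ|exact: integrable_cst_prob].
    by rewrite RintegralZl// Rintegral_cst.
  have mu1' : fine (mu I01) <= 1.
    by rewrite -lee_fin fineK ?probability_le1//; exact: fin_num_measure.
  have h3 : M' * s ^+ p <= e / 4 * wvar mu N p.
    rewrite (le_trans (ler_wpM2l (ltW M'0) h2))// mulrA [M' * _]mulrC divfK// gt_eqF//.
  have h4 : M' * s ^+ p * fine (mu I01) <= M' * s ^+ p by rewrite -[leRHS]mulr1 ler_wpM2l.
  by lra.
apply: (normc_integralC_ae_le mB B0 iF ig) => r /[dup] Ir /I01P[r0 r1] nBr.
have rp0 : 0 <= r ^+ p by rewrite exprn_ge0.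
have X0 := sqr_ge0 (r ^+ N - m).
rewrite normcM normc_real normrM (ger0_norm rp0) /g.
have [rs'|sr] := leP r s; last first.
  have h := hs r rs (introT andP (conj sr r1)) rsI.
  rewrite rsN in h.
  apply: (@le_trans _ _ (e / 4 * ((r ^+ N - m) ^+ 2 * r ^+ p))); last by rewrite lerDl.
  rewrite -(real_normK (num_real (r ^+ N - m))).
  have -> : e / 4 * (`|r ^+ N - m| ^+ 2 * r ^+ p) =
    e / 4 * `|r ^+ N - m| * (`|r ^+ N - m| * r ^+ p) by ring.
  by rewrite ler_wpM2r// mulr_ge0.
apply: (@le_trans _ _ (M' * s ^+ p)); last first.
  by rewrite lerDr; apply: mulr_ge0; [exact: ltW|exact: mulr_ge0].
have Xm : `|r ^+ N - m| <= 1.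
  have /andP[x0 x1] := expN_le1 N Ir; rewrite ler_norml; apply/andP; split; lra.
rewrite mulrA ler_pM// ?mulr_ge0 ?normc_ge0//; last by rewrite lerXn2r ?nnegrE.
rewrite -[leRHS]mulr1 ler_pM ?normc_ge0//.
have hrs := hs rs t0 rsI t0s; rewrite rsN in hrs.
have t0N : 0 <= t0 ^+ N <= 1.
  by case/andP: t0s => a b; rewrite exprn_ge0 ?exprn_ile1// ?(ltW b)// (le_trans s0)// ltW.
have dm : `|m - t0 ^+ N| <= 1.
  case/andP: t0N => a b; rewrite ler_norml; apply/andP; split; lra.
have qrs : normc (q rs) <= normc (q t0) + normc kap + e / 4.
  have -> : q rs = (q rs - q t0 - kap * (m - t0 ^+ N)%:C) + (q t0 + kap * (m - t0 ^+ N)%:C) by ring.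
  rewrite (le_trans (le_normcD _ _))// addrC lerD//; last first.
    by rewrite (le_trans hrs)// -[leRHS]mulr1 ler_wpM2l// ltW.
  rewrite (le_trans (le_normcD _ _))// lerD// normcM normc_real.
  by rewrite -[leRHS]mulr1 ler_wpM2l.
have qr : normc (q r) <= M by exact: hB.
have kx : normc (kap * (r ^+ N - m)%:C) <= normc kap.
  by rewrite normcM normc_real -[leRHS]mulr1 ler_wpM2l.
have := le_normcD (q r - q rs) (- (kap * (r ^+ N - m)%:C)).
have := le_normcD (q r) (- q rs); rewrite !normcN /M'.
lra.
Qed.

End weight.

Section band.
Variable n : nat.
Hypothesis n0 : (0 < n)%N.
Let N := (2 * n)%N.
Let N0 : (0 < N)%N. Proof. by rewrite muln_gt0. Qed.
Let V0 p : 0 < wvar mu N p. Proof. exact: wvar_gt0. Qed.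

Lemma tauE j : tau mu n (j + n) ^+ 2 = moment mu (2 * j + N) / moment mu (2 * j).
Proof.
rewrite /tau leq_addl addnK expr_div_n !(sqr_sg mu01 mu1 supp1) mulnDr//.
Qed.

(** Stated at [j + n] because for indices below [n] the subtracted term of [dd] vanishes, and the
    difference is not a variance. *)
Lemma dd_wvar j : dd mu n (j + n) = wvar mu N (2 * j) / moment mu (2 * j + N).
Proof.
have E : (2 * (j + n) + N = 2 * j + 2 * N)%N by rewrite mulnDr -/N -addnA addnn -(mul2n N).
rewrite /dd !tauE wvarE// E mulnDr -/N.
have g1 := lt0r_neq0 (G0 (2 * j)); have g2 := lt0r_neq0 (G0 (2 * j + N)).
by field; rewrite g1 g2.
Qed.

Lemma lam_diff k : lam mu q (k + n) - lam mu q k = wcov N (2 * k) / (moment mu (2 * k + N))%:C.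
Proof.
rewrite /lam /wcov /wmean mulnDr -/N -/(qmoment (2 * k + N)) -/(qmoment (2 * k)).
have g1 : (moment mu (2 * k))%:C != 0 :> R[i].
  by rewrite eq_complex/= eqxx andbT gt_eqF// G0.
have g2 : (moment mu (2 * k + N))%:C != 0 :> R[i].
  by rewrite eq_complex/= eqxx andbT gt_eqF// G0.
rewrite real_complexM real_complexV; field; by rewrite g1 g2.
Qed.

Lemma bandE j : band mu n q (j + n) =
  wcov N (2 * (j + n)) / (wvar mu N (2 * (j + n)))%:C *
  (Num.sqrt (wvar mu N (2 * (j + n)) / wvar mu N (2 * j)))%:C.
Proof.
rewrite /band lam_diff !dd_wvar mulnDr -/N.
set A := wvar mu N (2 * j); set V := wvar mu N (2 * j + N).
set g := moment mu (2 * j + N); set g' := moment mu (2 * j + N + N).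
have A0 : 0 < A by exact: V0.
have V0' : 0 < V by exact: V0.
have g0 : 0 < g by exact: G0.
have g'0 : 0 < g' by exact: G0.
have -> : tau mu n (j + n + n) = Num.sqrt g' / Num.sqrt g.
  by rewrite /tau leq_addl addnK /sg !mulnDr.
rewrite !powRN !powR12_sqrt ?divr_ge0 ?ltW//.
rewrite !sqrtrM ?ltW// !sqrtrV ?ltW//.
have sA : Num.sqrt A != 0 by rewrite gt_eqF// sqrtr_gt0.
have sV : Num.sqrt V != 0 by rewrite gt_eqF// sqrtr_gt0.
have sgn : Num.sqrt g != 0 by rewrite gt_eqF// sqrtr_gt0.
have sgn' : Num.sqrt g' != 0 by rewrite gt_eqF// sqrtr_gt0.
have EV : V = Num.sqrt V ^+ 2 by rewrite sqr_sqrtr// ltW.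
have Eg : g' = Num.sqrt g' ^+ 2 by rewrite sqr_sqrtr// ltW.
rewrite [g'%:C](_ : _ = (Num.sqrt g')%:C ^+ 2); last by rewrite -real_complexX -Eg.
rewrite [V%:C](_ : _ = (Num.sqrt V)%:C ^+ 2); last by rewrite -real_complexX -EV.
(* With the square roots taken as variables, what is left is a rational identity: the moments cancel
   between [dd], [tau] and [lam]. *)
move: sA sV sgn sgn'; move: (Num.sqrt A) (Num.sqrt V) (Num.sqrt g) (Num.sqrt g') => a v x y a0 v0 x0 y0.
have C0 (b : R) : b != 0 -> b%:C != 0 :> R[i] by move=> b0; rewrite eq_complex/= eqxx andbT.
rewrite !(real_complexM, real_complexX, real_complexV, invfM, invrK).
field; by rewrite !C0.
Qed.

Lemma band_limit (e : R) : 0 < e -> exists K, forall k, (K <= k)%N ->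
  normc (band mu n q k - q' 1 / (2 * n)%:R) <= e.
Proof.
move=> e0; set kap := q' 1 / _.
have k0 := normc_ge0 kap; have k10 : 0 < normc kap + 1 by rewrite ltr_wpDl.
(* Half of [e] is kept for replacing the square root by 1, an error that gets multiplied by
   [kap]. *)
pose e1 := Num.min 1 (e / 2 / (normc kap + 1)).
have e10 : 0 < e1 by rewrite lt_min ltr01 !divr_gt0.
have e11 : e1 <= 1 by rewrite ge_min lexx.
have e1k : e1 * normc kap <= e / 2.
  apply: (@le_trans _ _ (e / 2 / (normc kap + 1) * (normc kap + 1))).
    by rewrite ler_pM ?(ltW e10) ?lerDl// ge_min lexx orbT.
  by rewrite divfK// gt_eqF.
have [P1 h1] := wcov_limit N0 (divr_gt0 e0 (ltr0Sn R 1)).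
have [P2 h2] := wvar_ratio mu01 mu1 supp1 N0 e10.
exists (P1 + P2 + n)%N => k Kk.
have [j kj] : exists j, k = (j + n)%N.
  by exists (k - n)%N; rewrite subnK// (leq_trans (leq_addl _ _) Kk).
have j12 : (P1 + P2 <= j)%N by move: Kk; rewrite kj leq_add2r.
rewrite kj bandE.
have p1 : (P1 <= 2 * (j + n))%N.
  rewrite (leq_trans (leq_addr P2 _))// (leq_trans j12)//.
  by rewrite mul2n -addnn -addnA leq_addr.
have p2 : (P2 <= 2 * j)%N.
  by rewrite (leq_trans (leq_addl P1 _))// (leq_trans j12)// mul2n -addnn leq_addr.
have {}h1 := h1 _ p1; have {}h2 := h2 _ p2.
have E2 : (2 * (j + n) = 2 * j + N)%N by rewrite mulnDr.
rewrite E2 in h1 *; rewrite -/kap in h1.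
have A0 := V0 (2 * j); have Vp := V0 (2 * j + N).
set A := wvar mu N (2 * j) in h2 A0 *; set V := wvar mu N (2 * j + N) in h1 h2 Vp *.
set x := Num.sqrt (V / A).
have x0 : 0 <= x by exact: sqrtr_ge0.
have xx : x ^+ 2 = V / A by rewrite sqr_sqrtr// divr_ge0// ltW.
have [x2l x2u] : 1 - e1 <= x ^+ 2 /\ x ^+ 2 <= 1.
  by case/andP: h2 => a b; rewrite xx ler_pdivlMr// ler_pdivrMr// mul1r.
have x1 : x <= 1 by rewrite -(@expr_le1 _ 2).
(* As [0 <= x <= 1], the lower bound on [x ^+ 2] passes to [x]. *)
have xl : 1 - e1 <= x by rewrite (le_trans x2l)// expr2 ler_piMl.
have VC : V%:C != 0 :> R[i] by rewrite eq_complex/= eqxx andbT gt_eqF.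
have -> : wcov N (2 * j + N) / V%:C * x%:C - kap =
   (wcov N (2 * j + N) - kap * V%:C) / V%:C * x%:C - kap * (1 - x)%:C.
  by rewrite rmorphB/= rmorph1; field.
rewrite (le_trans (le_normcD _ _))// normcN (splitr e) lerD//.
  rewrite !normcM normcV !normc_real (gtr0_norm Vp) (ger0_norm x0).
  rewrite -[leRHS]mulr1 ler_pM// ?mulr_ge0 ?normc_ge0 ?invr_ge0 ?(ltW Vp)//.
  by rewrite ler_pdivrMr.
rewrite (normcM kap) normc_real ger0_norm ?subr_ge0//.
by apply: le_trans e1k; rewrite (mulrC (normc kap)) ler_wpM2r//; lra.
Qed.

End band.

End BandLimit.

(** * Compactness of band matrices with vanishing entries *)

Section Compactness.
Context {R : realType}.
Implicit Types (x y z beta : nat -> R[i]) (n : nat).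

Lemma sqr_normcD_le (u v : R[i]) :
  normc (u + v) ^+ 2 <= 2 * normc u ^+ 2 + 2 * normc v ^+ 2.
Proof.
have h := le_normcD u v.
have u0 := normc_ge0 u; have v0 := normc_ge0 v; have w0 := normc_ge0 (u + v).
rewrite (@le_trans _ _ ((normc u + normc v) ^+ 2))// ?lerXn2r ?nnegrE ?addr_ge0//.
rewrite -subr_ge0 [leRHS](_ : _ = (normc u - normc v) ^+ 2) ?sqr_ge0//; ring.
Qed.

Lemma l2norm2_leP x (M : R) :
  (l2norm2 x <= M%:E)%E <-> forall L, \sum_(k < L) normc (x k) ^+ 2 <= M.
Proof.
have E L : (\sum_(0 <= k < L) (normc (x k) ^+ 2)%:E)%E =
    (\sum_(k < L) normc (x k) ^+ 2)%:E.
  by rewrite sumEFin big_mkord.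
have x0 k : (0 <= (normc (x k) ^+ 2)%:E)%E by rewrite lee_fin sqr_ge0.
split=> [xM L|xM].
  rewrite -lee_fin -E (le_trans _ xM)//.
  by apply: nneseries_lim_ge => k _ _; exact: x0.
apply: lime_le; first by apply: is_cvg_nneseries => k _ _; exact: x0.
by apply: nearW => L; rewrite E lee_fin.
Qed.

Lemma l2P x : l2 x <-> exists M : R, forall L, \sum_(k < L) normc (x k) ^+ 2 <= M.
Proof.
have x0 : (0 <= l2norm2 x)%E.
  by apply: nneseries_ge0 => k _ _; rewrite lee_fin sqr_ge0.
split=> [xoo|[M /l2norm2_leP xM]]; last exact: (le_lt_trans xM (ltry _)).
exists (fine (l2norm2 x)); apply/l2norm2_leP; rewrite fineK//.
by rewrite ge0_fin_numE.
Qed.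

(* The matrix supported on the [n]-th super- and subdiagonal, with entries
   [beta] and their conjugates. *)
Definition hermitian_band n beta x : nat -> R[i] := fun j =>
  beta j * x (j + n)%N +
  (if (n <= j)%N then (beta (j - n)%N)^*%C * x (j - n)%N else 0).

Lemma hermitian_band_linear n beta (a : R[i]) x y :
  hermitian_band n beta (fun k => a * x k + y k) =
  (fun k => a * hermitian_band n beta x k + hermitian_band n beta y k).
Proof. by apply/funext => k; rewrite /hermitian_band; case: ifP => _; ring. Qed.

Lemma hermitian_bandB n beta x z k :
  hermitian_band n beta x k - hermitian_band n beta z k =
  hermitian_band n beta (fun k => x k - z k) k.
Proof. by rewrite /hermitian_band; case: ifP => _; ring. Qed.

(** The coordinate [x i] is multiplied by [beta i] in one row and by [beta (i - n)] in another, so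
    [w i] has to dominate both. One factor 2 comes from the square of a sum, the other from these
    two occurrences. *)
Lemma sum_hermitian_band_le n beta (w : nat -> R) x L :
  (forall j, normc (beta j) <= w j) -> (forall j, normc (beta j) <= w (j + n)%N) ->
  \sum_(j < L) normc (hermitian_band n beta x j) ^+ 2 <=
  4 * \sum_(i < n + L) w i ^+ 2 * normc (x i) ^+ 2.
Proof.
move=> bw bwn; pose h i := w i ^+ 2 * normc (x i) ^+ 2.
have w0 j : 0 <= w j by rewrite (le_trans (normc_ge0 (beta j))).
have h0 i : 0 <= h i by rewrite mulr_ge0// sqr_ge0.
have sq (u : R[i]) (t : R) : normc u <= t -> normc u ^+ 2 <= t ^+ 2.
  by move=> ut; rewrite lerXn2r// nnegrE ?normc_ge0// (le_trans (normc_ge0 u)).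
pose h1 j := if (n <= j)%N then h (j - n)%N else 0.
have h10 j : 0 <= h1 j by rewrite /h1; case: ifP.
have term j : normc (hermitian_band n beta x j) ^+ 2 <= 2 * h (j + n)%N + 2 * h1 j.
  rewrite (le_trans (sqr_normcD_le _ _))// lerD// ler_pM2l//.
    by rewrite normcM exprMn ler_wpM2r ?sqr_ge0// sq.
  rewrite /h1; case: ifP => _; last by rewrite normc0 expr0n.
  by rewrite normcM normc_conj exprMn ler_wpM2r ?sqr_ge0// sq.
apply: le_trans (ler_sum _ (fun (j : 'I_L) _ => term j)) _.
rewrite big_split/= -!mulr_sumr -mulrDr.
rewrite (_ : 4 = 2 * 2 :> R); last by ring.
rewrite -[leRHS]mulrA ler_pM2l// mulr_natl mulr2n lerD//.
  rewrite big_split_ord/= -[leLHS]add0r; apply: lerD; first by apply: sumr_ge0 => i _; exact: h0.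
  by apply: ler_sum => i _; rewrite addnC.
apply: (@le_trans _ _ (\sum_(j < n + L) h1 j)).
  by rewrite addnC big_split_ord/= lerDl sumr_ge0.
rewrite big_split_ord/= big1 ?add0r; last by move=> i _; rewrite /h1 leqNgt ltn_ord.
rewrite addnC big_split_ord/= -[leLHS]addr0; apply: lerD; last by apply: sumr_ge0 => i _; exact: h0.
by apply: ler_sum => i _; rewrite /h1 leq_addr addKn.
Qed.

Lemma hermitian_band_le n beta x (B e M : R) N L :
  (forall j, normc (beta j) <= B) -> (forall j, (N <= j)%N -> normc (beta j) <= e) ->
  (forall L', \sum_(k < L') normc (x k) ^+ 2 <= M) ->
  \sum_(j < L) normc (hermitian_band n beta x j) ^+ 2 <=
  4 * (B ^+ 2 * \sum_(i < N + n) normc (x i) ^+ 2 + e ^+ 2 * M).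
Proof.
move=> bB be xM.
(* The threshold is [N + n] because [x i] also meets [beta (i - n)], which is small only for
   [N <= i - n]. *)
pose w i := if (i < N + n)%N then B else e.
apply: le_trans (@sum_hermitian_band_le n beta w x L _ _) _.
- move=> j; rewrite /w; case: ltnP => // h.
  by apply: be; rewrite (leq_trans _ h)// leq_addr.
- by move=> j; rewrite /w ltn_add2r; case: ltnP => // h; exact: be.
rewrite ler_pM2l//.
pose a i := normc (x i) ^+ 2.
have a0 i : 0 <= a i by rewrite sqr_ge0.
apply: (@le_trans _ _ (\sum_(i < N + n + (n + L))
   (B ^+ 2 * (if (i < N + n)%N then a i else 0) + e ^+ 2 * a i))).
  rewrite [leRHS](_ : _ = \sum_(i < (n + L) + (N + n))
   (B ^+ 2 * (if (i < N + n)%N then a i else 0) + e ^+ 2 * a i)); last by rewrite addnC.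
  rewrite [leRHS]big_split_ord/= -[leLHS]addr0; apply: lerD.
    apply: ler_sum => i _; rewrite /w; case: ifP => _.
      by rewrite lerDl mulr_ge0// sqr_ge0.
    by rewrite mulr0 add0r.
  apply: sumr_ge0 => i _; rewrite addr_ge0// mulr_ge0 ?sqr_ge0//.
  by case: ifP.
rewrite big_split/= -!mulr_sumr lerD//; last first.
  by apply: ler_wpM2l; [exact: sqr_ge0|exact: xM].
rewrite ler_wpM2l ?sqr_ge0// big_split_ord/= [X in _ + X]big1 ?addr0.
  by apply: ler_sum => i _; rewrite ltn_ord.
by move=> i _; rewrite ltnNge leq_addr.
Qed.

(** By compactness there is a cluster point, and a cluster point of an ultrafilter is a limit. A
    single ultrafilter thus makes all coordinates converge at once. *)
Lemma ultra_bounded_cvg {T : Type} (U : set_system T) (f : T -> R) (M : R) :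
  UltraFilter U -> (forall t, `|f t| <= M) -> exists l : R, f t @[t --> U] --> l.
Proof.
move=> UU fM.
have [|l [_ cl]] := @segment_compact R (- M) M (f @ U) _.
  apply: (@filterE _ U _ (f @^-1` `[- M, M])) => t.
  by have := fM t; rewrite ler_norml /= in_itv.
exists l => A lA.
have [//|UA] := in_ultra_setVsetC (f @^-1` A) UU.
by have [y [/= nAy Ay]] := cl (~` A) A UA lA.
Qed.

Lemma ultra_bounded_ccvg {T : Type} (U : set_system T) (f : T -> R[i]) (M : R) :
  UltraFilter U -> (forall t, normc (f t) <= M) -> exists l, ccvg U f l.
Proof.
move=> UU fM.
have [a ha] := @ultra_bounded_cvg T U (fun t => complex.Re (f t)) M UU
  (fun t => le_trans (Re_le_normc _) (fM t)).
have [b hb] := @ultra_bounded_cvg T U (fun t => complex.Im (f t)) M UU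
  (fun t => le_trans (Im_le_normc _) (fM t)).
by exists (a +i* b).
Qed.

(** Turns the good indices that the ultrafilter provides arbitrarily far into an increasing
    sequence. *)
Lemma seq_frequently (P : nat -> nat -> Prop) :
  (forall m N, exists2 j, (N < j)%N & P m j) ->
  exists2 s : nat -> nat, {homo s : i j / (i < j)%N} & forall m, P m (s m).
Proof.
move=> h.
have /choice[g hg] (p : nat * nat) : exists j, (p.2 < j)%N /\ P p.1 j.
  by have [j pj Pj] := h p.1 p.2; exists j.
pose s := fix s m := if m is m'.+1 then g (m, s m') else g (0%N, 0%N).
exists s; last by case=> [|m]; exact: (hg (_, _)).2.
apply: homo_ltn => [? ? ?|m]; first exact: ltn_trans.
exact: (hg (m.+1, s m)).1.
Qed.

Lemma hermitian_band_compact n beta :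
  (forall e : R, 0 < e -> exists N, forall j, (N <= j)%N -> normc (beta j) <= e) ->
  compact_operator (hermitian_band n beta).
Proof.
move=> beta0.
have [B bB] : exists B : R, forall j, normc (beta j) <= B.
  have [N hN] := beta0 1 ltr01.
  exists (1 + \sum_(i < N) normc (beta i)) => j.
  have s0 : 0 <= \sum_(i < N) normc (beta i) by apply: sumr_ge0 => i _; exact: normc_ge0.
  have [Nj|jN] := leqP N j; first by rewrite (le_trans (hN _ Nj))// lerDl.
  rewrite (bigD1 (Ordinal jN))//= addrCA lerDl addr_ge0// sumr_ge0// => i _.
  exact: normc_ge0.
split=> [x /l2P[M xM]|a x y _ _|x M /= xM].
- apply/l2P; have [N hN] := beta0 1 ltr01.
  exists (4 * (B ^+ 2 * \sum_(i < N + n) normc (x i) ^+ 2 + 1 ^+ 2 * M)) => L.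
  exact: hermitian_band_le.
- exact: hermitian_band_linear.
have {}xM j := (l2norm2_leP (x j) M).1 (xM j).
have M0 : 0 <= M by have := xM 0%N 0%N; rewrite big_ord0.
have xkM j k : normc (x j k) <= Num.sqrt M.
  rewrite -[leLHS]ger0_norm ?normc_ge0// -sqrtr_sqr ler_wsqrtr//.
  rewrite (le_trans _ (xM j k.+1))// big_ord_recr/= lerDr.
  by apply: sumr_ge0 => i _; rewrite sqr_ge0.
have [U [UU Uoo]] := @ultraFilterLemma nat \oo _.
have /choice[z xz] k : exists l, ccvg U (fun j => x j k) l.
  exact: (ultra_bounded_ccvg UU (fun j => xkM j k)).
(* Finite sums of squares pass to the limit, so [z] inherits the bound [M]. *)
have zM L : \sum_(k < L) normc (z k) ^+ 2 <= M.
  apply: (@cvgr_to_le _ U _ _ (fun j => \sum_(k < L) normc (x j k) ^+ 2)).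
    apply: cvg_big => [|k _]; first exact: add_continuous.
    rewrite expr2; under eq_fun do rewrite expr2.
    by apply: cvgM; apply: ccvg_normc.
  exact: nearW.
have near0 e : 0 < e -> \forall j \near U, forall L,
    \sum_(k < L) normc (hermitian_band n beta (x j) k - hermitian_band n beta z k) ^+ 2 <= e.
  (* The sums of squares of [x j - z] being at most [4 * M], the far entries contribute at most
     [16 * d ^+ 2 * M], which is below [e / 2]; [M + 1] avoids a division by 0. *)
  move=> e0; pose d := Num.sqrt (e / (32 * (M + 1))).
  have M1 : 0 < 32 * (M + 1) by rewrite mulr_gt0// ltr_wpDl.
  have d0 : 0 < d by rewrite sqrtr_gt0 divr_gt0.
  have [N hN] := beta0 d d0.
  have dM j L : \sum_(k < L) normc (x j k - z k) ^+ 2 <= 4 * M.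
    apply: (@le_trans _ _ (\sum_(k < L) (2 * normc (x j k) ^+ 2 + 2 * normc (z k) ^+ 2))).
      by apply: ler_sum => k _; rewrite -[X in _ <= _ + 2 * X ^+ 2]normcN sqr_normcD_le.
    rewrite big_split/= -!mulr_sumr.
    by have h1 := xM j L; have h2 := zM L; lra.
  have h0 : 4 * (B ^+ 2 * \sum_(i < N + n) normc (x j i - z i) ^+ 2) @[j --> U] -->
      (4 * (B ^+ 2 * \sum_(i < N + n) 0) : R).
    apply: cvgM; [exact: cvg_cst|apply: cvgM; [exact: cvg_cst|]].
    apply: cvg_big => [|i _]; first exact: add_continuous.
    rewrite -(mulr0 (0 : R)); under eq_fun do rewrite expr2.
    by apply: cvgM; apply/ccvgP.
  rewrite big1// !mulr0 in h0.
  have h1 : \forall j \near U,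
      4 * (B ^+ 2 * \sum_(i < N + n) normc (x j i - z i) ^+ 2) <= e / 2.
    by apply: (cvgr_le _ h0); rewrite divr_gt0.
  apply: filterS h1 => j hj L.
  under eq_bigr do rewrite hermitian_bandB.
  apply: le_trans (hermitian_band_le n L bB hN (dM j)) _.
  rewrite mulrDr (splitr e) lerD// sqr_sqrtr; last by rewrite ltW// divr_gt0.
  rewrite [leLHS](_ : _ = e / 2 * (M / (M + 1))); last first.
    by field; rewrite gt_eqF// ltr_wpDl.
  apply: ler_piMr; first by rewrite divr_ge0// ltW.
  by rewrite ler_pdivrMr ?ltr_wpDl// mul1r lerDl.
have [|s s_incr hs] := @seq_frequently (fun m j => forall L,
    \sum_(k < L) normc (hermitian_band n beta (x j) k - hermitian_band n beta z k) ^+ 2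
      <= m.+1%:R^-1).
  (* [U] refines [\oo], so each of its sets meets every tail. *)
  move=> m N; have /filter_ex[j [h Nj]] :
      \forall j \near U, (forall L, \sum_(k < L) normc (hermitian_band n beta (x j) k -
        hermitian_band n beta z k) ^+ 2 <= m.+1%:R^-1) /\ (N < j)%N.
    apply: filterI; first by apply: near0; rewrite invr_gt0.
    by apply: Uoo; exact: nbhs_infty_gt.
  by exists j.
exists s, (hermitian_band n beta z); split=> //.
  have [N hN] := beta0 1 ltr01; apply/l2P.
  exists (4 * (B ^+ 2 * \sum_(i < N + n) normc (z i) ^+ 2 + 1 ^+ 2 * M)) => L.
  exact: hermitian_band_le.
apply: (@squeeze_cvge _ _ _ _ (fun=> 0%E) _ (fun m => (m.+1%:R^-1)%:E)).
- apply: nearW => m; apply/andP; split; last by apply/l2norm2_leP; exact: hs.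
  by apply: nneseries_ge0 => k _ _; rewrite lee_fin sqr_ge0.
- exact: cvg_cst.
- by apply: cvg_EFin; [exact: nearW|exact: cvg_harmonic].
Qed.

End Compactness.

(** * Powers of the shifts, and the compact perturbation *)

Lemma iter_left_shift {R : realType} (x : nat -> R[i]) n j :
  iter n left_shift x j = x (j + n)%N.
Proof. by elim: n j => [|n ih] j; rewrite ?addn0// iterS /left_shift ih addSnnS. Qed.

Lemma iter_right_shift {R : realType} (x : nat -> R[i]) n j :
  iter n right_shift x j = if (n <= j)%N then x (j - n)%N else 0.
Proof.
elim: n j => [|n ih] [|j]; rewrite ?subn0//.
by rewrite iterS/= ih ltnS subSS.
Qed.

Theorem theorem3p1 (R : realType) (mu : probability (measurableTypeR R) R)
    (mu01 : mu `[0%R, 1%R]%classic = 1%E)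
    (supp1 : supp mu 1)
    (mu1 : mu [set 1%R] = 0%E)
    (n : nat) (n_ge1 : (1 <= n)%N)
    (q q' : R -> R[i]) (qLinfty : Linfty01 mu q) (qC1 : C1_near1 q q') :
  let alpha : R[i] := q' 1 / (2 * n)%:R in
  exists K : (nat -> R[i]) -> (nat -> R[i]),
    compact_operator K /\
    forall (N : nat) (c : nat -> R[i]),
      let f : R[i] -> R[i] := fun z => \sum_(k < N) c k * e_ mu k z in
      forall j : nat,
        coords mu (J_op mu n q f) j
          - (alpha * iter n left_shift (coords mu f) j
             + (alpha^*)%C * iter n right_shift (coords mu f) j)
        = K (coords mu f) j.
Proof.
move=> alpha.
(* Both [J] and the model operator are band matrices on the same diagonals, so the difference is
   again one, and its entries tend to 0 by [band_limit]. *)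
exists (hermitian_band n (fun k => band mu n q k - alpha)); split.
  apply: hermitian_band_compact => e e0.
  exact: (band_limit mu01 mu1 supp1 qLinfty qC1 n_ge1 e0).
move=> N c f j.
have fc : coords mu f = fun k => if (k < N)%N then c k else 0.
  by apply/funext => k; exact: (coords_comb mu01 mu1 supp1 N c k).
rewrite (J_coords mu01 mu1 supp1 n qLinfty j (fin_comb mu01 mu1 supp1 N c)).
rewrite fc iter_left_shift iter_right_shift /hermitian_band.
case: (n <= j)%N; last by ring.
by rewrite rmorphB/=; ring.
Qed.
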